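(* Let $d\ge1$, $T>0$, let $f:\mathbb{R}\to\mathbb{R}^d$ and $A:\mathbb{R}\to\mathbb{R}$ be Lipschitz continuous, with $A$ non-decreasing and $A(0)=0$, and let $\mu$ be a positive Radon measure on $\mathbb{R}^d\setminus\{0\}$ with $\int_{|z|>0}\min(|z|^2,1)\,\mu(dz)<\infty$. Let $u$ and $v$ be two entropy solutions, with initial data $u_0$ and $v_0$ respectively, of the initial value problem $$\partial_tu+\nabla\cdot f(u)=g_\mu[A(u)]\ \text{ in }Q_T=\mathbb{R}^d\times(0,T),\qquad u(\cdot,0)=u_0\text{ in }\mathbb{R}^d .$$ Then, for all $t\in(0,T)$, $$\|u(\cdot,t)-v(\cdot,t)\|_{L^1(\mathbb{R}^d)}\le\|u_0-v_0\|_{L^1(\mathbb{R}^d)}.$$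
   Context: The Lévy operator (acting in the space variable) is $g_\mu[\phi](x)=\int_{|z|>0}\phi(x+z)-\phi(x)-z\cdot\nabla\phi(x)\mathbf 1_{|z|<1}\,\mu(dz)$. For $r>0$ define $$g_{\mu,r}^*[\varphi](x)=\int_{0<|z|\le r}\varphi(x-z)-\varphi(x)+z\cdot\nabla\varphi(x)\mathbf 1_{|z|<1}\,\mu(dz),$$ $$g_\mu^r[\varphi](x)=\int_{|z|>r}\varphi(x+z)-\varphi(x)\,\mu(dz),\qquad \gamma_\mu^r=\int_{r<|z|<1}z\,\mu(dz)\in\mathbb{R}^d.$$ For $k\in\mathbb{R}$: $\eta_k(u)=|u-k|$, $\eta_k'(u)=\mathrm{sgn}(u-k)$ with $\mathrm{sgn}(0)=0$, $q_k(u)=\eta_k'(u)(f(u)-f(k))$. Entropy solution: a function $u$ is an entropy solution with initial datum $u_0$ if (i) $u\in L^\infty(Q_T)\cap C([0,T];L^1(\mathbb{R}^d))$; (ii) for all $k\in\mathbb{R}$, all $r>0$ and all nonnegative $\varphi\in C_c^\infty(Q_T)$, $$\iint_{Q_T}\eta_k(u)\partial_t\varphi+q_k(u)\cdot\nabla\varphi+\eta_{A(k)}(A(u))\,g_{\mu,r}^*[\varphi]+\eta_k'(u)\,g_\mu^r[A(u)]\,\varphi+\eta_{A(k)}(A(u))\,\gamma_\mu^r\cdot\nabla\varphi\;dx\,dt\ge0;$$ (iii) $u(\cdot,0)=u_0$ a.e. *)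

(* Defs.v *)
From HB Require Import structures.
From mathcomp Require Import all_boot all_order all_algebra.
From mathcomp Require Import all_classical all_reals all_analysis.
From mathcomp Require Import measurable_realfun.
Set Implicit Arguments.
Unset Strict Implicit.
Unset Printing Implicit Defensive.
Import Order.TTheory GRing.Theory Num.Theory.
Import numFieldNormedType.Exports.
Local Open Scope classical_set_scope.
Local Open Scope ring_scope.

(* R^n is 'rV[R]_n with the product sigma-algebra, which is the Borel one
   (measurable_rV_Borel). *)
Definition measure_rV_display : measure_display.
Proof. exact: default_measure_display. Qed.

Section measurable_rV.
Variables (R : realType) (n : nat).

Definition rV_coord (i : 'I_n) (v : 'rV[R]_n) : R := v 0 i.

Let rV_set0 : g_sigma_preimage rV_coord set0.
Proof. exact: sigma_algebra0. Qed.

Let rV_setC A : g_sigma_preimage rV_coord A -> g_sigma_preimage rV_coord (~` A).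
Proof. exact: sigma_algebraC. Qed.

Let rV_bigcup (F : (set 'rV[R]_n)^nat) :
  (forall i, g_sigma_preimage rV_coord (F i)) ->
  g_sigma_preimage rV_coord (\bigcup_i (F i)).
Proof. exact: sigma_algebra_bigcup. Qed.

HB.instance Definition _ := @isMeasurable.Build measure_rV_display
  'rV[R]_n (g_sigma_preimage rV_coord) rV_set0 rV_setC rV_bigcup.

Lemma measurable_coord (i : 'I_n) : measurable_fun setT (rV_coord i).
Proof.
move=> _ Y mY; rewrite setTI; apply: sub_sigma_algebra => /=.
rewrite -bigcup_seq/=; exists i => /=; first by rewrite mem_index_enum.
by exists Y => //; rewrite setTI.
Qed.

Lemma measurable_fun_rVP d (T : measurableType d) (f : T -> 'rV[R]_n) :
  (forall i, measurable_fun setT (fun x => f x 0 i)) -> measurable_fun setT f.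
Proof.
move=> mf _ A; rewrite setTI; move: A.
apply: smallest_sub.
  split=> [|A mA|F mF]; first by rewrite preimage_set0.
  - by rewrite setTD preimage_setC; exact: measurableC.
  - by rewrite preimage_bigcup; exact: bigcup_measurable.
rewrite -bigcup_seq => A [i /= _ [B mB <-]].
rewrite setTI -[X in measurable X]setTI; exact: mf.
Qed.

Lemma measurable_rV_box (A : 'I_n -> set R) : (forall i, measurable (A i)) ->
  measurable [set v : 'rV[R]_n | forall i, A i (v 0 i)].
Proof.
move=> mA; rewrite (_ : mkset _ =
    \bigcap_(i in [set: 'I_n]) (rV_coord i @^-1` A i)); last first.
  by apply/seteqP; split=> v /= + i; [move=> /(_ i)|move=> /(_ i I)].
apply: fin_bigcap_measurable => // i _.
by rewrite -[X in measurable X]setTI; exact: measurable_coord.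
Qed.

Lemma open_measurable_rV (U : set 'rV[R]_n) : open U -> measurable U.
Proof.
move=> oU.
pose B (p : 'rV[rat]_n * nat) := [set v : 'rV[R]_n | forall i,
  ball (ratr (p.1 0 i) : R) p.2.+1%:R^-1 (v 0 i)].
have mB p : measurable (B p).
  by apply: (@measurable_rV_box (fun i => ball _ _)) => i; exact: measurable_ball.
pose C p := if `[< B p `<=` U >] then B p else set0.
rewrite (_ : U = \bigcup_p C p).
  apply: countable_bigcupT_measurable => // p.
  by rewrite /C; case: ifPn => // _; exact: measurable0.
apply/seteqP; split=> [v Uv|v [p _]]; last first.
  by rewrite /C; case: ifPn => // /asboolP; exact.
have /nbhs_ballP[e /= e0 veU] : nbhs v U by exact: open_nbhs_nbhs.
have [k] := @ltr_add_invr R 0 (e / 2) ltac:(by rewrite divr_gt0).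
rewrite add0r => ke.
have k0 : 0 < k.+1%:R^-1 :> R by rewrite invr_gt0.
have qP i : exists q : rat, ball (ratr q : R) k.+1%:R^-1 (v 0 i).
  have /rat_in_itvoo[q] : v 0 i < v 0 i + k.+1%:R^-1 by rewrite ltrDl.
  rewrite in_itv/= => /andP[vq qv]; exists q.
  by rewrite /ball/= gtr0_norm ?subr_gt0// ltrBlDl.
have [q {}qP] := choice qP.
have BU : B (\row_i q i, k) `<=` U.
  move=> w /= Bw; apply: veU; split=> // i j; rewrite !ord1.
  apply: (@le_ball _ _ _ (k.+1%:R^-1 + k.+1%:R^-1)).
    by rewrite [leRHS]splitr lerD// ltW.
  apply: (@ball_triangle _ _ (ratr (q j) : R)); first exact/ball_sym.
  by have := Bw j; rewrite mxE.
exists (\row_i q i, k) => //; rewrite /C asboolT// => i /=.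
by rewrite mxE.
Qed.

Lemma measurable_rV_Borel : @measurable _ 'rV[R]_n = <<s @open 'rV[R]_n >>.
Proof.
apply/seteqP; split; last first.
  apply: smallest_sub; first exact: sigma_algebra_measurable.
  by move=> U; exact: open_measurable_rV.
apply: smallest_sub; first exact: smallest_sigma_algebra.
rewrite -bigcup_seq => A [i /= _ [B mB <-]]; rewrite setTI.
have mc : measurable_fun setT
    (@rV_coord i : g_sigma_algebraType (@open 'rV[R]_n) -> R).
  apply: (measurability _ (RGenOpens.measurableE R)) => _ [_ [x [y ->]] <-].
  rewrite setTI; apply: sub_sigma_algebra.
  apply: open_comp; last exact: interval_open.
  by move=> v _; exact: coord_continuous.
by have := mc measurableT B mB; rewrite setTI.
Qed.

End measurable_rV.

Section lebesgue_rV.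
Variable R : realType.

Definition rV_cons n (p : R * 'rV[R]_n) : 'rV[R]_n.+1 :=
  \row_i oapp (p.2 0) p.1 (unlift 0 i).

Lemma rV_cons0 n (p : R * 'rV[R]_n) : rV_cons p 0 0 = p.1.
Proof. by rewrite mxE unlift_none. Qed.

Lemma rV_consS n (p : R * 'rV[R]_n) i : rV_cons p 0 (lift 0 i) = p.2 0 i.
Proof. by rewrite mxE liftK. Qed.

Lemma measurable_rV_cons n : measurable_fun setT (@rV_cons n).
Proof.
apply: measurable_fun_rVP => i; case: (unliftP 0 i) => [j ->|->].
  rewrite (_ : (fun _ => _) = @rV_coord R n j \o snd); last first.
    by apply/funext => p; rewrite rV_consS.
  exact: measurableT_comp (measurable_coord j) measurable_snd.
rewrite (_ : (fun _ => _) = fst) //.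
by apply/funext => p; rewrite rV_cons0.
Qed.

Definition rV_uncons n (v : 'rV[R]_n.+1) : R * 'rV[R]_n :=
  (v 0 0, \row_i v 0 (lift 0 i)).

Lemma rV_consK n : cancel (@rV_cons n) (@rV_uncons n).
Proof.
case=> a v; rewrite /rV_uncons rV_cons0; congr pair.
by apply/rowP => i; rewrite mxE rV_consS.
Qed.

Lemma measurable_rV_uncons n : measurable_fun setT (@rV_uncons n).
Proof.
apply/measurable_fun_pairP; split; first exact: measurable_coord.
apply: measurable_fun_rVP => i.
rewrite (_ : (fun _ => _) = @rV_coord R n.+1 (lift 0 i)).
  exact: measurable_coord.
by apply/funext => v; rewrite /= mxE.
Qed.

Section lebesgue_rVS.
Variables (n : nat) (m : {sigma_finite_measure set 'rV[R]_n -> \bar R}).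

Definition lebesgue_rVS : set 'rV[R]_n.+1 -> \bar R :=
  pushforward (lebesgue_measure \x m)%E (@rV_cons n).

Let measurable_pre A : measurable A -> measurable (@rV_cons n @^-1` A).
Proof.
by move=> mA; rewrite -[X in measurable X]setTI; exact: measurable_rV_cons.
Qed.

Let lebesgue_rVS0 : lebesgue_rVS set0 = 0%E.
Proof. by rewrite /lebesgue_rVS /pushforward preimage_set0 measure0. Qed.

Let lebesgue_rVS_ge0 A : (0 <= lebesgue_rVS A)%E.
Proof. by rewrite /lebesgue_rVS /pushforward. Qed.

Let lebesgue_rVS_sigma_additive : semi_sigma_additive lebesgue_rVS.
Proof.
move=> F mF tF mUF; rewrite /lebesgue_rVS /pushforward preimage_bigcup.
apply: measure_semi_sigma_additive.
- by move=> k; exact: measurable_pre.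
- apply/trivIsetP => i j _ _ ij; rewrite -preimage_setI.
  by move/trivIsetP : tF => /(_ _ _ I I ij) ->; rewrite preimage_set0.
- by rewrite -preimage_bigcup; exact: measurable_pre.
Qed.

HB.instance Definition _ := isMeasure.Build _ _ _ lebesgue_rVS
  lebesgue_rVS0 lebesgue_rVS_ge0 lebesgue_rVS_sigma_additive.

Let lebesgue_rVS_sigma_finite : sigma_finite setT lebesgue_rVS.
Proof.
have /sigma_finiteP[F [FT ndF Foo]] := sigma_finiteT (@lebesgue_measure R).
have /sigma_finiteP[G [GT ndG Goo]] := sigma_finiteT m.
exists (fun k => @rV_uncons n @^-1` (F k `*` G k)) => [|k].
  rewrite -preimage_bigcup; apply/esym/seteqP; split=> // v _ /=.
  have [i _ Fi] : (\bigcup_i F i) (v 0 0) by rewrite -FT.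
  have [j _ Gj] : (\bigcup_i G i) (\row_i v 0 (lift 0 i)) by rewrite -GT.
  exists (maxn i j) => //; split => /=.
    by apply: subsetPset Fi; exact/ndF/leq_maxl.
  by apply: subsetPset Gj; exact/ndG/leq_maxr.
have [[mF Fky] [mG Gky]] := (Foo k, Goo k); split.
  rewrite -[X in measurable X]setTI; apply: measurable_rV_uncons => //.
  exact: measurableX.
rewrite /lebesgue_rVS /pushforward -comp_preimage.
rewrite (_ : _ \o _ = id) ?preimage_id; last by apply/funext; exact: rV_consK.
by rewrite product_measure1E// lte_mul_pinfty// ge0_fin_numE.
Qed.

HB.instance Definition _ := @Measure_isSigmaFinite.Build _ _ _
  lebesgue_rVS lebesgue_rVS_sigma_finite.

End lebesgue_rVS.

(* n-dimensional Lebesgue measure as an iterated product, transported along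
   R * R^n ~ R^n.+1; lebesgue_rV_box gives its value on boxes. *)
Fixpoint lebesgue_rV n : {sigma_finite_measure set 'rV[R]_n -> \bar R} :=
  match n with
  | 0 => dirac (0 : 'rV[R]_0)
  | n'.+1 => lebesgue_rVS (lebesgue_rV n')
  end.

Lemma lebesgue_rV_box n (A : 'I_n -> set R) : (forall i, measurable (A i)) ->
  lebesgue_rV n [set v | forall i, A i (v 0 i)] =
  (\prod_(i < n) lebesgue_measure (A i))%E.
Proof.
elim: n A => [|n IHn] A mA /=.
  by rewrite big_ord0 diracE mem_set// => -[].
rewrite /lebesgue_rVS /pushforward.
have mB : measurable [set v : 'rV[R]_n | forall i, A (lift 0 i) (v 0 i)].
  exact: (@measurable_rV_box R n (fun i => A (lift 0 i))).
rewrite big_ord_recl -(IHn (fun i => A (lift 0 i)))// -product_measure1E//;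
  last exact: mA.
congr (_ _); apply/seteqP; split=> -[a v] /=.
  move=> h; split=> [|i]; first by have := h 0; rewrite rV_cons0.
  by have := h (lift 0 i); rewrite rV_consS.
move=> [Aa Av] i.
by case: (unliftP 0 i) => [j ->|->]; rewrite ?rV_consS ?rV_cons0.
Qed.

End lebesgue_rV.

Section euclidean.
Context {R : realType} {d : nat}.
Implicit Types x y : 'rV[R]_d.

Definition dotv x y : R := \sum_(i < d) x 0 i * y 0 i.

(* The norm `|x| provided by the library on 'rV[R]_d is the sup norm. *)
Definition enorm x : R := Num.sqrt (dotv x x).

Definition grad (phi : 'rV[R]_d -> R) x : 'rV[R]_d :=
  \row_(i < d) 'D_(delta_mx 0 i) phi x.

End euclidean.

Section test_functions.
Context {R : realType}.

(* All iterated directional derivatives up to order k exist everywhere and are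
   continuous; in finite dimension this is the usual class C^k. *)
Fixpoint Ck {V : normedModType R} (k : nat) (phi : V -> R) : Prop :=
  continuous phi /\
  match k with
  | 0 => True
  | k'.+1 => forall v, (forall x, derivable phi x v) /\ Ck k' ('D_v phi)
  end.

(* C_c^oo(Q): such a function is identified with its extension by 0. *)
Definition test_function {V : normedModType R} (Q : set V) (phi : V -> R) :=
  [/\ forall k, Ck k phi,
      compact (closure [set p | phi p != 0]) &
      closure [set p | phi p != 0] `<=` Q].

End test_functions.

Section levy_measure.
Context {R : realType} {d : nat}.
Implicit Type mu : {measure set 'rV[R]_d -> \bar R}.

Definition radon_on (U : set 'rV[R]_d) mu :=
  (forall K, compact K -> K `<=` U -> (mu K < +oo)%E) /\
  (forall B, measurable B -> B `<=` U ->
    mu B = ereal_sup [set mu K | K in [set K | compact K /\ K `<=` B]]).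

(* A measure on R^d \ {0} is represented by a measure on R^d, all notions below
   ignoring the mass at the origin. *)
Definition levy_measure mu :=
  radon_on [set z | z != 0] mu /\
  (\int[mu]_(z in [set z | (0 < enorm z)%R])
     (Num.min (enorm z ^+ 2) 1)%:E < +oo)%E.

Definition levy_near mu (r : R) (phi : 'rV[R]_d -> R) (x : 'rV[R]_d) : R :=
  \int[mu]_(z in [set z | 0 < enorm z <= r])
    (phi (x - z) - phi x + dotv z (grad phi x) * (enorm z < 1)%R%:R).

Definition levy_far mu (r : R) (phi : 'rV[R]_d -> R) (x : 'rV[R]_d) : R :=
  \int[mu]_(z in [set z | r < enorm z]) (phi (x + z) - phi x).

Definition levy_drift mu (r : R) : 'rV[R]_d :=
  \row_(i < d) \int[mu]_(z in [set z | r < enorm z < 1]) z 0 i.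

End levy_measure.

Section entropy.
Context {R : realType} {d : nat}.
Variables (f : R -> 'rV[R]_d) (A : R -> R).
Variables (mu : {measure set 'rV[R]_d -> \bar R}) (T : R).
Implicit Types u phi : 'rV[R]_d * R -> R.

Definition QT : set ('rV[R]_d * R) := [set: 'rV[R]_d] `*` `]0, T[.

Definition eta (k w : R) : R := `|w - k|.

Definition eta' (k w : R) : R := Num.sg (w - k).

Definition entropy_flux (k w : R) : 'rV[R]_d := eta' k w *: (f w - f k).

Definition entropy_integrand u (k r : R) phi (p : 'rV[R]_d * R) : R :=
  let: (x, t) := p in
  let phit y := phi (y, t) in
  eta k (u p) * derive1 (fun s => phi (x, s)) t
  + dotv (entropy_flux k (u p)) (grad phit x)
  + eta (A k) (A (u p)) * levy_near mu r phit x
  + eta' k (u p) * levy_far mu r (fun y => A (u (y, t))) x * phi p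
  + eta (A k) (A (u p)) * dotv (levy_drift mu r) (grad phit x).

(* u is a Borel representative of its class, defined at every time: membership
   in Lfun includes measurability, and every element of
   L^oo(Q_T) /\ C([0,T]; L^1) has such a representative. *)
Record entropy_solution (u0 : 'rV[R]_d -> R) u : Prop := {
  entropy_Loo : u \_ QT \in Lfun (lebesgue_rV R d \x lebesgue_measure)%E +oo%E;
  entropy_L1 : forall t, 0 <= t <= T ->
    (fun x => u (x, t)) \in Lfun (lebesgue_rV R d) 1%E;
  entropy_continuous : forall t, 0 <= t <= T ->
    'N[lebesgue_rV R d]_1[(fun x => (u (x, s) - u (x, t))%:E)]%E
      @[s --> within `[0, T] (nbhs t)] --> 0%E;
  entropy_ineq : forall k r phi, 0 < r -> test_function QT phi ->
    (forall p, 0 <= phi p) ->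
    (0 <= \int[(lebesgue_rV R d \x lebesgue_measure)%E]_(p in QT)
       (entropy_integrand u k r phi p)%:E)%E;
  entropy_init : {ae lebesgue_rV R d, forall x, u (x, 0) = u0 x} }.

End entropy.

(* Main.v *)
(** Kruzkov's doubling of variables. Write the entropy inequality of u at (x, t)
    with k = v(y, s), that of v at (y, s) with k = u(x, t), both with the test
    function moll(x - y) theta(t, s), integrate each in the other pair of
    variables and add. The flux and drift terms cancel because the kernel depends
    on x - y only. The far terms combine into at most the integral over z of
    |A u - A v|(x + z, y + z) - |A u - A v|(x, y) against a kernel invariant under
    the simultaneous shift, which is 0 since the shift preserves Lebesgue measure.
    The near terms are O(int_(|z| <= r) |z|^2 mu(dz)) and vanish as r -> 0. What
    remains is the time derivative: regularised L^1 distances of u and v do not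
    increase from t0 to t1. Continuity of translations in L^1 and of u, v in time
    remove the regularisation, and t0 -> 0 gives the claim. *)
Require Import Defs.
From HB Require Import structures.
From mathcomp Require Import all_boot all_order all_algebra.
From mathcomp Require Import all_classical all_reals all_analysis.
From mathcomp Require Import measurable_realfun ring lra.
Set Implicit Arguments.
Unset Strict Implicit.
Unset Printing Implicit Defensive.
Import Order.TTheory GRing.Theory Num.Theory.
Import numFieldNormedType.Exports.
Local Open Scope classical_set_scope.
Local Open Scope ring_scope.

(** The inequality for u is used one second point q at a time, with k = W q frozen, and only
    afterwards integrated in q. The entropy integrand, whose measurability is not at hand, is first
    majorised by an explicit measurable one ([dbl1] to [dbl5]) in which the near operator is already
    replaced by its bound; [le_integral_any] makes such comparisons legitimate. Solutions are
    extended by 0 outside Q_T, so that Fubini is always used on the whole space. Order of limits: r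
    -> 0 is taken with e fixed, because the constant of the near bound depends on e; afterwards the
    inequality between the regularised distances at t0 and t1 is exact for each small e. One e
    serves as scale in space, in t - s and for the cut-off. The bumps are not normalised: their
    masses are the same at t0 and t1 and are divided out at the end. The monotonicity of A enters
    once, in [sgA]: the sign of u - v is also a sign of A u - A v, and this is what lets the two far
    terms combine. Away from 0 the Levy measure is finite, so the far operator is bounded on L^1;
    near 0 only the quadratic Taylor bound of the mollifier is available. *)

(** * Functions of class C^k on a normed space *)

Section smooth.
Context {R : realType} {V : normedModType R}.
Implicit Types (f g : V -> R) (x v : V).

(** Restricting to the line through x in direction v brings the one-variable chain rule to bear on
    directional derivatives. *)
Lemma is_derive_lineP f x v (df : R) :
  is_derive x v f df <-> is_derive (0 : R) 1 (fun h : R => f (h *: v + x)) df.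
Proof.
have dE : 'D_1 (fun h : R => f (h *: v + x)) 0 = 'D_v f x.
  rewrite /derive; set g1 := fun h => h^-1 *: _; set g2 := fun h => h^-1 *: _.
  suff -> : g1 = g2 by []; rewrite funeqE /g1 /g2 => h /=.
  by rewrite addr0 scale0r add0r [_%:A]mulr1.
split=> -[fx fE]; split.
- exact/(derivable1P f x v).
- by rewrite dE.
- exact/(derivable1P f x v).
- by rewrite -dE.
Qed.

Lemma Ck_continuous k f : Ck k f -> continuous f.
Proof. by case: k => [|k] []. Qed.

(** Introduction rule: a candidate derivative is exhibited for every direction, so that inductions
    on k never compute ['D_v] itself. *)
Lemma CkS k f (D : V -> V -> R) : continuous f ->
  (forall v x, is_derive x v f (D v x)) -> (forall v, Ck k (D v)) -> Ck k.+1 f.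
Proof.
move=> cf df cD; split=> // v; split=> [x|]; first by have [] := df v x.
rewrite (_ : 'D_v f = D v)//.
by apply/funext => x; have [] := df v x.
Qed.

Lemma CkS_derive k f v : Ck k.+1 f -> (forall x, is_derive x v f ('D_v f x)).
Proof. by move=> [_ /(_ v)[df _]] x; exact: derivableP. Qed.

Lemma CkS_Ck k f v : Ck k.+1 f -> Ck k ('D_v f).
Proof. by move=> [_ /(_ v)[]]. Qed.

Lemma CkW k f : Ck k.+1 f -> Ck k f.
Proof.
elim: k f => [|k IH] f [cf df]; split=> // v; have [? ?] := df v.
by split=> //; exact: IH.
Qed.

Lemma Ck_cst k (c : R) : Ck k (fun _ : V => c).
Proof.
elim: k c => [|k IH] c; first by split=> //; exact: cst_continuous.
apply: (@CkS _ _ (fun _ _ => 0)) => [|v].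
- exact: cst_continuous.
- exact: IH.
Qed.

Lemma CkD k f g : Ck k f -> Ck k g -> Ck k (fun x => f x + g x).
Proof.
elim: k f g => [|k IH] f g Cf Cg.
  by split=> // x; apply: continuousD; [exact: Cf.1|exact: Cg.1].
apply: (@CkS _ _ (fun v x => 'D_v f x + 'D_v g x)).
- by move=> x; apply: continuousD; [exact: (Ck_continuous Cf)|
    exact: (Ck_continuous Cg)].
- move=> v x; exact: (is_deriveD (CkS_derive v Cf x) (CkS_derive v Cg x)).
- by move=> v; apply: IH; [exact: (CkS_Ck v Cf)|exact: (CkS_Ck v Cg)].
Qed.

Lemma CkM k f g : Ck k f -> Ck k g -> Ck k (fun x => f x * g x).
Proof.
elim: k f g => [|k IH] f g Cf Cg.
  by split=> // x; apply: continuousM; [exact: Cf.1|exact: Cg.1].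
apply: (@CkS _ _ (fun v x => f x * 'D_v g x + g x * 'D_v f x)).
- by move=> x; apply: continuousM; [exact: (Ck_continuous Cf)|
    exact: (Ck_continuous Cg)].
- move=> v x; exact: (is_deriveM (CkS_derive v Cf x) (CkS_derive v Cg x)).
- by move=> v; apply: CkD; apply: IH; [exact: CkW|exact: (CkS_Ck v Cg)|
    exact: CkW|exact: (CkS_Ck v Cf)].
Qed.

Lemma Ck_prod k (I : Type) (s : seq I) (F : I -> V -> R) :
  (forall i, Ck k (F i)) -> Ck k (fun x => \prod_(i <- s) F i x).
Proof.
move=> CF; elim: s => [|i s IH].
  under eq_fun do rewrite big_nil; exact: Ck_cst.
under eq_fun do rewrite big_cons; exact: CkM.
Qed.

End smooth.

Section affine.
Context {R : realType} {V : normedModType R}.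
Variables (a : V -> R) (l : V -> R).
Hypotheses (ca : continuous a)
  (al : forall (h : R) (v x : V), a (h *: v + x) = h * l v + a x).

Lemma is_derive_affine (g : R -> R) (dg : R) (x v : V) :
  is_derive (a x) 1 g dg -> is_derive x v (g \o a) (l v * dg).
Proof.
move=> gd; apply/is_derive_lineP.
rewrite (_ : (fun h => _) = g \o (fun h : R => h * l v + a x)); last first.
  by apply/funext => h /=; rewrite al.
rewrite mulrC; apply: is_derive1_comp.
  by rewrite mul0r add0r.
have -> : (fun h : R => h * l v + a x) = (l v *: (@id R) + cst (a x)).
  by apply/funext => h; rewrite mulrC.
apply: is_derive_eq.
by rewrite addr0 [_ *: 1]mulr1.
Qed.

(** As l v is a constant, differentiating g o a only replaces g by g': regularity on V is inherited
    from a chain of one-variable derivatives. *)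
Lemma Ck_affineS k (g g' : R -> R) : (forall s : R, is_derive s 1 g (g' s)) ->
  Ck k (g' \o a) -> Ck k.+1 (g \o a).
Proof.
move=> gd Cg; apply: (@CkS _ _ _ _ (fun v x => l v * g' (a x))).
- move=> x; apply: continuous_comp; first exact: ca.
  by apply: differentiable_continuous; apply/derivable1_diffP; have [] := gd (a x).
- by move=> v x; exact: is_derive_affine.
- by move=> v; apply: CkM => //; exact: Ck_cst.
Qed.

End affine.

(** * The flat functions and a smooth bump *)

Section flat.
Context {R : realType}.
Implicit Types x : R.

(* Indexed by n because the derivatives of exp(-1/x) are combinations of the
   x^-n exp(-1/x). *)
Definition flat n x : R := if 0 < x then x^-1 ^+ n * expR (- x^-1) else 0.

Definition dflat n x : R := flat n.+2 x - n%:R * flat n.+1 x.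

Lemma flat_ge0 n x : 0 <= flat n x.
Proof.
rewrite /flat; case: ifPn => // x0.
by rewrite mulr_ge0 ?expR_ge0// exprn_ge0// invr_ge0 ltW.
Qed.

Lemma flat_gt0 n x : 0 < x -> 0 < flat n x.
Proof. by move=> x0; rewrite /flat x0 mulr_gt0 ?expR_gt0// exprn_gt0// invr_gt0. Qed.

Lemma flat_le0 n x : x <= 0 -> flat n x = 0.
Proof. by move=> x0; rewrite /flat ltNge x0. Qed.

(** With y = 1/x this is y^n <= n! e^y, read off the exponential series. *)
Lemma flat_le n x : flat n x <= n`!%:R.
Proof.
rewrite /flat; case: ifPn => // x0.
have y0 : 0 < x^-1 by rewrite invr_gt0.
rewrite expRN ler_pdivrMr ?expR_gt0//.
case: n => [|n].
  by rewrite expr0 mul1r (le_trans _ (expR_ge1Dx _))// lerDl ltW.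
have := @expR_ge1Dxn _ x^-1 n (ltW y0).
have n0 : 0 < n.+1`!%:R :> R by rewrite ltr0n fact_gt0.
move=> h; rewrite mulrC -ler_pdivrMr//; apply: le_trans h.
by rewrite lerDr.
Qed.

(** Trades two indices for a factor x^2; with [flat_le] it makes [flat n] quadratically small at 0,
    which gives the derivative there. *)
Lemma flat_sqr n x : flat n x = x ^+ 2 * flat n.+2 x.
Proof.
rewrite /flat; case: ifPn => [x0|_]; last by rewrite mulr0.
have x0' : x != 0 by rewrite gt_eqF.
by rewrite mulrA !exprS; congr (_ * _); field.
Qed.

Lemma is_derive_flat n x : is_derive x 1 (flat n) (dflat n x).
Proof.
have [x0|x0|->] := ltgtP x 0.
- rewrite /dflat !flat_le0 ?ltW// mulr0 subr0.
  apply: (@near_eq_is_derive _ _ _ (cst 0)).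
  near=> y; rewrite /= flat_le0//; near: y.
  by apply: cvgr_le x0; exact: cvg_id.
- apply: (@near_eq_is_derive _ _ _ (fun y : R => y^-1 ^+ n * expR (- y^-1))).
    near=> y; rewrite /flat ifT//; near: y.
    by apply: cvgr_gt x0; exact: cvg_id.
  have x0' : x != 0 by rewrite gt_eqF.
  have dV : is_derive x 1 (fun y : R => y^-1) (- x ^- 2).
    apply: is_derive_eq.
      apply: (@is_deriveV _ id x 1 1 x0').
    by rewrite [_ *: 1]mulr1.
  have dX := is_deriveX n dV.
  have dE : is_derive x 1 (expR \o (- (fun y : R => y^-1))) (expR (- x^-1) * - - x ^- 2).
    by apply: is_derive1_comp; exact: is_deriveN.
  have dXE := is_deriveM dX dE.
  rewrite (_ : (fun y => _) = (fun y : R => y^-1) ^+ n *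
      (expR \o (- (fun y : R => y^-1)))); last first.
    by apply/funext => y; rewrite fctE exprfctE.
  apply: (is_derive_eq dXE).
  rewrite /dflat /flat x0 exprfctE /=.
  rewrite /GRing.scale/=.
  case: n {dX dXE} => [|n].
    rewrite !mul0r !expr0 mul1r subr0 mulr0 addr0 opprK mulrC.
    by rewrite exprVn.
  rewrite opprK -exprVn !exprS; ring.
- rewrite /dflat !flat_le0// mulr0 subr0.
  (* At 0 the difference quotient is h times [flat n.+2 h], at most |h| (n+2)! in absolute value. *)
  have c0 : (fun h : R => h^-1 *: ((flat n \o shift 0) (h *: 1) - flat n 0)) @ 0^' --> (0 : R).
    apply/cvgr0Pnorm_le => /= e e0.
    near=> h.
    have h0 : h != 0 by near: h; exact: nbhs_dnbhs_neq.
    rewrite /= addr0 [_%:A]mulr1 (flat_le0 _ (lexx 0)) subr0 flat_sqr.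
    rewrite [_ *: _]mulrA expr2 mulrA mulVf// mul1r normrM.
    rewrite (ger0_norm (flat_ge0 _ _)).
    apply: (@le_trans _ _ (`|h| * n.+2`!%:R)); first by rewrite ler_wpM2l// flat_le.
    rewrite -ler_pdivlMr ?ltr0n ?fact_gt0//.
    near: h.
    apply: dnbhs0_le.
    by rewrite divr_gt0// ltr0n fact_gt0.
  split; first by apply/cvg_ex; exists 0.
  exact: cvg_lim c0.
Unshelve. all: by end_near. Qed.

Lemma continuous_flat n : continuous (flat n).
Proof.
by move=> x; apply/differentiable_continuous/derivable1_diffP;
  have [] := is_derive_flat n x.
Qed.

(** Induction on k for all n at once, since [dflat n] involves the indices n+1 and n+2. *)
Lemma Ck_flat (V : normedModType R) (a l : V -> R) k n : continuous a ->
  (forall (h : R) (v y : V), a (h *: v + y) = h * l v + a y) ->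
  Ck k (flat n \o a).
Proof.
move=> ca al; elim: k n => [|k IH] n.
  split=> // x; apply: continuous_comp; [exact: ca|exact: continuous_flat].
apply: (@Ck_affineS _ _ _ _ ca al _ _ (dflat n)); first exact: is_derive_flat.
rewrite (_ : _ \o _ =
  fun y => (flat n.+2 \o a) y + (- n%:R) * (flat n.+1 \o a) y); last first.
  by apply/funext => y; rewrite /= /dflat mulNr.
by apply: CkD => //; apply: CkM => //; exact: Ck_cst.
Qed.

End flat.

Section bump.
Context {R : realType}.
Implicit Types x : R.

Definition bump x : R := flat 0 (1 + x) * flat 0 (1 - x).

Definition dbump x : R :=
  dflat 0 (1 + x) * flat 0 (1 - x) - flat 0 (1 + x) * dflat 0 (1 - x).

Lemma bump_ge0 x : 0 <= bump x.
Proof. by rewrite mulr_ge0// flat_ge0. Qed.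

Lemma flat0_le1 x : flat 0 x <= 1.
Proof. by have := flat_le 0 x; rewrite fact0. Qed.

Lemma bump_le1 x : bump x <= 1.
Proof.
by rewrite -[leRHS]mulr1 ler_pM ?flat_ge0 ?flat0_le1.
Qed.

Lemma bumpN x : bump (- x) = bump x.
Proof. by rewrite /bump opprK mulrC. Qed.

Lemma dbumpN x : dbump (- x) = - dbump x.
Proof. by rewrite /dbump opprK; ring. Qed.

Lemma bump_eq0 x : 1 <= `|x| -> bump x = 0.
Proof.
rewrite /bump ler_normr; case/orP => h.
  by rewrite [X in _ * X]flat_le0 ?mulr0// subr_le0.
rewrite flat_le0 ?mul0r//; lra.
Qed.

Lemma dbump_eq0 x : 1 <= `|x| -> dbump x = 0.
Proof.
rewrite /dbump /dflat ler_normr; case/orP => h.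
  have x1 : 1 - x <= 0 by lra.
  by rewrite !(flat_le0 _ x1) !mulr0 !subr0 mulr0 subr0.
have x1 : 1 + x <= 0 by lra.
by rewrite !(flat_le0 _ x1) !mulr0 !subr0 !mul0r subr0.
Qed.

Lemma bump_gt0 x : `|x| < 1 -> 0 < bump x.
Proof. by rewrite ltr_norml => /andP[? ?]; rewrite mulr_gt0// flat_gt0//; lra. Qed.

Lemma normr_dflat n x : `|dflat n x| <= n.+2`!%:R + n%:R * n.+1`!%:R.
Proof.
rewrite /dflat (le_trans (ler_normB _ _))// normrM normr_nat.
rewrite !(ger0_norm (flat_ge0 _ _)).
by rewrite lerD ?flat_le// ler_wpM2l// flat_le.
Qed.

Lemma dbump_le x : `|dbump x| <= 4.
Proof.
have h y : `|dflat 0 y| <= 2 :> R.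
  by apply: (le_trans (normr_dflat _ _)); rewrite mul0r addr0.
have f1 y : `|flat 0 y| <= 1 :> R by rewrite ger0_norm ?flat_ge0 ?flat0_le1.
rewrite (le_trans (ler_normB _ _))// !normrM.
have -> : 4 = 2 * 1 + 1 * 2 :> R by ring.
by rewrite lerD// ler_pM.
Qed.

Lemma is_derive_onemD x : is_derive x 1 (fun y : R => 1 + y) 1.
Proof.
rewrite (_ : (fun _ => _) = cst 1 + id)//; apply: is_derive_eq.
by rewrite add0r.
Qed.

Lemma is_derive_onemB x : is_derive x 1 (fun y : R => 1 - y) (-1).
Proof.
rewrite (_ : (fun _ => _) = cst 1 - id)//; apply: is_derive_eq.
by rewrite sub0r.
Qed.

Lemma is_derive_bump x : is_derive x 1 bump (dbump x).
Proof.
have d1 := is_derive1_comp (is_derive_flat 0 (1 + x)) (is_derive_onemD x).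
have d2 := @is_derive1_comp R (flat 0) (fun y => 1 - y) x _ _ (is_derive_flat 0 (1 - x)) (is_derive_onemB x).
apply: is_derive_eq (is_deriveM d1 d2) _.
rewrite /dbump /= /GRing.scale/=; ring.
Qed.

Lemma is_derive_continuous (f g : R -> R) :
  (forall x, is_derive x 1 f (g x)) -> continuous f.
Proof.
by move=> fg x; apply/differentiable_continuous/derivable1_diffP;
  have [] := fg x.
Qed.

Lemma continuous_bump : continuous bump.
Proof. exact: is_derive_continuous is_derive_bump. Qed.

Lemma continuous_dbump : continuous dbump.
Proof.
have cp : continuous (fun y : R => 1 + y).
  exact: is_derive_continuous is_derive_onemD.
have cm : continuous (fun y : R => 1 - y).
  exact: is_derive_continuous is_derive_onemB.
have cd : continuous (@dflat R 0).
  rewrite (_ : dflat 0 = flat 2); first exact: continuous_flat.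
  by apply/funext => y; rewrite /dflat mul0r subr0.
move=> x; rewrite /dbump; apply: cvgB; apply: cvgM.
- by apply: (continuous_comp (cp x)); exact: cd.
- by apply: (continuous_comp (cm x)); exact: continuous_flat.
- by apply: (continuous_comp (cp x)); exact: continuous_flat.
- by apply: (continuous_comp (cm x)); exact: cd.
Qed.

Lemma Ck_bump (V : normedModType R) (a l : V -> R) k : continuous a ->
  (forall (h : R) (v y : V), a (h *: v + y) = h * l v + a y) ->
  Ck k (bump \o a).
Proof.
move=> ca al; apply: CkM.
  apply: (@Ck_flat _ _ (fun y => 1 + a y) l) => [y|h v y].
    by apply: continuousD; [exact: cst_continuous|exact: ca].
  by rewrite al; ring.
apply: (@Ck_flat _ _ (fun y => 1 - a y) (fun v => - l v)) => [y|h v y].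
  by apply: continuousB; [exact: cst_continuous|exact: ca].
by rewrite al; ring.
Qed.

Lemma integrable_bump :
  (@lebesgue_measure R).-integrable setT (EFin \o bump).
Proof.
have ib : (@lebesgue_measure R).-integrable `[-1, 1] (EFin \o bump).
  apply: continuous_compact_integrable; first exact: segment_compact.
  by apply: continuous_subspaceT => x; exact: continuous_bump.
move: ib; rewrite integrable_mkcond; last exact: measurable_itv.
rewrite (_ : (EFin \o bump) \_ _ = EFin \o bump); first by [].
apply/funext => x; rewrite patchE /=.
case: ifPn => // /negP; rewrite inE/= in_itv/= -ler_norml => /negP.
by rewrite -ltNge => /ltW/bump_eq0 ->.
Qed.

Lemma bump_primitive : exists B : R -> R, forall x, is_derive x 1 B (bump x).
Proof.
exists (fun x => \int[lebesgue_measure]_(t in [set` `]-oo, x]]) bump t)%R => x.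
have xx : x < x + 1 by rewrite ltrDl.
have [||d1 d2] := @continuous_FTC1 R bump (BInfty R true) x (x + 1) xx _ (ltNyr _).
- by apply: integrableS integrable_bump => //; exact: measurable_itv.
- exact: continuous_bump.
by split=> //; rewrite -derive1E d2.
Qed.

(** A smooth monotone step, constant on either side of [-1, 1]. Which primitive is chosen is
    immaterial: only its derivatives and the differences of its values matter. *)
Definition step : R -> R := sval (cid bump_primitive).

Lemma is_derive_step x : is_derive x 1 step (bump x).
Proof. by rewrite /step; case: cid. Qed.

Lemma is_derive_MVT (f g : R -> R) (a b : R) :
  (forall x, is_derive x 1 f (g x)) -> a <= b ->
  exists2 c, a <= c <= b & f b - f a = g c * (b - a).
Proof.
move=> fg ab.
have cf : {within `[a, b], continuous f}.
  by apply: continuous_subspaceT => x; exact: (is_derive_continuous fg).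
have [c cab fE] := MVT_segment ab (fun x _ => fg x) cf.
by exists c => //; move: cab; rewrite in_itv.
Qed.

Lemma step_le (a b : R) : a <= b -> step a <= step b.
Proof.
move=> ab; rewrite -subr_ge0.
have [c _ ->] := is_derive_MVT is_derive_step ab.
by rewrite mulr_ge0 ?bump_ge0// subr_ge0.
Qed.

Lemma step_ge1 x : 1 <= x -> step x = step 1.
Proof.
move=> x1; apply/eqP; rewrite -subr_eq0.
have [c /andP[c1 _] ->] := is_derive_MVT is_derive_step x1.
by rewrite bump_eq0 ?mul0r// ger0_norm// (le_trans _ c1).
Qed.

Lemma step_leN1 x : x <= -1 -> step x = step (-1).
Proof.
move=> x1; apply/eqP; rewrite eq_sym -subr_eq0.
have [c /andP[_ c1] ->] := is_derive_MVT is_derive_step x1.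
by rewrite bump_eq0 ?mul0r// ler0_norm; lra.
Qed.

Lemma step_itv x : step (-1) <= step x <= step 1.
Proof.
apply/andP; split.
  have [x2|/ltW x2] := leP (-1) x; first exact: step_le.
  by rewrite (step_leN1 x2).
have [x1|/ltW x1] := leP x 1; first exact: step_le.
by rewrite (step_ge1 x1).
Qed.

Lemma continuous_step : continuous step.
Proof. exact: is_derive_continuous is_derive_step. Qed.

Lemma Ck_step (V : normedModType R) (a l : V -> R) k : continuous a ->
  (forall (h : R) (v y : V), a (h *: v + y) = h * l v + a y) ->
  Ck k (step \o a).
Proof.
move=> ca al; case: k => [|k].
  split=> // y; apply: continuous_comp; [exact: ca|exact: continuous_step].
apply: (@Ck_affineS _ _ _ _ ca al _ _ bump); first exact: is_derive_step.
exact: Ck_bump al.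
Qed.

End bump.

(** * Euclidean scalar product and norm *)

Section euclidean_theory.
Context {R : realType} {d : nat}.
Implicit Types x y z : 'rV[R]_d.

Lemma dotvC x y : dotv x y = dotv y x.
Proof. by apply: eq_bigr => i _; rewrite mulrC. Qed.

Lemma dotvDr x y z : dotv x (y + z) = dotv x y + dotv x z.
Proof. by rewrite /dotv -big_split; apply: eq_bigr => i _; rewrite mxE mulrDr. Qed.

Lemma dotvZr c x y : dotv x (c *: y) = c * dotv x y.
Proof. by rewrite /dotv mulr_sumr; apply: eq_bigr => i _; rewrite mxE mulrCA. Qed.

Lemma dotvNr x y : dotv x (- y) = - dotv x y.
Proof. by rewrite -scaleN1r dotvZr mulN1r. Qed.

Lemma dotvNl x y : dotv (- x) y = - dotv x y.
Proof. by rewrite dotvC dotvNr dotvC. Qed.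

Lemma dotvZl c x y : dotv (c *: x) y = c * dotv x y.
Proof. by rewrite dotvC dotvZr dotvC. Qed.

Lemma dotv0r x : dotv x 0 = 0.
Proof. by rewrite /dotv big1// => i _; rewrite mxE mulr0. Qed.

Lemma dotv_ge0 x : 0 <= dotv x x.
Proof. by apply: sumr_ge0 => i _; rewrite -expr2 sqr_ge0. Qed.

Lemma dotv_delta x i : dotv (delta_mx 0 i) x = x 0 i.
Proof.
rewrite /dotv (bigD1 i)//= mxE !eqxx mul1r big1 ?addr0// => j ji.
by rewrite mxE (negbTE ji) andbF mul0r.
Qed.

Lemma enorm_ge0 x : 0 <= enorm x.
Proof. exact: sqrtr_ge0. Qed.

Lemma enorm_sqr x : enorm x ^+ 2 = dotv x x.
Proof. by rewrite sqr_sqrtr// dotv_ge0. Qed.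

Lemma enormZ c x : enorm (c *: x) = `|c| * enorm x.
Proof.
apply/eqP; rewrite -(eqrXn2 (n := 2))// ?mulr_ge0 ?enorm_ge0//.
by rewrite exprMn !enorm_sqr dotvZl dotvZr mulrA -expr2 real_normK// num_real.
Qed.

Lemma enormN x : enorm (- x) = enorm x.
Proof. by rewrite -scaleN1r enormZ normrN1 mul1r. Qed.

Lemma enorm_delta i : enorm (delta_mx 0 i : 'rV[R]_d) = 1.
Proof. by rewrite /enorm dotv_delta mxE !eqxx sqrtr1. Qed.

Lemma coord_le_enorm x i : `|x 0 i| <= enorm x.
Proof.
rewrite -(ler_pXn2r (n := 2)) ?nnegrE ?enorm_ge0//.
rewrite enorm_sqr real_normK ?num_real// /dotv (bigD1 i)//= -expr2 lerDl.
by apply: sumr_ge0 => j _; rewrite -expr2 sqr_ge0.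
Qed.

End euclidean_theory.

(** * Uniform second-order Taylor bounds *)

Section taylor2.
Context {R : realType} {d : nat}.
Implicit Types (g h : 'rV[R]_d -> R) (G H : 'rV[R]_d -> 'rV[R]_d) (x z : 'rV[R]_d).

(** Bounds on value, increment, differential and second-order remainder, uniform in x. Bundled in
    this way they are stable under products, so the mollifier, a product over coordinates, gets its
    quadratic remainder with no Taylor formula in several variables. *)
Definition taylor2 g G := exists2 C : R, 0 <= C & forall x z,
  [/\ `|g x| <= C, `|g (x + z) - g x| <= C * enorm z,
      `|dotv z (G x)| <= C * enorm z &
      `|g (x + z) - g x - dotv z (G x)| <= C * enorm z ^+ 2].

Lemma taylor2_cst c : taylor2 (fun _ => c) (fun _ => 0).
Proof.
exists `|c| => // x z; rewrite subrr dotv0r subr0 normr0.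
by split=> //; rewrite mulr_ge0 ?exprn_ge0 ?enorm_ge0.
Qed.

Lemma taylor2M g h G H : taylor2 g G -> taylor2 h H ->
  taylor2 (fun x => g x * h x) (fun x => g x *: H x + h x *: G x).
Proof.
move=> [A A0 gA] [B B0 hB]; exists (3 * (A * B)) => [|x z].
  by rewrite !mulr_ge0.
have [g1 g2 g3 g4] := gA x z; have [h1 h2 h3 h4] := hB x z.
have [h5 _ _ _] := hB (x + z) z.
have n0 := enorm_ge0 z; set n := enorm z in n0 g2 g3 g4 h2 h3 h4 *.
have AB0 : 0 <= A * B by rewrite mulr_ge0.
have ABn0 : 0 <= A * B * n by rewrite mulr_ge0.
split.
- have e1 : `|g x| * `|h x| <= A * B by rewrite ler_pM.
  rewrite normrM; lra.
- rewrite (_ : _ - _ = (g (x + z) - g x) * h (x + z) + g x * (h (x + z) - h x)); last by ring.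
  rewrite (le_trans (ler_normD _ _))// !normrM.
  have e1 : `|g (x + z) - g x| * `|h (x + z)| <= A * n * B by rewrite ler_pM.
  have e2 : `|g x| * `|h (x + z) - h x| <= A * (B * n) by rewrite ler_pM.
  nra.
- rewrite dotvDr !dotvZr (le_trans (ler_normD _ _))// !normrM.
  have e1 : `|g x| * `|dotv z (H x)| <= A * (B * n) by rewrite ler_pM.
  have e2 : `|h x| * `|dotv z (G x)| <= B * (A * n) by rewrite ler_pM.
  nra.
- rewrite dotvDr !dotvZr.
  (* Three terms, each at most A B |z|^2: the origin of the factor 3 in the constant. *)
  rewrite (_ : _ - _ = (g (x + z) - g x - dotv z (G x)) * h (x + z)
    + g x * (h (x + z) - h x - dotv z (H x))
    + dotv z (G x) * (h (x + z) - h x)); last by ring.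
  rewrite (le_trans (ler_normD _ _))// !normrM.
  have e0 := ler_normD ((g (x + z) - g x - dotv z (G x)) * h (x + z))
    (g x * (h (x + z) - h x - dotv z (H x))).
  rewrite !normrM in e0.
  have e1 : `|g (x + z) - g x - dotv z (G x)| * `|h (x + z)| <= A * n ^+ 2 * B.
    by rewrite ler_pM.
  have e2 : `|g x| * `|h (x + z) - h x - dotv z (H x)| <= A * (B * n ^+ 2).
    by rewrite ler_pM.
  have e3 : `|dotv z (G x)| * `|h (x + z) - h x| <= A * n * (B * n) by rewrite ler_pM.
  nra.
Qed.

Lemma taylor2_prod (I : Type) (s : seq I) (F : I -> 'rV[R]_d -> R) :
  (forall i, exists G, taylor2 (F i) G) ->
  exists G, taylor2 (fun x => \prod_(i <- s) F i x) G.
Proof.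
move=> tF; elim: s => [|i s [G tG]].
  exists (fun _ => 0); rewrite (_ : (fun _ => _) = fun _ => 1).
    exact: taylor2_cst.
  by apply/funext => x; rewrite big_nil.
have [H tH] := tF i.
exists (fun x => F i x *: G x + (\prod_(j <- s) F j x) *: H x).
rewrite (_ : (fun _ => _) = fun x => F i x * \prod_(j <- s) F j x).
  exact: taylor2M.
by apply/funext => x; rewrite big_cons.
Qed.

(** Along each coordinate axis the remainder divided by h is O(h), so G is forced. This uniqueness
    also drives [taylor2_even]. *)
Lemma taylor2_grad g G : taylor2 g G -> grad g = G.
Proof.
move=> [C C0 gC]; apply/funext => x; apply/rowP => i; rewrite mxE.
have C1 : 0 < C + 1 by rewrite ltr_wpDl.
apply: cvg_lim => //; apply/cvgrPdist_le => /= e e0.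
near=> h; rewrite distrC.
have h0 : h != 0 by near: h; exact: nbhs_dnbhs_neq.
have [_ _ _] := gC x (h *: delta_mx 0 i).
rewrite dotvZl dotv_delta enormZ enorm_delta mulr1 => gh.
rewrite /= [_ + x]addrC.
have -> : h^-1 *: (g (x + h *: delta_mx 0 i) - g x) - G x 0 i =
    h^-1 * (g (x + h *: delta_mx 0 i) - g x - h * G x 0 i).
  by rewrite [h^-1 *: _]/(h^-1 * _) [RHS]mulrBr mulKf.
rewrite normrM normfV mulrC ler_pdivrMr ?normr_gt0//.
rewrite (le_trans gh)// expr2 mulrA ler_wpM2r//.
rewrite (@le_trans _ _ ((C + 1) * `|h|))// ?ler_wpM2r ?lerDl//.
rewrite mulrC -ler_pdivlMr//; near: h; apply: dnbhs0_le.
by rewrite divr_gt0.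
Unshelve. all: by end_near. Qed.

(** A zero of a nonnegative function is a minimum. Applied to the mollifier, it confines the
    gradient kernel to the same box as the kernel. *)
Lemma taylor2_min g G x : taylor2 g G -> (forall y, 0 <= g y) -> g x = 0 -> G x = 0.
Proof.
move=> [C C0 gC] g0 gx0; apply/rowP => i; rewrite mxE; apply/eqP.
have C1 : 0 < C + 1 by rewrite ltr_wpDl.
rewrite -normr_le0 leNgt; apply/negP => Gi0.
(* Let w be the i-th coordinate of G x. The remainder bound at this step gives g <= - w^2/(C+1) + C
   w^2/(C+1)^2 < 0. Using C + 1 instead of C makes the inequality strict and the division safe. *)
pose h := - G x 0 i / (C + 1).
have [_ _ _] := gC x (h *: delta_mx 0 i).
rewrite dotvZl dotv_delta enormZ enorm_delta mulr1 gx0 subr0 => gh.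
have g1 := g0 (x + h *: delta_mx 0 i).
have := le_trans (ler_norm _) gh.
rewrite /h real_normK ?num_real//.
move: Gi0; rewrite normr_gt0; set w := G x 0 i => w0.
have w2 : 0 < w ^+ 2 by rewrite exprn_even_gt0.
apply/negP; rewrite -ltNge.
set gg := g _ in g1 *.
have -> : C * (- w / (C + 1)) ^+ 2 = (w ^+ 2 / (C + 1)) * (C / (C + 1)).
  by field; rewrite gt_eqF.
have -> : gg - - w / (C + 1) * w = gg + w ^+ 2 / (C + 1) by field; rewrite gt_eqF.
have q0 : 0 < w ^+ 2 / (C + 1) by rewrite divr_gt0.
have : C / (C + 1) < 1 by rewrite ltr_pdivrMr// mul1r ltrDl.
nra.
Qed.

(** The field y -> - G (- y) satisfies the same bounds for g, hence is G by uniqueness of the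
    gradient. *)
Lemma taylor2_even g G x : taylor2 g G -> (forall y, g (- y) = g y) ->
  G (- x) = - G x.
Proof.
move=> tg gN; have [C C0 gC] := tg.
have tg' : taylor2 g (fun y => - G (- y)).
  exists C => // y z; have [h1 h2 h3 h4] := gC (- y) (- z).
  rewrite -opprD !gN !enormN ?dotvNl in h1 h2 h3 h4.
  by rewrite dotvNr; split=> //; rewrite normrN in h3 *.
have := taylor2_grad tg; rewrite (taylor2_grad tg').
by move=> /(congr1 (fun F => F x)) => <-; rewrite opprK.
Qed.

End taylor2.

(** * Mollifiers in space and time *)

Section mollifiers.
Context {R : realType}.
Implicit Types e k c s t : R.

Lemma flat0_dist (x z : R) : `|flat 0 (x + z) - flat 0 x| <= 2 * `|z|.
Proof.
wlog z0 : x z / 0 <= z => [h|].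
  have [/h|/ltW z0] := leP 0 z; first exact.
  have := h (x + z) (- z); rewrite addrK distrC normrN; apply.
  by rewrite oppr_ge0.
have [//||c _] := @is_derive_MVT _ (flat 0) (dflat 0) x (x + z).
- exact: is_derive_flat.
- by rewrite lerDl.
move=> ->; rewrite addrC addKr normrM ler_wpM2r//.
by apply: (le_trans (normr_dflat _ _)); rewrite mul0r addr0.
Qed.

Lemma dflat0E : dflat 0 = flat 2 :> (R -> R).
Proof. by apply/funext => y; rewrite /dflat mul0r subr0. Qed.

(** 36 = 4! + 2 * 3! is the bound of [normr_dflat] for n = 2. *)
Lemma flat2_dist (x z : R) : `|flat 2 (x + z) - flat 2 x| <= 36 * `|z|.
Proof.
wlog z0 : x z / 0 <= z => [h|].
  have [/h|/ltW z0] := leP 0 z; first exact.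
  have := h (x + z) (- z); rewrite addrK distrC normrN; apply.
  by rewrite oppr_ge0.
have [//||c _] := @is_derive_MVT _ (flat 2) (dflat 2) x (x + z).
- exact: is_derive_flat.
- by rewrite lerDl.
move=> ->; rewrite addrC addKr normrM ler_wpM2r//.
apply: (le_trans (normr_dflat _ _)); rewrite -natrM -natrD ler_nat.
by [].
Qed.

Lemma flat0_taylor (x z : R) :
  `|flat 0 (x + z) - flat 0 x - z * flat 2 x| <= 36 * z ^+ 2.
Proof.
(* By the mean value theorem the increment is z times [flat 2], the derivative of [flat 0], at a
   point within |z| of x; and [flat 2] is 36-Lipschitz. *)
suff [c cz ->] : exists2 c, `|c| <= `|z| &
    flat 0 (x + z) - flat 0 x = flat 2 (x + c) * z.
  rewrite [z * _]mulrC -mulrBl normrM -[z ^+ 2]real_normK ?num_real// expr2 mulrA.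
  rewrite ler_wpM2r// (le_trans (flat2_dist _ _))// ler_wpM2l//.
have d0 (y : R) : is_derive y 1 (flat 0) (flat 2 y).
  by rewrite -dflat0E; exact: is_derive_flat.
have [z0|/ltW z0] := leP 0 z.
  have xz : x <= x + z by rewrite lerDl.
  have [c /andP[c1 c2] ->] := is_derive_MVT d0 xz.
  exists (c - x); last by congr (flat 2 _ * _); ring.
  by rewrite !ger0_norm ?subr_ge0// lerBlDl.
have xz : x + z <= x by rewrite gerDl.
have [c /andP[c1 c2] h] := is_derive_MVT d0 xz.
exists (c - x).
  by rewrite !ler0_norm ?subr_le0// lerN2 lerBrDl.
rewrite -opprB h (_ : x + (c - x) = c); ring.
Qed.

Variable d : nat.

Lemma taylor2_flat0 c k (i : 'I_d) :
  exists G, taylor2 (fun x : 'rV[R]_d => flat 0 (c + x 0 i * k)) G.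
Proof.
exists (fun x => (k * flat 2 (c + x 0 i * k)) *: delta_mx 0 i).
(* One summand for the value, one for the increment and the differential, one for the remainder. *)
pose C := 1 + 2 * `|k| + 36 * k ^+ 2.
have k2 : 0 <= k ^+ 2 by rewrite sqr_ge0.
exists C => [|x z]; first by rewrite /C; have := normr_ge0 k; lra.
have n0 := enorm_ge0 z; have zn := coord_le_enorm z i.
have kn : 0 <= `|k| by [].
have zE : c + (x + z) 0 i * k = c + x 0 i * k + z 0 i * k by rewrite mxE; ring.
have knn : 0 <= `|k| * enorm z by rewrite mulr_ge0.
have knn2 : 0 <= k ^+ 2 * enorm z by rewrite mulr_ge0.
split.
- rewrite ger0_norm ?flat_ge0// (le_trans (flat0_le1 _))// /C; lra.
- rewrite zE (le_trans (flat0_dist _ _))// normrM.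
  have e1 : `|z 0 i| * `|k| <= enorm z * `|k| by rewrite ler_wpM2r.
  rewrite /C; nra.
- rewrite dotvZr dotvC dotv_delta.
  rewrite !normrM (ger0_norm (flat_ge0 _ _)) [leLHS]mulrC.
  have e1 : flat 2 (c + x 0 i * k) <= 2 by exact: (flat_le 2).
  have e2 : `|k| * flat 2 (c + x 0 i * k) <= `|k| * 2 by rewrite ler_wpM2l.
  have e3 : `|z 0 i| * (`|k| * flat 2 (c + x 0 i * k)) <= enorm z * (`|k| * 2).
    by rewrite ler_pM// mulr_ge0// flat_ge0.
  rewrite /C; nra.
- rewrite zE dotvZr dotvC dotv_delta.
  rewrite (_ : k * _ * z 0 i = z 0 i * k * flat 2 (c + x 0 i * k)); last by ring.
  rewrite (le_trans (flat0_taylor _ _))// exprMn mulrA.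
  have e1 : z 0 i ^+ 2 <= enorm z ^+ 2.
    by rewrite -[leLHS]real_normK ?num_real// ler_pXn2r// nnegrE.
  have e2 : z 0 i ^+ 2 * k ^+ 2 <= enorm z ^+ 2 * k ^+ 2 by rewrite ler_wpM2r.
  have e3 : 0 <= enorm z ^+ 2 by rewrite sqr_ge0.
  have e4 : 0 <= `|k| * enorm z ^+ 2 by rewrite mulr_ge0.
  rewrite /C; nra.
Qed.

(** A product of one-dimensional bumps, supported in a sup-norm ball: smoothness and Taylor bounds
    are inherited factor by factor. *)
Definition moll e (x : 'rV[R]_d) : R := \prod_(i < d) bump (x 0 i / e).

Lemma moll_ge0 e x : 0 <= moll e x.
Proof. by apply: prodr_ge0 => i _; exact: bump_ge0. Qed.

Lemma moll_le1 e x : moll e x <= 1.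
Proof. by apply: mathcomp.algebra.num_theory.numdomain.Num.Theory.prodr_ile1 => i _; rewrite bump_ge0 bump_le1. Qed.

Lemma mollN e x : moll e (- x) = moll e x.
Proof. by apply: eq_bigr => i _; rewrite mxE mulNr bumpN. Qed.

Lemma moll_eq0 e (x : 'rV[R]_d) i : 0 < e -> e <= `|x 0 i| -> moll e x = 0.
Proof.
move=> e0 ex; rewrite /moll (bigD1 i)//= bump_eq0 ?mul0r//.
by rewrite normrM normfV (gtr0_norm e0) ler_pdivlMr// mul1r.
Qed.

Lemma moll_gt0 e (x : 'rV[R]_d) : 0 < e -> (forall i, `|x 0 i| < e) -> 0 < moll e x.
Proof.
move=> e0 xe; apply: prodr_gt0 => i _; apply: bump_gt0.
by rewrite normrM normfV (gtr0_norm e0) ltr_pdivrMr// mul1r.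
Qed.

Lemma taylor2_moll e : taylor2 (moll e) (grad (moll e)).
Proof.
suff [G tG] : exists G, taylor2 (moll e) G by rewrite (taylor2_grad tG).
apply: taylor2_prod => i.
have [G tG] := taylor2_flat0 1 e^-1 i.
have [H tH] := taylor2_flat0 1 (- e^-1) i.
have E : (fun x : 'rV[R]_d => bump (x 0 i / e)) = fun x : 'rV[R]_d =>
    flat 0 (1 + x 0 i * e^-1) * flat 0 (1 + x 0 i * - e^-1).
  by apply/funext => x; rewrite /bump mulrN.
by have := taylor2M tG tH; rewrite -E => h; eexists; exact: h.
Qed.

(* A smooth bump around the diagonal t = s, cut off to t0 < (t + s) / 2 < t1.
   dtheta is its derivative in t; the derivative along the diagonal falls only
   on the cut-off and leaves two kernels at the times t0 and t1 (dthetaD). *)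
Definition theta e t0 t1 t s : R := bump ((t - s) / e) *
  (step ((t + s - 2 * t0) / e) - step ((t + s - 2 * t1) / e)).

Definition dtheta e t0 t1 t s : R := e^-1 * (dbump ((t - s) / e) *
  (step ((t + s - 2 * t0) / e) - step ((t + s - 2 * t1) / e)) +
  bump ((t - s) / e) *
  (bump ((t + s - 2 * t0) / e) - bump ((t + s - 2 * t1) / e))).

Definition tker e tau t s : R :=
  bump ((t - s) / e) * bump ((t + s - 2 * tau) / e).

Lemma tker_ge0 e tau t s : 0 <= tker e tau t s.
Proof. by rewrite mulr_ge0// bump_ge0. Qed.

Lemma thetaC e t0 t1 t s : theta e t0 t1 t s = theta e t0 t1 s t.
Proof. by rewrite /theta -opprB mulNr bumpN [t + s]addrC. Qed.

(** [dbump] is odd in t - s while the step factors are symmetric, so what comes from the diagonal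
    bump cancels in the sum. *)
Lemma dthetaD e t0 t1 t s : dtheta e t0 t1 t s + dtheta e t0 t1 s t =
  2 / e * (tker e t0 t s - tker e t1 t s).
Proof.
rewrite /dtheta /tker -[s - t]opprB mulNr bumpN dbumpN [s + t]addrC.
ring.
Qed.

Section support.
Variables e t0 t1 : R.
Hypotheses (e0 : 0 < e) (t01 : t0 <= t1).

Let stepdiff_eq0 (x y : R) : x <= y -> y <= -1 \/ 1 <= x -> step y - step x = 0 :> R.
Proof.
move=> xy [y1|x1].
  by rewrite (step_leN1 y1) (step_leN1 (le_trans xy y1)) subrr.
by rewrite (step_ge1 x1) (step_ge1 (le_trans x1 xy)) subrr.
Qed.

Let theta_arg t s : (t + s - 2 * t1) / e <= (t + s - 2 * t0) / e.
Proof. by rewrite ler_pM2r ?invr_gt0// lerD2l lerN2 ler_pM2l. Qed.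

Lemma theta_support t s : ~~ ((t0 - e < t < t1 + e) && (t0 - e < s < t1 + e)) ->
  theta e t0 t1 t s = 0 /\ dtheta e t0 t1 t s = 0.
Proof.
have [h|h] := leP e `|t - s|.
  have h' : 1 <= `|(t - s) / e|.
    by rewrite normrM normfV (gtr0_norm e0) ler_pdivlMr// mul1r.
  by rewrite /theta /dtheta (bump_eq0 h') (dbump_eq0 h') !mul0r addr0 mulr0.
rewrite !negb_and -!leNgt => ht.
move: h; rewrite ltr_norml => /andP[h1 h2].
have t01' := theta_arg t s.
(* As |t - s| < e, one time outside the window (t0 - e, t1 + e) drags t + s along, and both steps
   are evaluated on the same flat side. *)
have h3 : (t + s - 2 * t0) / e <= -1 \/ 1 <= (t + s - 2 * t1) / e.
  rewrite ler_pdivrMr// ler_pdivlMr//.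
  by move: ht => /orP[/orP[]|/orP[]] ht; [left|right|left|right]; lra.
rewrite /theta /dtheta (stepdiff_eq0 t01' h3) !mulr0 add0r; split=> //.
have b0 (y : R) : y <= -1 \/ 1 <= y -> bump y = 0.
  case=> h; apply: bump_eq0; rewrite ler_normr; apply/orP; last by left.
  by right; rewrite lerNr.
case: h3 => h3.
  by rewrite (b0 _ (or_introl h3)) (b0 _ (or_introl (le_trans t01' h3))) subrr !mulr0.
by rewrite (b0 _ (or_intror h3)) (b0 _ (or_intror (le_trans h3 t01'))) subrr !mulr0.
Qed.

Lemma theta_ge0 t s : 0 <= theta e t0 t1 t s.
Proof. by rewrite mulr_ge0 ?bump_ge0// subr_ge0 step_le// theta_arg. Qed.

Definition thetaC0 : R := step 1 - step (-1).

Let stepdiff_le (x y : R) : `|step x - step y : R| <= thetaC0.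
Proof.
rewrite /thetaC0; have /andP[? ?] := step_itv x; have /andP[? ?] := step_itv y.
by rewrite ler_norml; apply/andP; split; lra.
Qed.

Lemma theta_le t s : theta e t0 t1 t s <= thetaC0.
Proof.
rewrite -[leRHS]mul1r ler_pM ?bump_ge0 ?bump_le1//.
  by rewrite subr_ge0 step_le// theta_arg.
exact: le_trans (ler_norm _) (stepdiff_le _ _).
Qed.

Lemma dtheta_le t s : `|dtheta e t0 t1 t s| <= e^-1 * (4 * thetaC0 + 1).
Proof.
have ei : 0 <= e^-1 by rewrite invr_ge0 ltW.
rewrite normrM (ger0_norm ei) ler_wpM2l//.
rewrite (le_trans (ler_normD _ _))// lerD//.
  by rewrite normrM ler_pM// dbump_le.
have b1 (y : R) : `|bump y| <= 1 by rewrite ger0_norm ?bump_ge0 ?bump_le1.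
have b2 (y z : R) : `|bump y - bump z| <= 1.
  have := @bump_ge0 R y; have := @bump_le1 R y.
  have := @bump_ge0 R z; have := @bump_le1 R z => ? ? ? ?.
  by rewrite ler_norml; apply/andP; split; lra.
by rewrite normrM -[leRHS]mulr1 ler_pM.
Qed.

End support.

End mollifiers.

(** * Test functions of the doubling argument *)

Section test_functions_doubling.
Context {R : realType} {d : nat}.
Local Notation V := 'rV[R]_d.
Implicit Types (p q : V * R) (e t s : R) (x y : V).

Lemma taylor2_shift (g : V -> R) (G : V -> V) y :
  taylor2 g G -> taylor2 (fun x => g (x - y)) (fun x => G (x - y)).
Proof.
move=> [C C0 gC]; exists C => // x z.
by rewrite (_ : x + z - y = x - y + z); [exact: gC|rewrite addrAC].
Qed.

Lemma taylor2Z c (g : V -> R) (G : V -> V) :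
  taylor2 g G -> taylor2 (fun x => c * g x) (fun x => c *: G x).
Proof.
move=> tg; have := taylor2M (taylor2_cst c) tg.
by under [X in taylor2 _ X]eq_fun do rewrite scaler0 addr0.
Qed.

Definition testf e t0 t1 q p : R :=
  moll e (p.1 - q.1) * theta e t0 t1 p.2 q.2.

Lemma grad_testf e t0 t1 q t x : grad (fun y => testf e t0 t1 q (y, t)) x =
  theta e t0 t1 t q.2 *: grad (moll e) (x - q.1).
Proof.
rewrite (_ : (fun y => _) = fun y => theta e t0 t1 t q.2 * moll e (y - q.1)).
  by rewrite (taylor2_grad (taylor2Z _ (taylor2_shift _ (taylor2_moll d e)))).
by apply/funext => y; rewrite /testf mulrC.
Qed.

Lemma is_derive_affine1 (g : R -> R) (dg k c t : R) :
  is_derive ((t + c) / k) 1 g dg ->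
  is_derive t 1 (fun s => g ((s + c) / k)) (k^-1 * dg).
Proof.
move=> gd.
have al (h v w : R) : (h *: v + w + c) / k = h * (v / k) + (w + c) / k.
  by rewrite [h *: v]/(h * v) !mulrDl mulrA !addrA.
have := @is_derive_affine R R (fun s : R => (s + c) / k) _ al g dg t 1 gd.
by rewrite mul1r.
Qed.

Lemma is_derive_theta e t0 t1 t s :
  is_derive t 1 (theta e t0 t1 ^~ s) (dtheta e t0 t1 t s).
Proof.
have db := @is_derive_affine1 bump _ e (- s) t (is_derive_bump _).
have ds tau : is_derive t 1 (fun t => step ((t + s - 2 * tau) / e))
    (e^-1 * bump ((t + s - 2 * tau) / e)).
  have := @is_derive_affine1 step _ e (s - 2 * tau) t (is_derive_step _).
  by rewrite addrA; under [X in is_derive _ _ X _]eq_fun do rewrite addrA.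
apply: is_derive_eq (is_deriveM db (is_deriveB (ds t0) (ds t1))) _.
rewrite /dtheta /GRing.scale/= !fctE; ring.
Qed.

Lemma derive1_testf e t0 t1 q x t :
  derive1 (fun s => testf e t0 t1 q (x, s)) t =
  moll e (x - q.1) * dtheta e t0 t1 t q.2.
Proof.
rewrite derive1E (_ : (fun _ => _) =
  moll e (x - q.1) *: (theta e t0 t1 ^~ q.2 : R -> R))//; apply: derive_val.
exact: is_deriveZ (is_derive_theta e t0 t1 t q.2).
Qed.

Let continuous_coord_affine q i e :
  continuous (fun p : V * R => (p.1 - q.1) 0 i / e).
Proof.
rewrite (_ : (fun p => _) = fun p : V * R => (p.1 0 i - q.1 0 i) * e^-1); last first.
  by apply/funext => p; rewrite !mxE.
move=> p; apply: cvgM; last exact: cvg_cst.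
apply: cvgB; last exact: cvg_cst.
apply: (@continuous_comp _ _ _ fst (fun v : V => v 0 i)); first exact: cvg_fst.
exact: coord_continuous.
Qed.

Lemma Ck_testf k e t0 t1 q : Ck k (testf e t0 t1 q).
Proof.
have csnd (c k' : R) : continuous (fun p : V * R => (p.2 + c) / k').
  by move=> p; apply: cvgM; [apply: cvgD; [exact: cvg_snd|exact: cvg_cst]|exact: cvg_cst].
have asnd (c k' h : R) (v x : V * R) :
    ((h *: v + x).2 + c) / k' = h * (v.2 / k') + (x.2 + c) / k'.
  by rewrite /= [h *: v.2]/(h * v.2) !mulrDl mulrA !addrA.
have Cs tau : Ck k (fun p : V * R => step ((p.2 + q.2 - 2 * tau) / e)).
  have := @Ck_step R _ _ _ k (csnd (q.2 - 2 * tau) e) (asnd _ _).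
  by congr (Ck k); apply/funext => p; rewrite /= addrA.
apply: CkM.
  apply: Ck_prod => i.
  apply: (@Ck_bump R _ (fun p : V * R => (p.1 - q.1) 0 i / e)
    (fun p : V * R => p.1 0 i / e)); first exact: continuous_coord_affine.
  by move=> h v y; rewrite !mxE; ring.
apply: CkM.
  exact: (@Ck_bump R _ _ _ k (csnd (- q.2) e) (asnd _ _)).
apply: CkD; first exact: Cs.
rewrite (_ : (fun _ => _) = fun p : V * R =>
  (-1) * step ((p.2 + q.2 - 2 * t1) / e)); last by apply/funext => p; rewrite mulN1r.
by apply: CkM => //; exact: Ck_cst.
Qed.

Lemma testf_ge0 e t0 t1 q p : 0 < e -> t0 <= t1 -> 0 <= testf e t0 t1 q p.
Proof. by move=> e0 t01; rewrite mulr_ge0 ?moll_ge0 ?theta_ge0. Qed.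

Lemma test_function_testf T e t0 t1 q : 0 < e -> t0 <= t1 ->
  0 < t0 - e -> t1 + e < T -> test_function (QT T) (testf e t0 t1 q).
Proof.
move=> e0 t01 te0 te1.
pose K : set (V * R) :=
  [set x : V | forall i, `[q.1 0 i - e, q.1 0 i + e]%classic (x 0 i)] `*`
  `[t0 - e, t1 + e]%classic.
have cK : compact K.
  apply: compact_setX; last exact: segment_compact.
  have := @rV_compact R d (fun i => `[q.1 0 i - e, q.1 0 i + e]%classic) (fun i => @segment_compact _ _ _).
  by [].
have sK : [set p | testf e t0 t1 q p != 0] `<=` K.
  move=> [x t] /=; apply: contraPP => nK; apply/negP; rewrite negbK; apply/eqP.
  have [tI|tI] := boolP (t0 - e < t < t1 + e); last first.
    have [] // := @theta_support R e t0 t1 e0 t01 t q.2.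
      by rewrite (negbTE tI).
    by rewrite /testf /= => ->; rewrite mulr0.
  have [xI|/existsNP[i xi]] :=
      pselect (forall i, `[q.1 0 i - e, q.1 0 i + e]%classic (x 0 i)).
    exfalso; apply: nK; split => //=; rewrite in_itv/=.
    by move/andP : tI => [? ?]; rewrite !ltW.
  rewrite /testf (@moll_eq0 _ _ _ _ i) ?mul0r//=.
  move: xi; rewrite /= in_itv/= !mxE => /negP; rewrite -ler_distl -ltNge.
  exact: ltW.
have clK : closed K := compact_closed (@norm_hausdorff _ _) cK.
have clsub : closure [set p | testf e t0 t1 q p != 0] `<=` K.
  by rewrite (closure_id K).1//; exact: closure_subset.
split.
- by move=> k; exact: Ck_testf.
- apply: (subclosed_compact _ cK clsub); exact: closed_closure.
- apply: (subset_trans clsub) => -[x t] [_] /=; rewrite in_itv/= => /andP[h1 h2].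
  by split => //=; rewrite in_itv/=; apply/andP; split; lra.
Qed.

End test_functions_doubling.

Local Open Scope ereal_scope.

Lemma ereal_cvg0P (R : realType) (f : nat -> \bar R) : (forall n, 0 <= f n) ->
  f @ \oo --> 0 <-> forall e : R, (0 < e)%R -> \forall n \near \oo, f n <= e%:E.
Proof.
move=> f0; split=> [/fine_cvgP[ffin /cvgrPdist_le cf] e e0|h].
  have := cf e e0; apply: filterS2 ffin => n fn.
  by rewrite sub0r normrN ger0_norm ?fine_ge0// -lee_fin fineK.
apply/fine_cvgP; split.
  have := h 1%R ltr01; apply: filterS => n fn.
  by rewrite ge0_fin_numE// (le_lt_trans fn)// ltry.
apply/cvgrPdist_le => e e0; have := h e e0; apply: filterS => n fn.
have ffin : f n \is a fin_num by rewrite ge0_fin_numE// (le_lt_trans fn)// ltry.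
by rewrite sub0r normrN ger0_norm ?fine_ge0// -lee_fin fineK.
Qed.

Lemma ge0_dominated_cvg0 (R : realType) d (T : measurableType d)
    (m : {measure set T -> \bar R}) (f : nat -> T -> \bar R) (g : T -> \bar R) :
  (forall n, measurable_fun setT (f n)) -> (forall n x, 0 <= f n x) ->
  m.-integrable setT g -> (forall n x, f n x <= g x) ->
  {ae m, forall x, f ^~ x @ \oo --> 0} ->
  (fun n => \int[m]_x f n x) @ \oo --> 0.
Proof.
move=> mf f0 ig fg f_0.
have [] := @dominated_convergence d T R m setT measurableT f (cst 0) g.
- by move=> n; exact: mf.
- exact: measurable_cst.
- by apply: filterS f_0 => x + _.
- exact: ig.
- by apply: aeW => x n _; rewrite gee0_abs// fg.
by move=> _ _; rewrite integral0.
Qed.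

(** * Measure-preserving maps *)

Section mpres.
Context {R : realType}.

(** Stated through integrals of nonnegative functions instead of preimages of sets: products then
    follow from Tonelli, and integrability by taking absolute values. [mpresP] goes from sets to
    integrals. *)
Definition mpres d1 d2 (T1 : measurableType d1) (T2 : measurableType d2)
    (m1 : {measure set T1 -> \bar R}) (m2 : {measure set T2 -> \bar R})
    (phi : T1 -> T2) := measurable_fun setT phi /\
  forall F : T2 -> \bar R, measurable_fun setT F -> (forall x, 0 <= F x) ->
    \int[m1]_x F (phi x) = \int[m2]_x F x.

Context d1 d2 d3 d4 (T1 : measurableType d1) (T2 : measurableType d2)
  (T3 : measurableType d3) (T4 : measurableType d4).

Lemma mpres_integral (m1 : {measure set T1 -> \bar R})
    (m2 : {measure set T2 -> \bar R}) phi (F : T2 -> \bar R) :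
  mpres m1 m2 phi -> measurable_fun setT F ->
  \int[m1]_x F (phi x) = \int[m2]_x F x.
Proof.
move=> [mphi pphi] mF; rewrite [LHS]integralE [RHS]integralE.
congr (_ - _).
  rewrite -(pphi F^\+)//; last exact: measurable_funepos.
  by apply: eq_integral => x _; rewrite !funeposE.
rewrite -(pphi F^\-)//; last exact: measurable_funeneg.
by apply: eq_integral => x _; rewrite !funenegE.
Qed.

Lemma mpres_integrable (m1 : {measure set T1 -> \bar R})
    (m2 : {measure set T2 -> \bar R}) phi (F : T2 -> \bar R) :
  mpres m1 m2 phi -> m2.-integrable setT F ->
  m1.-integrable setT (F \o phi).
Proof.
move=> [mphi pphi] /integrableP[mF iF]; apply/integrableP; split.
  exact: measurableT_comp.
rewrite (pphi (fun x => `|F x|))//.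
exact: measurableT_comp.
Qed.

Lemma mpres_prod (m1 : {sigma_finite_measure set T1 -> \bar R})
    (m2 : {sigma_finite_measure set T2 -> \bar R})
    (m3 : {sigma_finite_measure set T3 -> \bar R})
    (m4 : {sigma_finite_measure set T4 -> \bar R}) phi psi :
  mpres m1 m3 phi -> mpres m2 m4 psi ->
  mpres (m1 \x m2) (m3 \x m4) (fun p => (phi p.1, psi p.2)).
Proof.
move=> [mphi pphi] [mpsi ppsi].
have mpp : measurable_fun setT (fun p : T1 * T2 => (phi p.1, psi p.2)).
  apply/measurable_fun_pairP; split.
    exact: (measurableT_comp mphi measurable_fst).
  exact: (measurableT_comp mpsi measurable_snd).
split=> // F mF F0; rewrite !fubini_tonelli1//; last exact: measurableT_comp.
rewrite /fubini_F -(pphi (fun x => \int[m4]_y F (x, y))); last 2 first.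
- exact: measurable_fun_fubini_tonelli_F.
- by move=> x; exact: integral_ge0.
apply: eq_integral => x _; rewrite -(ppsi (fun y => F (phi x, y)))//.
by apply: measurableT_comp => //; exact: measurable_pair1.
Qed.

Lemma mpres_swap (m1 : {sigma_finite_measure set T1 -> \bar R})
    (m2 : {sigma_finite_measure set T2 -> \bar R}) :
  mpres (m1 \x m2) (m2 \x m1) (fun p => (p.2, p.1)).
Proof.
have mp : measurable_fun setT (fun p : T1 * T2 => (p.2, p.1)).
  by apply/measurable_fun_pairP; split; [exact: measurable_snd|exact: measurable_fst].
split=> // F mF F0; rewrite fubini_tonelli2//; last exact: measurableT_comp.
by rewrite fubini_tonelli1.
Qed.

End mpres.

Section mpres_transport.
Context {R : realType} d1 d2 (T1 : measurableType d1) (T2 : measurableType d2).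
Variables (m1 : {measure set T1 -> \bar R}) (m2 : {measure set T2 -> \bar R}).
Variable kappa : T1 -> T2.
Hypothesis pk : mpres m1 m2 kappa.

(** psi is phi seen through kappa; with [rV_cons] as kappa this carries translations of R * R^n over
    to R^(n+1). *)
Lemma mpres_intertwine (phi : T1 -> T1) (psi : T2 -> T2) :
  mpres m1 m1 phi -> measurable_fun setT psi ->
  (forall x, psi (kappa x) = kappa (phi x)) -> mpres m2 m2 psi.
Proof.
move=> [mphi pphi] mpsi pkE; split=> // F mF F0.
have [mk pk'] := pk.
rewrite -(pk' _ mF F0) -(pphi (F \o kappa) (measurableT_comp mF mk) (fun=> F0 _)).
rewrite -(pk' (F \o psi) (measurableT_comp mF mpsi) (fun=> F0 _)).
by apply: eq_integral => x _ /=; rewrite pkE.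
Qed.

End mpres_transport.

(** * Strong L^1 convergence of compositions to the identity *)

Section L1_continuous.
Context {R : realType}.

(** The operators g -> g o phi n tend strongly to the identity on L^1. *)
Definition L1cvg d (T : measurableType d) (m : {measure set T -> \bar R})
    (phi : nat -> T -> T) := forall g : T -> R, m.-integrable setT (EFin \o g) ->
  (fun n => \int[m]_x `|(g (phi n x) - g x)%:E|) @ \oo --> 0.

Lemma L1cvg_intertwine d1 d2 (T1 : measurableType d1) (T2 : measurableType d2)
    (m1 : {measure set T1 -> \bar R}) (m2 : {measure set T2 -> \bar R})
    (kappa : T1 -> T2) phi psi : mpres m1 m2 kappa -> L1cvg m1 phi ->
  (forall n, measurable_fun setT (psi n)) ->
  (forall n x, psi n (kappa x) = kappa (phi n x)) -> L1cvg m2 psi.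
Proof.
move=> pk c1 mpsi pkE g ig.
have mg : measurable_fun setT g by case/integrableP : ig => /measurable_EFinP.
have := c1 (g \o kappa) (mpres_integrable pk ig).
rewrite (_ : (fun n => \int[m1]_x _) = fun n => \int[m2]_x `|(g (psi n x) - g x)%:E|)//.
apply/funext => n; rewrite -(mpres_integral pk); last first.
  apply: measurableT_comp => //; apply/measurable_EFinP.
  by apply: measurable_funB => //; exact: measurableT_comp.
by apply: eq_integral => x _ /=; rewrite pkE.
Qed.

(** A three-epsilon argument: by invariance of m, g and h are exactly as close after composition
    with phi n as before. *)
Lemma L1cvg_dense d (T : measurableType d) (m : {measure set T -> \bar R}) phi
    (g : T -> R) : (forall n, mpres m m (phi n)) -> measurable_fun setT g ->
  (forall e : R, (0 < e)%R -> exists h : T -> R, [/\ measurable_fun setT h,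
    \int[m]_x `|(g x - h x)%:E| <= e%:E &
    (fun n => \int[m]_x `|(h (phi n x) - h x)%:E|) @ \oo --> 0]) ->
  (fun n => \int[m]_x `|(g (phi n x) - g x)%:E|) @ \oo --> 0.
Proof.
move=> pp mg dg; apply/ereal_cvg0P => [n|e e0]; first exact: integral_ge0.
have e3 : (0 < e / 3)%R by rewrite divr_gt0.
have [h [mh gh]] := dg _ e3.
move=> /ereal_cvg0P => /(_ (fun n => integral_ge0 _ (fun _ _ => abse_ge0 _))).
move=> /(_ _ e3); apply: filterS => n hn.
have mphi : measurable_fun setT (phi n) by have [] := pp n.
have mgh : measurable_fun setT (fun x => `|(g x - h x)%:E|).
  by apply: measurableT_comp => //; apply/measurable_EFinP; exact: measurable_funB.
have mghp : measurable_fun setT (fun x => `|(g (phi n x) - h (phi n x))%:E|).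
  exact: (measurableT_comp mgh).
have mhh : measurable_fun setT (fun x => `|(h (phi n x) - h x)%:E|).
  apply: measurableT_comp => //; apply/measurable_EFinP; apply: measurable_funB => //.
  exact: measurableT_comp.
have mgg : measurable_fun setT (fun x => `|(g (phi n x) - g x)%:E|).
  apply: measurableT_comp => //; apply/measurable_EFinP; apply: measurable_funB => //.
  exact: measurableT_comp.
apply: (@le_trans _ _ (\int[m]_x (`|(g (phi n x) - h (phi n x))%:E| +
    `|(h (phi n x) - h x)%:E| + `|(g x - h x)%:E|))).
  apply: ge0_le_integral => //.
    by apply: emeasurable_funD => //; exact: emeasurable_funD.
  move=> x _; rewrite !abse_EFin -!EFinD lee_fin.
  rewrite (_ : g (phi n x) - g x = (g (phi n x) - h (phi n x)) +
    (h (phi n x) - h x) - (g x - h x))%R; last by ring.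
  by rewrite (le_trans (ler_normB _ _))// lerD2r ler_normD.
rewrite ge0_integralD//; [|by move=> x _; rewrite adde_ge0|exact: emeasurable_funD].
rewrite ge0_integralD//.
have -> : \int[m]_x `|(g (phi n x) - h (phi n x))%:E| = \int[m]_x `|(g x - h x)%:E|.
  by have [_ /(_ _ mgh)] := pp n; exact.
rewrite (_ : e%:E = (e / 3)%:E + (e / 3)%:E + (e / 3)%:E); last first.
  by rewrite -!EFinD; congr EFin; field.
by rewrite leeD// leeD.
Qed.

Lemma L1cvg_comp d (T : measurableType d) (m : {measure set T -> \bar R}) phi psi :
  (forall n, measurable_fun setT (phi n)) -> (forall n, mpres m m (psi n)) ->
  L1cvg m phi -> L1cvg m psi -> L1cvg m (fun n => phi n \o psi n).
Proof.
move=> mphi pp c1 c2 g ig.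
have mg : measurable_fun setT g by case/integrableP : ig => /measurable_EFinP.
have mD (a : T -> T) : measurable_fun setT a ->
    measurable_fun setT (fun p => `|(g (a p) - g p)%:E|).
  move=> ma; apply: measurableT_comp => //; apply/measurable_EFinP.
  by apply: measurable_funB => //; exact: measurableT_comp.
apply: (@squeeze_cvge _ _ _ _ (cst 0) _ (fun n =>
    \int[m]_x `|(g (phi n x) - g x)%:E| + \int[m]_x `|(g (psi n x) - g x)%:E|)).
- apply: nearW => n; have [mpsi ppsi] := pp n; rewrite integral_ge0//=.
  rewrite -(ppsi (fun x => `|(g (phi n x) - g x)%:E|))//; last exact: mD.
  rewrite -ge0_integralD//; [|exact: measurableT_comp (mD _ (mphi n)) mpsi|exact: mD].
  apply: ge0_le_integral => //.
  + by apply: mD; exact: measurableT_comp.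
  + apply: emeasurable_funD; last exact: mD.
    exact: measurableT_comp (mD _ (mphi n)) mpsi.
  + move=> x _; rewrite !abse_EFin -!EFinD lee_fin /=.
    by rewrite -(subrKA (g (psi n x))) ler_normD.
- exact: cvg_cst.
- rewrite -[0]adde0; apply: cvgeD => //; [exact: c1|exact: c2].
Qed.

(** For almost every y the slice of g at y is in L^1(m1) and its inner integral tends to 0; by
    invariance that integral is at most twice the norm of the slice, which is integrable in y. *)
Lemma L1cvg_prod1 d1 d2 (T1 : measurableType d1) (T2 : measurableType d2)
    (m1 : {sigma_finite_measure set T1 -> \bar R})
    (m2 : {sigma_finite_measure set T2 -> \bar R}) phi :
  (forall n, mpres m1 m1 (phi n)) -> L1cvg m1 phi ->
  L1cvg (m1 \x m2) (fun n p => (phi n p.1, p.2)).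
Proof.
move=> p1 c1 g ig.
have mg : measurable_fun setT g by case/integrableP : ig => /measurable_EFinP.
have mphi n : measurable_fun setT (phi n) by have [] := p1 n.
have mfp n : measurable_fun setT (fun p : T1 * T2 => (phi n p.1, p.2)).
  apply/measurable_fun_pairP; split; last exact: measurable_snd.
  exact: (measurableT_comp (mphi n) measurable_fst).
have mD n : measurable_fun setT (fun p => `|(g (phi n p.1, p.2) - g p)%:E|).
  apply: measurableT_comp => //; apply/measurable_EFinP.
  by apply: measurable_funB => //; exact: measurableT_comp (mfp n).
have mga : measurable_fun setT (fun p => `|(g p)%:E|).
  by apply: measurableT_comp => //; exact/measurable_EFinP.
rewrite (_ : (fun n => _) = fun n =>
  \int[m2]_y \int[m1]_x `|(g (phi n x, y) - g (x, y))%:E|); last first.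
  by apply/funext => n; rewrite fubini_tonelli2.
apply: (@ge0_dominated_cvg0 _ _ _ _ _ (fun y =>
    \int[m1]_x `|(g (x, y))%:E| + \int[m1]_x `|(g (x, y))%:E|)).
- move=> n; exact: (measurable_fun_fubini_tonelli_G (m1 := m1) _ (mD n) (fun=> abse_ge0 _)).
- by move=> n y; exact: integral_ge0.
- suff iG : m2.-integrable setT (fun y => \int[m1]_x `|(g (x, y))%:E|).
    exact: integrableD.
  apply/integrableP; split.
    exact: (measurable_fun_fubini_tonelli_G (m1 := m1) _ mga (fun=> abse_ge0 _)).
  under eq_integral do rewrite gee0_abs ?integral_ge0//.
  by rewrite -(fubini_tonelli2 (m1 := m1) (m2 := m2) _ mga)//; case/integrableP : ig.
- move=> n y.
  have mgy : measurable_fun setT (fun x => `|(g (x, y))%:E|).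
    exact: (measurableT_comp mga (measurable_pair2 y)).
  rewrite -[X in _ <= X + _]((p1 n).2 (fun x => `|(g (x, y))%:E|))//.
  rewrite -ge0_integralD//; last exact: measurableT_comp mgy (mphi n).
  apply: ge0_le_integral => //.
  + exact: (measurableT_comp (mD n) (measurable_pair2 y)).
  + by apply: emeasurable_funD => //; exact: measurableT_comp mgy (mphi n).
  + by move=> x _; rewrite !abse_EFin -EFinD lee_fin ler_normB.
- apply: filterS (ae_integrable2 ig) => y iy.
  exact: c1.
Qed.

(** One factor at a time: the second is reduced to the first by exchanging the coordinates. *)
Lemma L1cvg_prod d1 d2 (T1 : measurableType d1) (T2 : measurableType d2)
    (m1 : {sigma_finite_measure set T1 -> \bar R})
    (m2 : {sigma_finite_measure set T2 -> \bar R}) phi psi :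
  (forall n, mpres m1 m1 (phi n)) -> (forall n, mpres m2 m2 (psi n)) ->
  L1cvg m1 phi -> L1cvg m2 psi ->
  L1cvg (m1 \x m2) (fun n p => (phi n p.1, psi n p.2)).
Proof.
move=> p1 p2 c1 c2.
have idp d (T : measurableType d) (m : {measure set T -> \bar R}) : mpres m m id.
  by split.
have pr n := mpres_prod (idp _ _ m1) (p2 n).
apply: (@L1cvg_comp _ _ _ (fun n p => (phi n p.1, p.2)) (fun n p => (p.1, psi n p.2))).
- by move=> n; have [] := mpres_prod (p1 n) (idp _ _ m2).
- exact: pr.
- exact: L1cvg_prod1.
- apply: (L1cvg_intertwine (mpres_swap m2 m1) (L1cvg_prod1 p2 c2)) => [n|//].
  by have [] := pr n.
Qed.

End L1_continuous.

Section mpres_pushforward.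
Context {R : realType} d1 d2 (T1 : measurableType d1) (T2 : measurableType d2).
Variables (m1 : {measure set T1 -> \bar R}) (m2 : {measure set T2 -> \bar R}).
Variables (phi : T1 -> T2).
Hypothesis mphi : measurable_fun setT phi.

Let mphi_mixin := isMeasurableFun.Build _ _ _ _ _ mphi.
Let mphi_pack : {mfun _ >-> _} := HB.pack phi mphi_mixin.

Lemma mpresP : (forall A, measurable A -> m2 A = m1 (phi @^-1` A)) ->
  mpres m1 m2 phi.
Proof.
move=> m12; split=> // F mF F0.
rewrite [RHS](eq_measure_integral (pushforward m1 mphi_pack)); last first.
  by move=> A mA _; rewrite /= m12.
by rewrite (@ge0_integral_pushforward _ _ _ _ _ _ mphi)// preimage_setT.
Qed.

Lemma pushforward_ex : exists m : {measure set T2 -> \bar R},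
  forall A, m A = m1 (phi @^-1` A).
Proof.
pose m : {measure set T2 -> \bar R} := pushforward m1 mphi_pack.
by exists (m mphi).
Qed.

End mpres_pushforward.

(** * Translations of R and R^n, and their continuity in L^1 *)

Section shift.
Context {R : realType}.

Lemma measurable_shift (a : R) : measurable_fun setT (fun x : R => (x + a)%R).
Proof. exact: measurable_funD. Qed.

Lemma mpres_shift (a : R) :
  mpres lebesgue_measure lebesgue_measure (fun x : R => (x + a)%R).
Proof.
apply: mpresP => [|A mA]; first exact: measurable_shift.
have [m mE] := @pushforward_ex R _ _ (measurableTypeR R) (measurableTypeR R)
  lebesgue_measure _ (measurable_shift a).
rewrite -mE; apply: (@lebesgue_measure_unique R m _ A mA) => _ [[b c] _ <-] /=; rewrite mE.
rewrite (_ : _ @^-1` _ = `](b - a)%R, (c - a)%R]%classic); last first.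
  by apply/seteqP; split=> x /=; rewrite !in_itv/= ltrBlDr lerBrDr.
apply: (etrans (lebesgue_measure_itv _)).
apply: (etrans _ (esym (lebesgue_measure_itv _))).
rewrite /= !lte_fin ltrD2r; case: ifP => // _.
by rewrite -!EFinB; congr EFin; ring.
Qed.

Let cutoff (r x : R) : R := Num.max 0%R (Num.min 1 (r + 1 - `|x|))%R.

Let cutoff_itv r x : (0 <= cutoff r x <= 1)%R.
Proof. by rewrite /cutoff le_max lexx /= ge_max ler01 ge_min lexx. Qed.

Let cutoff1 r x : (`|x| <= r)%R -> cutoff r x = 1%R.
Proof.
move=> xr; rewrite /cutoff min_l; last by rewrite lerBrDl lerD2r.
by rewrite max_r.
Qed.

Let cutoff0 r x : (r + 1 <= `|x|)%R -> cutoff r x = 0%R.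
Proof.
by move=> xr; rewrite /cutoff max_l// ge_min subr_le0 xr orbT.
Qed.

Let continuous_cutoff r : continuous (cutoff r).
Proof.
move=> x.
apply: (@continuous_max _ _ (cst 0%R) (cst 1 \min (fun x => r + 1 - `|x|))%R x).
  exact: cvg_cst.
apply: (@continuous_min _ _ (cst 1) (fun x => r + 1 - `|x|) x)%R.
  exact: cvg_cst.
by apply: cvgB; [exact: cvg_cst|exact: norm_continuous].
Qed.

Lemma L1cvg_shift_continuous (h : R -> R) (L : R) (a : nat -> R) :
  (0 < L)%R -> continuous h -> (forall x, L <= `|x| -> h x = 0)%R ->
  (a n @[n --> \oo] --> (0 : R))%R ->
  (fun n => \int[lebesgue_measure]_x `|(h (x + a n) - h x)%:E|) @ \oo --> 0.
Proof.
move=> L0 ch h0 a0.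
have [M M0 hM] : exists2 M : R, (0 <= M)%R & forall x, (`|h x| <= M)%R.
  have LL : (- L <= L)%R by rewrite ge0_cp// ltW.
  have cnh : {within `[(- L)%R, L], continuous (fun x => `|h x|)%R}.
    apply: continuous_subspaceT => x.
    by apply: (continuous_comp (ch x)); exact: norm_continuous.
  have [c _ hc] := EVT_max LL cnh; exists `|h c|%R => // x.
  have [xL|xL] := leP `|x|%R L; last by rewrite (h0 x) ?normr0// ltW.
  by apply: hc; rewrite in_itv/= -ler_norml.
have [K K0 aK] : exists2 K : R, (0 <= K)%R & forall n, (`|a n| <= K)%R.
  have : cvgn a by apply/cvg_ex; exists 0%R.
  move=> /cvg_seq_bounded[K [_ /(_ (Num.max 0 (K + 1))%R)]].
  rewrite lt_max ltrDl ltr01 orbT => /(_ isT) aM; exists (Num.max 0 (K + 1))%R.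
    by rewrite le_max lexx.
  by move=> n; exact: aM.
have mh : measurable_fun setT h by exact: continuous_measurable_fun.
(* The shifts are bounded by K, so all the differences live on one interval, on which 2 M dominates
   them. *)
apply: (@ge0_dominated_cvg0 R _ (measurableTypeR R) lebesgue_measure
    (fun n x => `|(h (x + a n) - h x)%:E|) (fun x => (2 * M)%:E *
    (\1_`[(- (L + K))%R, (L + K)%R] x : R)%:E)).
- move=> n; apply: measurableT_comp => //; apply/measurable_EFinP.
  apply: measurable_funB => //.
  exact: (measurableT_comp mh (measurable_shift (a n))).
- by move=> n x.
- apply: integrableZl => //; exact: integrable_indic_itv.
- move=> n x; rewrite abse_EFin -EFinM lee_fin indicE.
  have [xI|xI] := boolP (x \in _).
    rewrite mulr1 (le_trans (ler_normB _ _))//.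
    by rewrite mulr_natl mulr2n lerD.
  move: xI; rewrite notin_setE /= in_itv/= => /negP; rewrite -ler_norml -ltNge => xI.
  rewrite !h0 ?subrr ?normr0 ?mulr0//; first by rewrite (le_trans _ (ltW xI))// lerDl.
  have := lerB_dist x (- a n)%R; rewrite normrN opprK; apply: le_trans.
  by rewrite lerBrDr (le_trans _ (ltW xI))// lerD2l.
- apply: aeW => x; apply/ereal_cvg0P => [//|e e0].
  have : (h (x + a n) @[n --> \oo] --> h x)%R.
    apply: continuous_cvg; first exact: ch.
    by rewrite -[X in _ --> X]addr0; apply: cvgD => //; exact: cvg_cst.
  move=> /cvgrPdist_le /(_ e e0); apply: filterS => n.
  by rewrite abse_EFin lee_fin distrC.
Qed.

Lemma L1_cutoff (g : R -> R) (e : R) :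
  lebesgue_measure.-integrable setT (EFin \o g) -> (0 < e)%R ->
  exists2 r : R, (0 < r)%R &
    \int[lebesgue_measure]_x `|(g x - g x * cutoff r x)%:E| <= e%:E.
Proof.
move=> ig e0.
have mg : measurable_fun setT g by case/integrableP : ig => /measurable_EFinP.
have := @ge0_dominated_cvg0 R _ _ lebesgue_measure
  (fun n x => `|(g x - g x * cutoff n.+1%:R x)%:E|) (abse \o (EFin \o g)).
have mc r : measurable_fun setT (cutoff r).
  exact: continuous_measurable_fun (@continuous_cutoff r).
have f0 n x : 0 <= `|(g x - g x * cutoff n.+1%:R x)%:E| by [].
move=> /(_ _ f0 (integrable_abse ig)) h.
have /ereal_cvg0P : (fun n => \int[lebesgue_measure]_x
    `|(g x - g x * cutoff n.+1%:R x)%:E|) @ \oo --> 0.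
  apply: h.
  - move=> n; apply: measurableT_comp => //; apply/measurable_EFinP.
    by apply: measurable_funB => //; exact: (measurable_funM mg (mc _)).
  - move=> n x; rewrite /= lee_fin -{1}[g x]mulr1 -mulrBr normrM ler_piMr//.
    have /andP[c0 c1] := cutoff_itv n.+1%:R x.
    by rewrite ger0_norm ?subr_ge0// gerBl.
  - apply: aeW => x; apply/ereal_cvg0P => // s s0.
    exists (Num.trunc `|x|%R) => // n /= xn.
    rewrite cutoff1; first by rewrite mulr1 subrr /= normr0 lee_fin ltW.
    by rewrite (le_trans (ltW (truncnS_gt _)))// ler_nat ltnS.
move=> /(_ (fun n => integral_ge0 _ (fun _ _ => abse_ge0 _))) /(_ e e0)[N _].
by move=> /(_ N (leqnn N)) /= hN; exists N.+1%:R%R.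
Qed.

Lemma L1cvg_shift (a : nat -> R) : (a n @[n --> \oo] --> (0 : R))%R ->
  L1cvg lebesgue_measure (fun n x => (x + a n)%R).
Proof.
move=> a0 g ig.
have mg : measurable_fun setT g by case/integrableP : ig => /measurable_EFinP.
apply: L1cvg_dense => // [n|e e0]; first exact: mpres_shift.
have e2 : (0 < e / 2)%R by rewrite divr_gt0.
have [r r0 hr] := L1_cutoff ig e2.
have r1 : (0 < r + 1)%R by rewrite addr_gt0.
pose E : set R := `[(- (r + 1))%R, (r + 1)%R]%classic.
have [||| g_ [cg ig_ /ereal_cvg0P]] := @approximation_continuous_integrable R E g.
- exact: measurable_itv.
- have lE := lebesgue_measure_itv `[(- (r + 1))%R, (r + 1)%R].
  apply: (eq_ind_r (fun z => z < +oo) _ lE) => /=.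
  by case: ifP => // _; rewrite -EFinB ltry.
- by apply: integrableS ig => //; exact: measurable_itv.
move=> /(_ (fun n => integral_ge0 _ (fun _ _ => abse_ge0 _))) /(_ _ e2)[N _].
move=> /(_ N (leqnn N)) /= hN.
have mc : measurable_fun setT (cutoff r).
  exact: continuous_measurable_fun (@continuous_cutoff r).
have mgN : measurable_fun setT (g_ N) by exact: continuous_measurable_fun.
(* [g_ N] is controlled only on E, so it is cut off to vanish outside. Then g - h is the sum of g -
   g [cutoff] and (g - [g_ N]) [cutoff], each of L^1 norm at most e / 2. *)
pose h x := (g_ N x * cutoff r x)%R.
have mh : measurable_fun setT h by exact: measurable_funM.
exists h; split => //; last first.
  apply: (@L1cvg_shift_continuous _ (r + 1)) => //.
    by move=> x; apply: cvgM; [exact: cg|exact: continuous_cutoff].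
  by move=> x xr; rewrite /h cutoff0// mulr0.
have mE : measurable E by exact: measurable_itv.
have m1 : measurable_fun setT (fun x => `|(g x - g x * cutoff r x)%:E|).
  apply: measurableT_comp => //; apply/measurable_EFinP.
  by apply: measurable_funB => //; exact: (measurable_funM mg mc).
have m2 : measurable_fun setT (fun x => `|(g x - g_ N x)%:E|).
  by apply: measurableT_comp => //; apply/measurable_EFinP; exact: measurable_funB.
have m4 : measurable_fun setT (fun x => `|(g x - h x)%:E|).
  by apply: measurableT_comp => //; apply/measurable_EFinP; exact: measurable_funB.
have m3 : measurable_fun setT ((fun x => `|(g x - g_ N x)%:E|) \_ E).
  by apply/(measurable_restrictT _ mE); exact: measurable_funTS.
rewrite (_ : e%:E = (e / 2)%:E + (e / 2)%:E); last by rewrite -EFinD -splitr.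
apply: le_trans (leeD hr hN); rewrite [X in _ <= _ + X]integral_mkcond.
rewrite -ge0_integralD//; last by move=> x _; rewrite patchE; case: ifP.
apply: ge0_le_integral => //.
- exact: (emeasurable_funD m1 m3).
move=> x _; rewrite patchE; have [xE|xE] := boolP (x \in E).
  rewrite !abse_EFin -EFinD lee_fin.
  rewrite (_ : g x - h x = (g x - g x * cutoff r x) +
    (g x - g_ N x) * cutoff r x)%R; last by rewrite /h; ring.
  rewrite (le_trans (ler_normD _ _))// lerD2l normrM ler_piMr//.
  by have /andP[c0 c1] := cutoff_itv r x; rewrite ger0_norm.
rewrite adde0 /h cutoff0 ?mulr0//.
move: xE; rewrite notin_setE /E /= in_itv/= => /negP; rewrite -ler_norml -ltNge.
exact: ltW.
Qed.

End shift.

Section shift_rV.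
Context {R : realType}.

Lemma measurable_shift_rV n (a : 'rV[R]_n) :
  measurable_fun setT (fun x : 'rV[R]_n => (x + a)%R).
Proof.
apply: measurable_fun_rVP => i.
rewrite (_ : (fun _ => _) = fun x : 'rV[R]_n => (rV_coord i x + a 0 i)%R).
  exact: (measurableT_comp (measurable_shift _) (measurable_coord i)).
by apply/funext => x; rewrite mxE.
Qed.

Lemma mpres_rV_cons n :
  mpres (lebesgue_measure \x lebesgue_rV R n) (lebesgue_rV R n.+1) (@rV_cons R n).
Proof. by apply: mpresP => //; exact: measurable_rV_cons. Qed.

Lemma rV_cons_shift n (a : 'rV[R]_n.+1) p : (rV_cons p + a =
  rV_cons (p.1 + a 0 0, p.2 + \row_i a 0 (lift 0 i)))%R.
Proof.
apply/rowP => i; rewrite mxE; case: (unliftP 0%R i) => [j ->|->].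
  by rewrite !rV_consS !mxE.
by rewrite !rV_cons0.
Qed.

Lemma mpres_shift_rV n (a : 'rV[R]_n) :
  mpres (lebesgue_rV R n) (lebesgue_rV R n) (fun x => (x + a)%R).
Proof.
elim: n a => [|n IH] a.
  split; first exact: measurable_shift_rV.
  move=> F mF F0; apply: eq_integral => x _; congr F.
  by apply/rowP => -[].
apply: (mpres_intertwine (mpres_rV_cons n) _ (measurable_shift_rV a)
  (rV_cons_shift a)).
exact: (mpres_prod (mpres_shift (a 0 0)%R) (IH (\row_i a 0 (lift 0 i)))%R).
Qed.

Lemma L1cvg_shift_rV n (a : nat -> 'rV[R]_n) :
  (forall i, (a k 0 i @[k --> \oo] --> (0 : R))%R) ->
  L1cvg (lebesgue_rV R n) (fun k x => (x + a k)%R).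
Proof.
elim: n a => [|n IH] a a0.
  move=> g ig; rewrite (_ : (fun _ => _) = cst 0); first exact: cvg_cst.
  apply/funext => k; rewrite integral0_eq// => x _.
  have -> : (x + a k)%R = x by apply/rowP => -[].
  by rewrite subrr abse0.
apply: (L1cvg_intertwine (mpres_rV_cons n) _ _ (fun k => rV_cons_shift (a k))).
  apply: (@L1cvg_prod R _ _ _ _ lebesgue_measure (lebesgue_rV R n)
    (fun k s => s + a k 0 0)%R (fun k x => x + \row_i a k 0 (lift 0 i))%R).
  - by move=> k; exact: mpres_shift.
  - by move=> k; exact: mpres_shift_rV.
  - by apply: L1cvg_shift; exact: a0.
  - apply: IH => i; rewrite (_ : (fun k => _) = fun k => a k 0%R (lift 0%R i)).
      exact: a0.
    by apply/funext => k; rewrite mxE.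
by move=> k; exact: measurable_shift_rV.
Qed.

(** Passes from sequences to a modulus: bad shifts with coordinates below 1/(k+1) would form a
    sequence tending to 0. *)
Lemma L1_shift_modulus n (g : 'rV[R]_n -> R) (e : R) :
  (lebesgue_rV R n).-integrable setT (EFin \o g) -> (0 < e)%R ->
  exists2 del : R, (0 < del)%R & forall a : 'rV[R]_n, (forall i, `|a 0 i| < del)%R ->
    \int[lebesgue_rV R n]_x `|(g (x + a) - g x)%:E| <= e%:E.
Proof.
move=> ig e0; apply: contrapT => /forall2NP h.
have hk k : exists a : 'rV[R]_n, (forall i, `|a 0%R i| < k.+1%:R^-1)%R /\
    e%:E < \int[lebesgue_rV R n]_x `|(g (x + a) - g x)%:E|.
  have [] := h k.+1%:R^-1%R; first by rewrite invr_gt0.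
  by move=> /existsNP[a /not_implyP[ai /negP]]; rewrite -ltNge; exists a.
have [a ha] := choice hk.
have a0 i : (a k 0 i @[k --> \oo] --> (0 : R))%R.
  apply/cvgr0Pnorm_le => /= s s0; near=> k.
  apply: ltW; apply: (lt_trans ((ha k).1 i)).
  by near: k; exact: (near_infty_natSinv_lt (PosNum s0)).
have := L1cvg_shift_rV a0 ig.
move=> /ereal_cvg0P => /(_ (fun n => integral_ge0 _ (fun _ _ => abse_ge0 _))).
move=> /(_ e e0)[N _ /(_ N (leqnn N))] /=.
by apply/negP; rewrite -ltNge; exact: (ha N).2.
Unshelve. all: by end_near. Qed.

End shift_rV.

Local Close Scope ereal_scope.

(** * Levy measures away from the origin *)

Section levy.
Context {R : realType} {d : nat}.
Local Notation V := 'rV[R]_d.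
Implicit Types (mu : {measure set V -> \bar R}) (r : R).

Lemma measurable_dotv d' (T : measurableType d') (f g : T -> V) :
  measurable_fun setT f -> measurable_fun setT g ->
  measurable_fun setT (fun x => dotv (f x) (g x)).
Proof.
move=> mf mg; apply: measurable_sum => i; apply: measurable_funM.
  exact: (measurableT_comp (measurable_coord i) mf).
exact: (measurableT_comp (measurable_coord i) mg).
Qed.

Lemma measurable_enorm : measurable_fun setT (@enorm R d).
Proof.
have ms : measurable_fun setT (@Num.sqrt R).
  by apply: continuous_measurable_fun; exact: sqrt_continuous.
have md : measurable_fun setT (fun z : V => dotv z z).
  by apply: measurable_dotv; exact: measurable_id.
exact: (measurableT_comp ms md).
Qed.

Lemma measurable_enorm_gt r : measurable [set z : V | r < enorm z].
Proof.
rewrite (_ : mkset _ = @enorm R d @^-1` `]r, +oo[%classic); last first.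
  by apply/seteqP; split=> z /=; rewrite in_itv/= andbT.
by rewrite -[X in measurable X]setTI; exact: measurable_enorm.
Qed.

Lemma measurable_enorm_le r : measurable [set z : V | enorm z <= r].
Proof.
rewrite (_ : mkset _ = ~` [set z : V | r < enorm z]); last first.
  by apply/seteqP; split=> z /=; rewrite leNgt => /negP.
exact: measurableC (measurable_enorm_gt r).
Qed.

Definition punct_ball r : set V := [set z | 0 < enorm z <= r].

Lemma measurable_punct_ball r : measurable (punct_ball r).
Proof.
rewrite (_ : punct_ball r = [set z | 0 < enorm z] `&` [set z | enorm z <= r]).
  by apply: measurableI; [exact: measurable_enorm_gt|exact: measurable_enorm_le].
by apply/seteqP; split=> z /= => [/andP[]|[? ?]] //; apply/andP.
Qed.

Definition levy_integrable mu :=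
  (\int[mu]_(z in [set z : V | (0 < enorm z)%R]) (Num.min (enorm z ^+ 2) 1)%:E
     < +oo)%E.

Let mmin : measurable_fun setT (fun z : V => (Num.min (enorm z ^+ 2) 1)%:E).
Proof.
apply/measurable_EFinP; apply: measurable_minr => //.
by apply: measurable_funX; exact: measurable_enorm.
Qed.

Let min_ge0 (z : V) : 0 <= Num.min (enorm z ^+ 2) 1.
Proof. by rewrite le_min sqr_ge0 ler01. Qed.

(** Chebyshev: beyond r the integrable weight min(|z|^2, 1) is at least min(r^2, 1). *)
Lemma levy_far_lty mu r : 0 < r -> levy_integrable mu ->
  (mu [set z : V | (r < enorm z)%R] < +oo)%E.
Proof.
move=> r0 imu; pose c := Num.min (r ^+ 2) 1.
have c0 : 0 < c by rewrite lt_min exprn_gt0 ?ltr01.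
have mr := measurable_enorm_gt r.
have h : (c%:E * mu [set z : V | (r < enorm z)%R] <=
    \int[mu]_(z in [set z : V | (0 < enorm z)%R]) (Num.min (enorm z ^+ 2) 1)%:E)%E.
  rewrite -integral_cst//; apply: (@le_trans _ _
    (\int[mu]_(z in [set z : V | (r < enorm z)%R]) (Num.min (enorm z ^+ 2) 1)%:E)%E).
    apply: ge0_le_integral => //.
    - by move=> z _; rewrite lee_fin ltW.
    - exact: measurable_funTS.
    - move=> z /= rz; rewrite lee_fin /c le_min !ge_min lexx orbT andbT.
      by apply/orP; left; rewrite ler_pXn2r ?nnegrE ?enorm_ge0 ?ltW.
  apply: ge0_subset_integral => //.
  - exact: measurable_enorm_gt.
  - exact: measurable_funTS.
  - by move=> z _; rewrite lee_fin.
  - by move=> z /=; exact: lt_trans.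
rewrite -(@lte_pmul2l _ c%:E) ?fin_numE// mulry gtr0_sg// mul1e.
exact: le_lt_trans h imu.
Qed.

(* The mass of mu at the origin is arbitrary, so mu itself need not be
   sigma-finite, which Fubini requires. *)
Lemma levy_sigma_finite mu : levy_integrable mu ->
  exists nu : {sigma_finite_measure set V -> \bar R},
    forall A, measurable A -> A `<=` [set z | 0 < enorm z] -> nu A = mu A.
Proof.
move=> imu; have m0 := measurable_enorm_gt 0.
pose nu : {measure set V -> \bar R} := mrestr mu m0.
have sf : sigma_finite setT nu.
  exists (fun n => [set z | enorm z <= 0] `|` [set z | n.+1%:R^-1 < enorm z]).
    apply/esym/seteqP; split=> // z _.
    have [z0|z0] := leP (enorm z) 0; first by exists 0%N => //; left.
    have [n zn] := @ltr_add_invr R 0 (enorm z) z0.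
    by exists n => //; right; move: zn; rewrite add0r.
  move=> n; split.
    by apply: measurableU; [exact: measurable_enorm_le|exact: measurable_enorm_gt].
  have n0 : 0 < n.+1%:R^-1 :> R by rewrite invr_gt0.
  apply: le_lt_trans (levy_far_lty n0 imu).
  rewrite /nu/= /mrestr; apply: le_measure; rewrite ?inE.
  - apply: measurableI => //.
    by apply: measurableU; [exact: measurable_enorm_le|exact: measurable_enorm_gt].
  - exact: measurable_enorm_gt.
  - by move=> z [[/= z0|//]]; rewrite ltNge z0.
pose sfm := @Measure_isSigmaFinite.Build _ _ _ nu sf.
pose nu' : {sigma_finite_measure set V -> \bar R} := HB.pack (Measure.sort nu) (Measure.class nu) sfm.
exists nu' => A mA A0; rewrite /= /mrestr; congr (mu _).
by apply/setIidPl.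
Qed.

End levy.

(** * The operators of the entropy inequality *)

Section levy_operators.
Context {R : realType} {d : nat}.
Local Notation V := 'rV[R]_d.

Section eq_levy.
Variables mu nu : {measure set V -> \bar R}.
Hypothesis munu : forall A, measurable A -> A `<=` [set z | 0 < enorm z] -> nu A = mu A.

Let eq_Rint (D : set V) (F : V -> R) : D `<=` [set z | 0 < enorm z] ->
  \int[nu]_(z in D) F z = \int[mu]_(z in D) F z.
Proof.
move=> D0; rewrite /Rintegral; congr fine; apply: eq_measure_integral => A mA AD.
by apply: munu => //; exact: subset_trans D0.
Qed.

Lemma eq_levy_integrable : levy_integrable mu -> levy_integrable nu.
Proof.
rewrite /levy_integrable; congr (_ < _)%E.
apply: eq_measure_integral => A mA AD.
exact/esym/munu.
Qed.

Lemma eq_levy_near r : levy_near nu r = levy_near mu r.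
Proof.
apply/funext => phi; apply/funext => x; apply: eq_Rint => z /= /andP[].
by [].
Qed.

Lemma eq_levy_far r : 0 < r -> levy_far nu r = levy_far mu r.
Proof.
move=> r0; apply/funext => phi; apply/funext => x; apply: eq_Rint => z /=.
exact: lt_trans.
Qed.

Lemma eq_levy_drift r : 0 < r -> levy_drift nu r = levy_drift mu r.
Proof.
move=> r0; apply/rowP => i; rewrite !mxE; apply: eq_Rint => z /= /andP[+ _].
exact: lt_trans.
Qed.

(** Every operator in the entropy inequality integrates over a set that avoids the origin, so it
    cannot tell mu from its sigma-finite replacement. *)
Lemma entropy_solution_eq_levy f A T u0 u :
  entropy_solution f A mu T u0 u -> entropy_solution f A nu T u0 u.
Proof.
case=> Loo L1 cont ineq init; split => // k r phi r0 tphi phi0.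
have := ineq k r phi r0 tphi phi0.
rewrite (_ : entropy_integrand f A mu u k r phi =
  entropy_integrand f A nu u k r phi)//.
apply/funext => -[x t]; rewrite /entropy_integrand.
by rewrite eq_levy_near eq_levy_far// eq_levy_drift.
Qed.

End eq_levy.

Section near.
Variable nu : {measure set V -> \bar R}.
Hypothesis inu : levy_integrable nu.

(** The punctured balls shrink to the empty set, and dominated convergence applies with the Levy
    weight as majorant. *)
Lemma near_sqr_small (e : R) : 0 < e -> exists2 r : R, 0 < r < 1 &
  (\int[nu]_(z in punct_ball r) (enorm z ^+ 2)%:E <= e%:E)%E.
Proof.
(* n + 2 keeps the radius below 1, where the Levy weight is |z|^2. *)
move=> e0; pose r (n : nat) : R := n.+2%:R^-1.
have r01 n : 0 < r n < 1 by rewrite invr_gt0 ltr0n invf_lt1 ?ltr1n.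
pose F n := (fun z : V => (enorm z ^+ 2)%:E) \_ (punct_ball (r n)).
pose G := (fun z : V => (Num.min (enorm z ^+ 2) 1)%:E) \_ [set z | 0 < enorm z].
have msq : measurable_fun setT (fun z : V => (enorm z ^+ 2)%:E).
  by apply/measurable_EFinP; apply: measurable_funX; exact: measurable_enorm.
have FG n z : (F n z <= G z)%E.
  rewrite /F /G !patchE; have /andP[r0 r1] := r01 n.
  case: ifPn => [|_].
    rewrite inE => /andP[z0 zr]; rewrite mem_set// lee_fin le_min lexx /=.
    by rewrite expr_le1 ?enorm_ge0// (le_trans zr)// ltW.
  by case: ifP => // _; rewrite lee_fin le_min sqr_ge0 ler01.
have F0 n z : (0 <= F n z)%E.
  by rewrite /F patchE; case: ifP => // _; rewrite lee_fin sqr_ge0.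
have mmin : measurable_fun setT (fun z : V => (Num.min (enorm z ^+ 2) 1)%:E).
  apply/measurable_EFinP; apply: measurable_minr => //.
  by apply: measurable_funX; exact: measurable_enorm.
have mG : measurable_fun setT G.
  apply/(measurable_restrictT _ (measurable_enorm_gt 0)).
  exact: measurable_funTS.
have mF n : measurable_fun setT (F n).
  apply/(measurable_restrictT _ (measurable_punct_ball (r n))).
  exact: measurable_funTS.
have iG : nu.-integrable setT G.
  apply/integrableP; split => //.
  rewrite (eq_integral G); last first.
    by move=> z _; rewrite gee0_abs// (le_trans (F0 0%N z)).
  by rewrite -integral_mkcond.
have /ereal_cvg0P : (fun n => \int[nu]_z F n z)%E @ \oo --> 0%E.
  apply: (ge0_dominated_cvg0 mF F0 iG FG); apply: aeW => z.
  apply/ereal_cvg0P => // s s0.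
  have [z0|z0] := leP (enorm z) 0.
    apply: nearW => n; rewrite /F patchE ifF ?lee_fin ?ltW//.
    by apply/negbTE; rewrite notin_setE /= => /andP[]; rewrite ltNge z0.
  have [N zN] := @ltr_add_invr R 0 (enorm z) z0.
  exists N => // n /= Nn; rewrite /F patchE ifF ?lee_fin ?ltW//.
  apply/negbTE; rewrite notin_setE /= => /andP[_]; apply/negP; rewrite -ltNge.
  move: zN; rewrite add0r; apply: le_lt_trans.
  by rewrite /r lef_pV2 ?posrE// ler_nat ltnS ltnW.
move=> /(_ (fun n => integral_ge0 _ (fun _ _ => F0 _ _))) /(_ e e0)[N _].
move=> /(_ N (leqnn N)) /= hN; exists (r N); first exact: r01.
by rewrite integral_mkcond.
Qed.

(** As r < 1 the indicator is 1 on the domain, and the integrand is the Taylor remainder of g for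
    the increment - z. *)
Lemma levy_near_le (g : V -> R) (C e r : R) x : 0 <= C -> 0 < r < 1 ->
  measurable_fun setT g ->
  (\int[nu]_(z in punct_ball r) (enorm z ^+ 2)%:E <= e%:E)%E ->
  (forall z, `|g (x + z) - g x - dotv z (grad g x)| <= C * enorm z ^+ 2) ->
  `|levy_near nu r g x| <= C * e.
Proof.
move=> C0 /andP[r0 r1] mg ie gC; rewrite /levy_near -/(punct_ball r) /Rintegral.
set I := (\int[nu]_(z in _) _)%E.
have mF : measurable_fun setT (fun z : V =>
    (g (x - z) - g x + dotv z (grad g x) * (enorm z < 1)%R%:R)%:E).
  apply/measurable_EFinP; apply: measurable_funD.
    apply: measurable_funB => //.
    have mx : measurable_fun setT (fun z : V => x - z).
      apply: measurable_fun_rVP => i.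
      rewrite (_ : (fun _ => _) = fun z : V => x 0 i - rV_coord i z).
        by apply: measurable_funB => //; exact: measurable_coord.
      by apply/funext => z; rewrite !mxE.
    exact: (measurableT_comp mg mx).
  apply: measurable_funM; first by apply: measurable_dotv => //; exact: measurable_id.
  rewrite (_ : (fun _ => _) = \1_[set z : V | enorm z < 1]).
    apply: measurable_indic.
    rewrite (_ : mkset _ = ~` [set z : V | 1 <= enorm z]); last first.
      by apply/seteqP; split=> z /=; rewrite ltNge => /negP.
    apply: measurableC.
    rewrite (_ : mkset _ = @enorm R d @^-1` `[1, +oo[%classic); last first.
      by apply/seteqP; split=> z /=; rewrite in_itv/= andbT.
    by rewrite -[X in measurable X]setTI; exact: measurable_enorm.
  apply/funext => z; rewrite indicE (_ : (z \in _) = (enorm z < 1))//.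
  by apply/idP/idP; rewrite inE.
have mp : measurable (punct_ball r : set V) by exact: measurable_punct_ball.
have hI : (`|I| <= (C * e)%:E)%E.
  apply: (le_trans (le_abse_integral nu mp (measurable_funTS mF))).
  apply: (@le_trans _ _ (\int[nu]_(z in punct_ball r) (C%:E * (enorm z ^+ 2)%:E))%E).
    apply: ge0_le_integral => //.
    - by apply: measurableT_comp => //; exact: measurable_funTS.
    - apply: measurable_funTS; apply/measurable_EFinP; apply: measurable_funM => //.
      by apply: measurable_funX; exact: measurable_enorm.
    - move=> z /andP[z0 zr]; rewrite abse_EFin lee_fin.
      rewrite (le_lt_trans zr r1) mulr1.
      have := gC (- z); rewrite dotvNl opprK enormN; exact.
  rewrite ge0_integralZl//.
  - by rewrite EFinM lee_wpmul2l.
  - apply: measurable_funTS; apply/measurable_EFinP.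
    by apply: measurable_funX; exact: measurable_enorm.
  - by move=> z _; rewrite lee_fin sqr_ge0.
have fI : I \is a fin_num by rewrite -abse_fin_num ge0_fin_numE// (le_lt_trans hI) ?ltry.
by rewrite -lee_fin -abse_EFin fineK.
Qed.

Lemma levy_near_eq0 (g : V -> R) r x :
  (forall z, enorm z <= r -> g (x - z) = 0) -> grad g x = 0 -> 0 <= r ->
  levy_near nu r g x = 0.
Proof.
move=> g0 G0 r0; rewrite /levy_near /Rintegral integral0_eq// => z /= /andP[_ zr].
by rewrite g0// -[x in g x]subr0 g0 ?G0 ?dotv0r ?mul0r ?subr0 ?addr0// /enorm dotv0r sqrtr0.
Qed.

End near.

End levy_operators.

Lemma ae_le_integral (R : realType) d (T : measurableType d)
    (m : {measure set T -> \bar R}) (f g : T -> R) :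
  m.-integrable setT (EFin \o f) -> m.-integrable setT (EFin \o g) ->
  {ae m, forall t, f t <= g t} ->
  (\int[m]_t (f t)%:E <= \int[m]_t (g t)%:E)%E.
Proof.
move=> jf ig fg.
have mgf : measurable_fun setT (fun t => (g t - f t)%:E).
  apply/measurable_EFinP; apply: measurable_funB.
    by case/integrableP : ig => /measurable_EFinP.
  by case/integrableP : jf => /measurable_EFinP.
have : (0 <= \int[m]_t (g t - f t)%:E)%E.
  rewrite (ae_eq_integral (fun t => `|(g t - f t)%:E|%E))//.
  - exact: integral_ge0.
  - exact: measurableT_comp.
  - by apply: filterS fg => t fg _; rewrite abse_EFin ger0_norm// subr_ge0.
under eq_integral do rewrite EFinB.
rewrite integralB_EFin// sube_ge0// integrable_fin_num ?orbT//.
Qed.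

(** * The far operator of a measure-preserving family *)

Section far.
Context {R : realType} d1 d2 (T : measurableType d1) (Z : measurableType d2).
Variables (m : {sigma_finite_measure set T -> \bar R}).
Variables (nu : {sigma_finite_measure set Z -> \bar R}).
Variables (D : set Z) (mD : measurable D) (D_lty : (nu D < +oo)%E).

(** Tonelli with z outermost: by invariance every inner integral is the norm of g, and D has finite
    mass. *)
Lemma integrable_action (psi : T -> Z -> T) (g : T -> R) :
  measurable_fun setT (fun tz : T * Z => psi tz.1 tz.2) ->
  (forall z, mpres m m (psi ^~ z)) -> m.-integrable setT (EFin \o g) ->
  (m \x nu)%E.-integrable setT (fun tz => (g (psi tz.1 tz.2) * \1_D tz.2)%:E).
Proof.
move=> mpsi ppsi ig.
have mg : measurable_fun setT g by case/integrableP : ig => /measurable_EFinP.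
have mH : measurable_fun setT (fun tz : T * Z => (g (psi tz.1 tz.2) * \1_D tz.2)%:E).
  apply/measurable_EFinP; apply: measurable_funM.
    exact: (measurableT_comp mg mpsi).
  have mI : measurable_fun setT (\1_D : Z -> R) by exact: measurable_indic.
  exact: (measurableT_comp mI measurable_snd).
apply/(integrable21ltyP _ _ mH).
have N0 : (0 <= \int[m]_t `|(g t)%:E|)%E by exact: integral_ge0.
rewrite (eq_integral (fun z => (\int[m]_t `|(g t)%:E|) * (\1_D z)%:E)%E).
  rewrite ge0_integralZl//.
  - rewrite integral_indic// setIT; case/integrableP : ig => _ Nlty.
    by rewrite lte_mul_pinfty// ge0_fin_numE.
  - by apply/measurable_EFinP; exact: measurable_indic.
move=> z _; rewrite -((ppsi z).2 (fun t => `|(g t)%:E|)%E)//; last first.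
  by apply: measurableT_comp => //; exact/measurable_EFinP.
rewrite muleC -ge0_integralZl//.
  apply: eq_integral => t _.
  by rewrite EFinM abseM muleC [X in (X * _)%E]gee0_abs ?lee_fin.
apply: measurableT_comp => //; apply/measurable_EFinP.
exact: (measurableT_comp mg (ppsi z).1).
Qed.

Variable phi : T -> Z -> T.
Hypothesis mphi : measurable_fun setT (fun tz : T * Z => phi tz.1 tz.2).
Hypothesis pphi : forall z, mpres m m (phi ^~ z).

(** Kept abstract in phi because it is used twice: for shifts of one space-time point ([shiftQ]) and
    for simultaneous shifts of two ([shiftQQ]). *)
Definition far (g : T -> R) (t : T) : R := \int[nu]_(z in D) (g (phi t z) - g t).

Let H (g : T -> R) (tz : T * Z) : \bar R :=
  ((g (phi tz.1 tz.2) - g tz.1) * \1_D tz.2)%:E.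

Let farE g t : far g t = fine (\int[nu]_z H g (t, z)).
Proof.
rewrite /far Rintegral_mkcond /Rintegral; congr fine; apply: eq_integral => z _.
by rewrite /H patchE indicE /=; case: ifP => _; rewrite ?mulr1 ?mulr0.
Qed.

Let integrable_H g : m.-integrable setT (EFin \o g) ->
  (m \x nu)%E.-integrable setT (H g).
Proof.
move=> ig.
have h1 := integrable_action mphi pphi ig.
have idp (z : Z) : mpres m m ((fun t _ => t) ^~ z) by split.
have h2 := @integrable_action (fun t _ => t) g measurable_fst idp ig.
rewrite (_ : H g = (fun tz => (g (phi tz.1 tz.2) * \1_D tz.2)%:E) \-
  (fun tz => (g tz.1 * \1_D tz.2)%:E))%E; first exact: integrableB.
by apply/funext => tz; rewrite /H mulrBl EFinB.
Qed.

Lemma ae_integrable_far g : m.-integrable setT (EFin \o g) ->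
  {ae m, forall t, nu.-integrable D (fun z => (g (phi t z) - g t)%:E)}.
Proof.
move=> ig; apply: filterS (ae_integrable1 (integrable_H ig)) => t it.
apply/(integrable_mkcond _ mD); apply: eq_integrable it => // z _.
by rewrite /H patchE indicE /=; case: ifP => _; rewrite ?mulr1 ?mulr0.
Qed.

(** [far] sends an infinite or undefined integral to 0, so the identity is claimed only where the
    section is integrable. *)
Let far_ae g : m.-integrable setT (EFin \o g) ->
  {ae m, forall t, (far g t)%:E = (\int[nu]_z H g (t, z))%E}.
Proof.
move=> ig; apply: filterS (ae_integrable1 (integrable_H ig)) => t it.
by rewrite farE fineK//; exact: integrable_fin_num.
Qed.

Lemma measurable_far g : m.-integrable setT (EFin \o g) ->
  measurable_fun setT (far g).
Proof.
move=> ig; rewrite (_ : far g = fun t => fine (\int[nu]_z H g (t, z))).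
  apply: measurableT_comp => //; exact: (measurable_fubini_F (integrable_H ig)).
by apply/funext => t; rewrite farE.
Qed.

Lemma integrable_far g : m.-integrable setT (EFin \o g) ->
  m.-integrable setT (EFin \o far g).
Proof.
move=> ig; apply/integrableP; split.
  by apply/measurable_EFinP; exact: measurable_far.
have := integrable_fubini_F (integrable_H ig) => /integrableP[mF].
apply: le_lt_trans; apply: ae_ge0_le_integral => //.
- apply: measurableT_comp => //; apply/measurable_EFinP; exact: measurable_far.
- exact: measurableT_comp.
- by apply: filterS (far_ae ig) => t ft _; rewrite /fubini_F -ft.
Qed.

(** After Fubini each z contributes the integral of g o phi(., z) minus that of g, which is 0 by
    invariance. *)
Lemma integral_far g : m.-integrable setT (EFin \o g) ->
  (\int[m]_t (far g t)%:E = 0)%E.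
Proof.
move=> ig; have iH := integrable_H ig.
have mg : measurable_fun setT g by case/integrableP : ig => /measurable_EFinP.
rewrite (ae_eq_integral (fun t => \int[nu]_z H g (t, z))%E)//.
- rewrite (Fubini iH) integral0_eq// => z _.
  have ip := mpres_integrable (pphi z) ig.
  transitivity (\int[m]_t ((\1_D z)%:E * ((g (phi t z))%:E - (g t)%:E)))%E.
    by apply: eq_integral => t _; rewrite /H /= mulrC EFinM EFinB.
  rewrite integralZl//; last exact: integrableB.
  rewrite integralB_EFin//.
  rewrite (mpres_integral (F := EFin \o g) (pphi z)); last exact/measurable_EFinP.
  by rewrite subee ?mule0//; exact: integrable_fin_num.
- by apply/measurable_EFinP; exact: measurable_far.
- exact: (measurable_fubini_F iH).
- by apply: filterS (far_ae ig) => t + _.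
Qed.

(* s is a sign of a - b, so that s * (far a - far b) <= far |a - b| pointwise,
   and the integral of the latter vanishes by invariance. *)
Lemma far_pair_le0 (a b s : T -> R) :
  m.-integrable setT (EFin \o a) -> m.-integrable setT (EFin \o b) ->
  measurable_fun setT s -> (forall t, `|s t| <= 1) ->
  (forall t, s t * (a t - b t) = `|a t - b t|) ->
  m.-integrable setT (fun t => (s t * (far a t - far b t))%:E) /\
  (\int[m]_t (s t * (far a t - far b t))%:E <= 0)%E.
Proof.
move=> ia ib ms s1 sab.
have iab : m.-integrable setT (EFin \o (fun t => a t - b t)).
  by apply: eq_integrable (integrableB measurableT ia ib) => //.
have iabs : m.-integrable setT (EFin \o (fun t => `|a t - b t|)).
  exact: (integrable_abse iab).
have ifab : m.-integrable setT (fun t => (far a t - far b t)%:E).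
  apply: eq_integrable (integrableB measurableT (integrable_far ia) (integrable_far ib)) => //.
have iS : m.-integrable setT (fun t => (s t * (far a t - far b t))%:E).
  apply: le_integrable ifab => //.
    apply/measurable_EFinP; apply: measurable_funM => //.
    by apply: measurable_funB; exact: measurable_far.
  by move=> t _; rewrite !abse_EFin lee_fin normrM ler_piMl.
split=> //; rewrite -(integral_far iabs).
apply: ae_le_integral => //; first exact: integrable_far.
apply: filterS3 (ae_integrable_far ia) (ae_integrable_far ib) (ae_integrable_far iabs).
move=> t ha hb hab.
have hB : nu.-integrable D (EFin \o
    (fun z => (a (phi t z) - a t) - (b (phi t z) - b t))).
  by apply: eq_integrable (integrableB mD ha hb) => //.
rewrite /far -RintegralB// -RintegralZl//.
apply: le_Rintegral => //.
  by apply: eq_integrable (integrableZl mD (s t) hB) => //.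
move=> z _.
rewrite (_ : s t * _ = s t * (a (phi t z) - b (phi t z)) - s t * (a t - b t)); last by ring.
by rewrite sab lerD2r (le_trans (ler_norm _))// normrM ler_piMl.
Qed.

End far.

(** * Doubled space-time and integrability near the diagonal *)

Section prod_sf.
Context (R : realType) d1 d2 (T1 : measurableType d1) (T2 : measurableType d2).
Variables (m1 : {sigma_finite_measure set T1 -> \bar R}).
Variables (m2 : {sigma_finite_measure set T2 -> \bar R}).

(** The product measure under a name of its own, carrying the sigma-finite structure that iterated
    products require. *)
Definition prod_sf : set (T1 * T2)%type -> \bar R := (m1 \x m2)%E.

HB.instance Definition _ := Measure.on prod_sf.

Let prod_sf_sigma_finite : sigma_finite setT prod_sf.
Proof.
have /sigma_finiteP[F [TF ndF Foo]] := sigma_finiteT m1.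
have /sigma_finiteP[G [TG ndG Goo]] := sigma_finiteT m2.
exists (fun n => F n `*` G n).
  rewrite -setXTT TF TG predeqE => -[x y]; split.
    move=> [/= [n _ Fnx] [k _ Gky]]; exists (maxn n k) => //; split.
    - by move: x Fnx; exact/subsetPset/ndF/leq_maxl.
    - by move: y Gky; exact/subsetPset/ndG/leq_maxr.
  by move=> [n _ []/= ? ?]; split; exists n.
move=> k; have [? ?] := Foo k; have [? ?] := Goo k.
split; first exact: measurableX.
by rewrite /prod_sf product_measure1E// lte_mul_pinfty// ge0_fin_numE.
Qed.

HB.instance Definition _ := Measure_isSigmaFinite.Build _ _ _ prod_sf
  prod_sf_sigma_finite.
End prod_sf.

Section space_time.
Context {R : realType} {d : nat}.
Local Notation V := 'rV[R]_d.
Local Notation lam := (lebesgue_rV R d).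

Definition lebQ := prod_sf (lebesgue_rV R d) (@lebesgue_measure R).

Definition lebQQ := prod_sf lebQ lebQ.

(** The set is unbounded along the diagonal x = y, but its sections at a fixed point have uniformly
    bounded measure: an integrable function of one point remains integrable on it. *)
Definition box (b a0 a1 : R) : set ((V * R) * (V * R))%type :=
  [set pq : (V * R) * (V * R) | (forall i : 'I_d, `|((pq.1.1 : V) - pq.2.1) 0 i| <= b) /\
            (a0 <= pq.1.2 <= a1 /\ a0 <= pq.2.2 <= a1)].

Lemma measurable_addv d' (T : measurableType d') (f g : T -> V) :
  measurable_fun setT f -> measurable_fun setT g ->
  measurable_fun setT (fun x => f x + g x).
Proof.
move=> mf mg; apply: measurable_fun_rVP => i.
rewrite (_ : (fun _ => _) = fun x => rV_coord i (f x) + rV_coord i (g x)).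
  by apply: measurable_funD;
    [exact: (measurableT_comp (measurable_coord i) mf)|
     exact: (measurableT_comp (measurable_coord i) mg)].
by apply/funext => x; rewrite mxE.
Qed.

Lemma measurable_subv d' (T : measurableType d') (f g : T -> V) :
  measurable_fun setT f -> measurable_fun setT g ->
  measurable_fun setT (fun x => f x - g x).
Proof.
move=> mf mg; apply: measurable_fun_rVP => i.
rewrite (_ : (fun _ => _) = fun x => rV_coord i (f x) - rV_coord i (g x)).
  by apply: measurable_funB;
    [exact: (measurableT_comp (measurable_coord i) mf)|
     exact: (measurableT_comp (measurable_coord i) mg)].
by apply/funext => x; rewrite !mxE.
Qed.

Let Q := (V * measurableTypeR R)%type.

Lemma measurable_xy : measurable_fun setT (fun pq : Q * Q => pq.1.1 - pq.2.1).
Proof.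
apply: measurable_subv.
  exact: (measurableT_comp measurable_fst measurable_fst).
exact: (measurableT_comp measurable_fst measurable_snd).
Qed.

Lemma measurable_t1 : measurable_fun setT (fun pq : Q * Q => pq.1.2 : R).
Proof. exact: (measurableT_comp measurable_snd measurable_fst). Qed.

Lemma measurable_t2 : measurable_fun setT (fun pq : Q * Q => pq.2.2 : R).
Proof. exact: (measurableT_comp measurable_snd measurable_snd). Qed.

Lemma measurable_box b a0 a1 : measurable (box b a0 a1 : set (Q * Q)%type).
Proof.
pose B : set V := [set v | forall i, `[-b, b]%classic (v 0 i)].
rewrite (_ : box b a0 a1 = ((fun pq : Q * Q => pq.1.1 - pq.2.1) @^-1` B) `&`
   (((fun pq : Q * Q => pq.1.2 : R) @^-1` `[a0, a1]%classic) `&`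
   ((fun pq : Q * Q => pq.2.2 : R) @^-1` `[a0, a1]%classic))); last first.
  apply/seteqP; split=> -[[x t] [y s]]; rewrite /box /B /= !in_itv/=.
    by move=> [h [? ?]]; split=> // i; rewrite in_itv/= -ler_norml.
  by move=> [h [? ?]]; split=> // i; have := h i; rewrite in_itv/= -ler_norml.
have mB : measurable B.
  by apply: (@measurable_rV_box R d (fun=> `[-b, b]%classic)) => i; exact: measurable_itv.
apply: measurableI.
  by rewrite -[X in measurable X]setTI; exact: measurable_xy.
apply: measurableI.
  by rewrite -[X in measurable X]setTI; apply: measurable_t1 => //; exact: measurable_itv.
by rewrite -[X in measurable X]setTI; apply: measurable_t2 => //; exact: measurable_itv.
Qed.

Lemma box_section b a0 a1 (p : Q) : 0 <= b -> a0 <= a1 ->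
  (\int[lebQ]_q (\1_(box b a0 a1) (p, q))%:E <= ((2 * b) ^+ d * (a1 - a0))%:E)%E.
Proof.
move=> b0 a01.
pose B : set Q := [set y : V | forall i, `[p.1 0 i - b, p.1 0 i + b]%classic (y 0 i)] `*`
  `[a0, a1]%classic.
have mB1 : measurable [set y : V | forall i, `[p.1 0 i - b, p.1 0 i + b]%classic (y 0 i)].
  apply: (@measurable_rV_box R d (fun i => `[p.1 0 i - b, p.1 0 i + b]%classic)) => i.
  exact: measurable_itv.
have mI : measurable (`[a0, a1]%classic : set (measurableTypeR R)).
  exact: measurable_itv.
have mB : measurable B by exact: measurableX.
have PB : lebQ B = ((2 * b) ^+ d * (a1 - a0))%:E.
  rewrite /lebQ /prod_sf /B product_measure1E// EFinM.
  congr (_ * _)%E; last first.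
    apply: (etrans (lebesgue_measure_itv _)); rewrite /= lte_fin; case: ltP => // a10.
    by rewrite (le_anti (introT andP (conj a01 a10))) subrr.
  apply: (etrans (@lebesgue_rV_box R d (fun i => `[p.1 0 i - b, p.1 0 i + b]%classic)
    (fun i => measurable_itv _))).
  rewrite -[in RHS](card_ord d) -prodr_const -prodEFin; apply: eq_bigr => i _.
  apply: (etrans (lebesgue_measure_itv _)); rewrite /= lte_fin; case: ltP => h.
    by rewrite -EFinB; congr EFin; ring.
  by congr EFin; lra.
have <- : (\int[lebQ]_q (\1_B q)%:E = ((2 * b) ^+ d * (a1 - a0))%:E)%E.
  by rewrite integral_indic// setIT.
apply: ge0_le_integral => //.
- apply/measurable_EFinP.
  have m1 : measurable_fun setT (\1_(box b a0 a1) : Q * Q -> R).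
    by apply: measurable_indic; exact: measurable_box.
  exact: (measurableT_comp m1 (measurable_pair1 p)).
- by apply/measurable_EFinP; exact: measurable_indic.
move=> q _; rewrite lee_fin !indicE; case: (boolP ((p, q) \in _)) => // /[!inE] -[h [_ h2]].
rewrite mem_set//; split=> /= [i|]; last by rewrite in_itv.
by have := h i; rewrite /= !mxE in_itv/= distrC ler_distl.
Qed.

Lemma box_sym b a0 a1 (p q : Q) :
  \1_(box b a0 a1) (p, q) = \1_(box b a0 a1) (q, p) :> R.
Proof.
rewrite !indicE; congr (nat_of_bool _)%:R.
by apply/idP/idP; rewrite !inE /box /= => -[h [? ?]]; split=> // i;
  have := h i; rewrite !mxE distrC.
Qed.

Lemma integrable_box1 b a0 a1 (g : Q -> R) : 0 <= b -> a0 <= a1 ->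
  lebQ.-integrable setT (EFin \o g) ->
  lebQQ.-integrable setT (fun pq => (g pq.1 * \1_(box b a0 a1) pq)%:E).
Proof.
move=> b0 a01 ig.
have mg : measurable_fun setT g by case/integrableP : ig => /measurable_EFinP.
have mI : measurable_fun setT (\1_(box b a0 a1) : Q * Q -> R).
  by apply: measurable_indic; exact: measurable_box.
have mF : measurable_fun setT (fun pq : Q * Q => (g pq.1 * \1_(box b a0 a1) pq)%:E).
  apply/measurable_EFinP; apply: measurable_funM => //.
  exact: (measurableT_comp mg measurable_fst).
apply/(integrable12ltyP _ _ mF).
have C0 : 0 <= (2 * b) ^+ d * (a1 - a0).
  by rewrite mulr_ge0 ?subr_ge0// exprn_ge0// mulr_ge0.
apply: (@le_lt_trans _ _ (\int[lebQ]_p (((2 * b) ^+ d * (a1 - a0))%:E * `|(g p)%:E|))%E).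
  apply: ge0_le_integral => //.
  - by move=> p _; exact: integral_ge0.
  - apply: (measurable_fun_fubini_tonelli_F (m2 := lebQ) (fun pq => `|(g pq.1 * \1_(box b a0 a1) pq)%:E|%E)) => //.
    exact: measurableT_comp.
  - apply: emeasurable_funM => //; apply: measurableT_comp => //.
    exact/measurable_EFinP.
  move=> p _.
  rewrite (eq_integral (fun q : Q => `|(g p)%:E| * (\1_(box b a0 a1) (p, q))%:E)%E).
    rewrite ge0_integralZl//.
    - by rewrite muleC lee_wpmul2r// box_section.
    - by apply/measurable_EFinP; exact: (measurableT_comp mI (measurable_pair1 p)).
  by move=> q _; rewrite EFinM abseM [X in (_ * X)%E]gee0_abs ?lee_fin.
rewrite ge0_integralZl//.
- by case/integrableP : ig => _ h; rewrite lte_mul_pinfty.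
- by apply: measurableT_comp => //; exact/measurable_EFinP.
Qed.

Lemma mpres_lebQQ_swap : mpres lebQQ lebQQ (fun pq => (pq.2, pq.1)).
Proof. exact: (@mpres_swap R _ _ _ _ lebQ lebQ). Qed.

Lemma integrable_box2 b a0 a1 (g : Q -> R) : 0 <= b -> a0 <= a1 ->
  lebQ.-integrable setT (EFin \o g) ->
  lebQQ.-integrable setT (fun pq => (g pq.2 * \1_(box b a0 a1) pq)%:E).
Proof.
move=> b0 a01 /(integrable_box1 b0 a01) /(mpres_integrable mpres_lebQQ_swap).
by apply: eq_integrable => // -[p q] _; rewrite /= box_sym.
Qed.

(** The criterion by which every doubled term is shown integrable. *)
Lemma integrable_box_dominated b a0 a1 C (g h : Q -> R) (F : Q * Q -> R) :
  0 <= b -> a0 <= a1 -> 0 <= C ->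
  lebQ.-integrable setT (EFin \o g) -> lebQ.-integrable setT (EFin \o h) ->
  measurable_fun setT F ->
  (forall pq, `|F pq| <= C * (`|g pq.1| + `|h pq.2|) * \1_(box b a0 a1) pq) ->
  lebQQ.-integrable setT (EFin \o F).
Proof.
move=> b0 a01 C0 ig ih mF hF.
have i1 := integrable_box1 b0 a01 (integrable_abse ig).
have i2 := integrable_box2 b0 a01 (integrable_abse ih).
have := integrableZl measurableT C (integrableD measurableT i1 i2).
apply: le_integrable => //; first exact/measurable_EFinP.
move=> pq _; rewrite /= lee_fin (le_trans (hF pq))// (le_trans _ (ler_norm _))//.
by rewrite -mulrDl mulrA.
Qed.

End space_time.

(** * Integrability of entropy solutions *)

Section entropy_integrability.
Context {R : realType} {d : nat}.
Local Notation V := 'rV[R]_d.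

Lemma lipschitz_bound (W : normedModType R) (f : R -> W) : lipschitz f ->
  exists2 L : R, 0 <= L & forall x y, `|f x - f y| <= L * `|x - y|.
Proof.
move=> [M [_ /(_ (Num.max 0 (M + 1)))]].
rewrite lt_max ltrDl ltr01 orbT => /(_ isT) h.
exists (Num.max 0 (M + 1)); first by rewrite le_max lexx.
by move=> x y; exact: (h (x, y)).
Qed.

Variables (f : R -> V) (A : R -> R) (mu : {measure set V -> \bar R}) (T : R).
Variables (u0 : V -> R) (u : V * R -> R).
Hypothesis T0 : 0 < T.
Hypothesis es : entropy_solution f A mu T u0 u.

Definition extU : V * R -> R := u \_ (QT T).

Lemma extUE x t : 0 < t < T -> extU (x, t) = u (x, t).
Proof. by move=> tT; rewrite /extU patchE mem_set//; split => //=; rewrite in_itv. Qed.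

Lemma extU_out x t : ~~ (0 < t < T) -> extU (x, t) = 0.
Proof.
move=> tT; rewrite /extU patchE ifF//; apply/negbTE; rewrite notin_setE => -[_] /=.
by rewrite in_itv/= (negbTE tT).
Qed.

Lemma measurable_extU : measurable_fun setT (extU : V * measurableTypeR R -> R).
Proof.
have /sub_Lfun_mfun := entropy_Loo es; rewrite inE => h; exact: h.
Qed.

Lemma integrable_slice t : 0 <= t <= T ->
  (lebesgue_rV R d).-integrable setT (fun x => (u (x, t))%:E).
Proof. by move=> tT; apply/Lfun1_integrable; exact: (entropy_L1 es). Qed.

Let N (t : R) : R := fine (\int[lebesgue_rV R d]_x `|(u (x, t))%:E|)%E.

Let NE t : 0 <= t <= T -> (\int[lebesgue_rV R d]_x `|(u (x, t))%:E| = (N t)%:E)%E.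
Proof.
move=> tT; rewrite /N fineK// ge0_fin_numE ?integral_ge0//.
by have /integrableP[] := integrable_slice tT.
Qed.

Lemma slice_cvg t : 0 <= t <= T ->
  (\int[lebesgue_rV R d]_x `|(u (x, s) - u (x, t))%:E|)%E
    @[s --> within `[0, T] (nbhs t)] --> 0%E.
Proof.
move=> tT; have := entropy_continuous es tT.
by under eq_fun do rewrite Lnorm1.
Qed.

(** The L^1 norm is continuous in time, hence bounded on the compact [0, T]. This makes the
    extension integrable on space-time, which the L^oo bound alone does not give. *)
Lemma slice_L1_bounded : exists2 M : R, 0 <= M & forall t, 0 <= t <= T ->
  (\int[lebesgue_rV R d]_x `|(u (x, t))%:E| <= M%:E)%E.
Proof.
have cN : {within `[0, T], continuous N}.
  apply/subspace_continuousP => t /=; rewrite in_itv/= => tT.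
  apply/cvgrPdist_le => e e0.
  have := slice_cvg tT => /fine_cvgP[ff /cvgrPdist_le /(_ e e0)] h.
  near=> s.
  have sT : 0 <= s <= T.
    have : s \in `[0, T] by near: s; exact: withinT.
    by rewrite in_itv.
  have fs : (\int[lebesgue_rV R d]_x `|(u (x, s) - u (x, t))%:E|)%E \is a fin_num.
    by near: s.
  have : `|0 - fine (\int[lebesgue_rV R d]_x `|(u (x, s) - u (x, t))%:E|)%E| <= e.
    by near: s.
  rewrite sub0r normrN ger0_norm ?fine_ge0 ?integral_ge0//; apply: le_trans.
  have is_ := integrable_slice sT; have it := integrable_slice tT.
  have tri (a b : R) : 0 <= a <= T -> 0 <= b <= T ->
      N a <= N b + fine (\int[lebesgue_rV R d]_x `|(u (x, a) - u (x, b))%:E|)%E.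
    move=> aT bT.
    have ia := integrable_slice aT; have ib := integrable_slice bT.
    have ma : measurable_fun setT (fun x => u (x, a)).
      by case/integrableP : ia => /measurable_EFinP.
    have mb : measurable_fun setT (fun x => u (x, b)).
      by case/integrableP : ib => /measurable_EFinP.
    have mab : measurable_fun setT (fun x => `|(u (x, a) - u (x, b))%:E|)%E.
      by apply: measurableT_comp => //; apply/measurable_EFinP; exact: measurable_funB.
    have mb' : measurable_fun setT (fun x => `|(u (x, b))%:E|)%E.
      by apply: measurableT_comp => //; exact/measurable_EFinP.
    have iab : (\int[lebesgue_rV R d]_x `|(u (x, a) - u (x, b))%:E|)%E \is a fin_num.
      rewrite ge0_fin_numE ?integral_ge0//.
      by have /integrableP[] := integrableB measurableT ia ib.
    rewrite -lee_fin EFinD -(NE aT) -(NE bT) fineK// -ge0_integralD//.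
    apply: ge0_le_integral => //.
    - by apply: measurableT_comp => //; exact/measurable_EFinP.
    - exact: emeasurable_funD.
    - move=> x _; rewrite !abse_EFin -EFinD lee_fin -[in leLHS](subrK (u (x, b)) (u (x, a))).
      by rewrite addrC (le_trans (ler_normD _ _))// addrC.
  have h1 := tri t s tT sT; have h2 := tri s t sT tT.
  have E : (\int[lebesgue_rV R d]_x `|(u (x, s) - u (x, t))%:E| =
    \int[lebesgue_rV R d]_x `|(u (x, t) - u (x, s))%:E|)%E.
    by apply: eq_integral => x _; rewrite !abse_EFin distrC.
  rewrite -[leLHS]/(`|N t - N s|); move: h1 h2; rewrite -E; move: (fine _) (N s) (N t) => X a b h1 h2.
  by rewrite ler_norml; apply/andP; split; lra.
have [c _ hc] := EVT_max (ltW T0) cN.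
exists (Num.max 0 (N c)); first by rewrite le_max lexx.
move=> t tT; rewrite NE// lee_fin le_max hc ?orbT// in_itv.
Unshelve. all: by end_near. Qed.

Lemma integrable_extU : lebQ.-integrable setT (EFin \o extU).
Proof.
have mU : measurable_fun setT (EFin \o extU : V * measurableTypeR R -> \bar R).
  by apply/measurable_EFinP; exact: measurable_extU.
apply/(integrable21ltyP _ _ mU).
have [M M0 hM] := slice_L1_bounded.
have m1 : measurable_fun setT (\1_`]0, T[%classic : measurableTypeR R -> R).
  by apply: measurable_indic; exact: measurable_itv.
apply: (@le_lt_trans _ _ (\int[@lebesgue_measure R]_t
    (M%:E * (\1_`]0, T[%classic t)%:E))%E).
  apply: ge0_le_integral => //.
  - by move=> t _; exact: integral_ge0.
  - apply: (measurable_fun_fubini_tonelli_G (m1 := lebesgue_rV R d)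
      (fun p : V * measurableTypeR R => `|(extU p)%:E|%E)) => //.
    exact: measurableT_comp.
  - by apply/measurable_EFinP; exact: measurable_funM.
  move=> t _; rewrite indicE; have [tT|tT] := boolP (0 < t < T).
    have -> : t \in `]0, T[%classic by rewrite mem_set//= in_itv.
    rewrite mule1; apply: le_trans (hM t _).
      rewrite le_eqVlt; apply/orP; left; apply/eqP.
      by apply: eq_integral => x _ /=; rewrite extUE.
    by move/andP : tT => [? ?]; rewrite !ltW.
  rewrite integral0_eq ?lee_fin ?mulr_ge0// => x _ /=.
  by rewrite extU_out// normr0.
rewrite ge0_integralZl//.
- rewrite integral_indic//= setIT lebesgue_measure_itv/= lte_fin T0 oppr0 adde0.
  by rewrite -EFinM ltry.
- exact/measurable_EFinP.
Qed.

End entropy_integrability.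

(** The integral of a nonnegative function is a supremum over simple functions below it, so it is
    monotone whether or not the functions are measurable; positive and negative parts are compared
    separately. *)
Lemma le_integral_any (R : realType) d (T : measurableType d)
    (m : {measure set T -> \bar R}) (D : set T) (f g : T -> \bar R) :
  (forall x, D x -> f x <= g x)%E -> (\int[m]_(x in D) f x <= \int[m]_(x in D) g x)%E.
Proof.
have ge0 (h k : T -> \bar R) : (forall x, 0 <= h x)%E -> (forall x, h x <= k x)%E ->
    (\int[m]_x h x <= \int[m]_x k x)%E.
  move=> h0 hk; rewrite !ge0_integralE//; last first.
    by move=> x _; exact: le_trans (hk x).
  apply: ereal_sup_le => _ [s /= sh <-]; exists s => //= x.
  by apply: le_trans (sh x) _; rewrite !patch_setT.
move=> fg; rewrite (integral_mkcond D f) (integral_mkcond D g).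
have fg' x : ((f \_ D) x <= (g \_ D) x)%E.
  by rewrite !patchE; case: ifPn => // /set_mem; exact: fg.
rewrite [leLHS]integralE [leRHS]integralE; apply: leeB; apply: ge0 => // x.
  by rewrite !funeposE ge_max !le_max lexx orbT andbT fg'.
by rewrite !funenegE ge_max !le_max lexx orbT andbT leeN2 fg'.
Qed.

Section measurability.
Context {R : realType}.

Lemma measurable_sgr : measurable_fun setT (@Num.sg R).
Proof.
rewrite (_ : @Num.sg R = fun x => \1_`]0, +oo[%classic x - \1_`]-oo, 0[%classic x).
  by apply: measurable_funB; apply: measurable_indic; exact: measurable_itv.
apply/funext => x; rewrite !indicE.
have [x0|x0|->] := ltgtP x 0.
- rewrite ltr0_sg// memNset ?mem_set/= ?in_itv/= ?andbT ?x0 ?sub0r//.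
  by apply/negP; rewrite -leNgt ltW.
- rewrite gtr0_sg// mem_set/= ?memNset/= ?in_itv/= ?andbT ?x0 ?subr0//.
  by apply/negP; rewrite -leNgt ltW.
- by rewrite sgr0 !memNset/= ?in_itv/= ?ltxx// subrr.
Qed.

Lemma continuous_measurable_rV n (g : 'rV[R]_n -> R) : continuous g ->
  measurable_fun setT g.
Proof.
move=> cg; apply: (measurability _ (RGenOpens.measurableE R)) => _ [_ [x [y ->]] <-].
rewrite setTI; apply: open_measurable_rV.
by apply: open_comp; [move=> v _; exact: cg|exact: interval_open].
Qed.

Lemma lipschitz_continuous (W : normedModType R) (g : R -> W) : lipschitz g ->
  continuous g.
Proof.
move=> /lipschitz_bound[L L0 gL] x; apply/cvgrPdist_le => /= e e0.
have L1 : 0 < L + 1 by rewrite ltr_wpDl.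
near=> y; apply: le_trans (gL x y) _.
apply: (@le_trans _ _ ((L + 1) * `|x - y|)); first by rewrite ler_wpM2r// lerDl.
rewrite mulrC -ler_pdivlMr//; near: y.
by apply: cvgr_dist_le; [exact: cvg_id|exact: divr_gt0].
Unshelve. all: by end_near. Qed.

End measurability.

Section moll_theory.
Context {R : realType} {d : nat}.
Local Notation V := 'rV[R]_d.
Variable e : R.

Lemma Ck_moll k : Ck k (@moll R d e).
Proof.
apply: Ck_prod => i.
have ci : continuous (fun v : V => v 0 i) by move=> v; exact: coord_continuous.
apply: (@Ck_bump R _ (fun x : V => x 0 i / e) (fun x : V => x 0 i / e)) => [x|h v y].
  exact: (cvgM (ci x) (cvg_cst _)).
by rewrite !mxE; ring.
Qed.

Lemma measurable_moll : measurable_fun setT (@moll R d e).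
Proof. exact: continuous_measurable_rV (Ck_continuous (Ck_moll 0)). Qed.

Lemma measurable_grad_moll : measurable_fun setT (grad (@moll R d e)).
Proof.
apply: measurable_fun_rVP => i; apply: continuous_measurable_rV.
rewrite (_ : (fun _ => _) = 'D_(delta_mx 0 i) (@moll R d e)).
  exact: (Ck_continuous (CkS_Ck _ (Ck_moll 1))).
by apply/funext => x; rewrite mxE.
Qed.

Lemma moll_taylor_bound : exists2 C : R, 0 <= C & forall x z : V,
  (forall i, `|grad (moll e) x 0 i| <= C) /\
  `|moll e (x + z) - moll e x - dotv z (grad (moll e) x)| <= C * enorm z ^+ 2.
Proof.
have [C C0 hC] := @taylor2_moll R d e; exists C => // x z; split=> [i|].
  have [_ _ + _] := hC x (delta_mx 0 i).
  by rewrite dotv_delta enorm_delta mulr1.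
by have [] := hC x z.
Qed.

Lemma grad_mollN (x : V) : grad (moll e) (- x) = - grad (moll e) x.
Proof. by apply: taylor2_even (taylor2_moll d e) _ => y; exact: mollN. Qed.

Lemma grad_moll_eq0 (x : V) : moll e x = 0 -> grad (moll e) x = 0.
Proof. by apply: taylor2_min (taylor2_moll d e) _; exact: moll_ge0. Qed.

End moll_theory.

Lemma coord_le_norm (R : realType) n (x : 'rV[R]_n) i : `|x 0 i| <= `|x|.
Proof.
rewrite (_ : `|x| = \big[Num.max/0]_ij `|x ij.1 ij.2|); last exact: mx_normrE.
exact: (le_bigmax _ (fun ij : 'I_1 * 'I_n => `|x ij.1 ij.2|) (0, i)).
Qed.

(** * Kernels of the doubling: supports, bounds and symmetries *)

Section kernels.
Context {R : realType} {d : nat}.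
Local Notation V := 'rV[R]_d.
Local Notation Q := (V * measurableTypeR R)%type.
Variables (e t0 t1 : R).
Hypotheses (e0 : 0 < e) (t01 : t0 <= t1).

Definition ker (pq : Q * Q) : R :=
  moll e (pq.1.1 - pq.2.1) * theta e t0 t1 pq.1.2 pq.2.2.

Definition dker (pq : Q * Q) : R :=
  moll e (pq.1.1 - pq.2.1) * dtheta e t0 t1 pq.1.2 pq.2.2.

Definition gker (pq : Q * Q) : V :=
  theta e t0 t1 pq.1.2 pq.2.2 *: grad (moll e) (pq.1.1 - pq.2.1).

(** The margin 1 in space leaves room for the nonlocal near operator: when r < 1, outside the box
    the kernel also vanishes at all spatial shifts of length at most r. *)
Definition kbox : set (Q * Q) := box (e + 1) (t0 - e) (t1 + e).

Lemma out_kbox pq : ~ kbox pq ->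
  (exists i, e + 1 <= `|(pq.1.1 - pq.2.1) 0 i|) \/
  (theta e t0 t1 pq.1.2 pq.2.2 = 0 /\ dtheta e t0 t1 pq.1.2 pq.2.2 = 0).
Proof.
move=> npq; have [tI|tI] := boolP ((t0 - e < pq.1.2 < t1 + e) && (t0 - e < pq.2.2 < t1 + e)).
  left; apply/not_existsP => h; apply: npq; split=> [i|].
    by rewrite leNgt; apply/negP => /ltW; exact: h.
  by move/andP : tI => [/andP[? ?] /andP[? ?]]; rewrite !ltW.
by right; exact: (theta_support e0 t01 tI).
Qed.

Lemma kernel_bounds : exists2 C : R, 0 <= C & forall pq,
  [/\ 0 <= ker pq, ker pq <= C * \1_kbox pq, `|dker pq| <= C * \1_kbox pq &
      forall i, `|gker pq 0 i| <= C * \1_kbox pq].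
Proof.
have [C C0 hC] := @moll_taylor_bound R d e.
pose K := @thetaC0 R; pose K' : R := e^-1 * (4 * K + 1).
have th0 t s : 0 <= theta e t0 t1 t s by exact: theta_ge0.
have th1 t s : theta e t0 t1 t s <= K by exact: theta_le.
have dth t s : `|dtheta e t0 t1 t s| <= K' by exact: dtheta_le.
have K0 : 0 <= K by exact: le_trans (th1 0 0).
have K'0 : 0 <= K' by exact: le_trans (dth 0 0).
(* K serves for [ker], K' for [dker] and K C for [gker]. *)
exists (K + K' + K * C) => [|pq]; first by apply: addr_ge0; [exact: addr_ge0|exact: mulr_ge0].
have KC0 : 0 <= K * C by rewrite mulr_ge0.
have m0 := moll_ge0 e (pq.1.1 - pq.2.1); have m1 := moll_le1 e (pq.1.1 - pq.2.1).
have ker0 : 0 <= ker pq by rewrite mulr_ge0.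
have [pB|pB] := pselect (kbox pq).
  rewrite indicE mem_set// mulr1; split=> //.
  - apply: (@le_trans _ _ (1 * K)); first by rewrite ler_pM.
    lra.
  - apply: (@le_trans _ _ (1 * K')); first by rewrite normrM ger0_norm// ler_pM.
    lra.
  - move=> i; rewrite mxE normrM ger0_norm//.
    apply: (@le_trans _ _ (K * C)); last lra.
    by rewrite ler_pM//; exact: (hC _ 0).1.
rewrite indicE memNset// mulr0; case: (out_kbox pB) => [[i hi]|[h1 h2]].
  have m00 : moll e (pq.1.1 - pq.2.1) = 0.
    by apply: (moll_eq0 e0 (i := i)); apply: le_trans hi; rewrite lerDl.
  split; rewrite /ker /dker ?m00 ?mul0r ?normr0// => j.
  by rewrite /gker grad_moll_eq0// scaler0 mxE normr0.
by split; rewrite /ker /dker ?h1 ?h2 ?mulr0 ?normr0// => j;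
  rewrite /gker h1 scale0r mxE normr0.
Qed.

Lemma ker_ge0 pq : 0 <= ker pq.
Proof. by have [C _ /(_ pq)[]] := kernel_bounds. Qed.

Lemma ker_sym (p q : Q) : ker (p, q) = ker (q, p).
Proof. by rewrite /ker /= thetaC -mollN opprB. Qed.

Lemma gker_antisym (p q : Q) : gker (q, p) = - gker (p, q).
Proof. by rewrite /gker /= thetaC -[q.1 - p.1]opprB grad_mollN scalerN. Qed.

Lemma ker_shift (p q : Q) z :
  ker ((p.1 + z, p.2), (q.1 + z, q.2)) = ker (p, q).
Proof. by rewrite /ker /= opprD addrACA subrr addr0. Qed.

Let mbump_arg (g : R -> R) (c : R) : continuous g ->
  measurable_fun setT (fun pq : Q * Q => g ((pq.1.2 + pq.2.2 - c) / e)).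
Proof.
move=> cg; have mg := continuous_measurable_fun cg.
have ma : measurable_fun setT (fun pq : Q * Q => (pq.1.2 + pq.2.2 - c) / e : R).
  apply: measurable_funM => //; apply: measurable_funB => //.
  by apply: measurable_funD; [exact: measurable_t1|exact: measurable_t2].
exact: (measurableT_comp mg ma).
Qed.

Let mbump_arg2 (g : R -> R) : continuous g ->
  measurable_fun setT (fun pq : Q * Q => g ((pq.1.2 - pq.2.2) / e)).
Proof.
move=> cg; have mg := continuous_measurable_fun cg.
have ma : measurable_fun setT (fun pq : Q * Q => (pq.1.2 - pq.2.2) / e : R).
  apply: measurable_funM => //.
  by apply: measurable_funB; [exact: measurable_t1|exact: measurable_t2].
exact: (measurableT_comp mg ma).
Qed.

Lemma measurable_tker tau :
  measurable_fun setT (fun pq : Q * Q => tker e tau pq.1.2 pq.2.2).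
Proof.
apply: measurable_funM; first exact: mbump_arg2 continuous_bump.
exact: mbump_arg continuous_bump.
Qed.

Lemma measurable_theta :
  measurable_fun setT (fun pq : Q * Q => theta e t0 t1 pq.1.2 pq.2.2).
Proof.
apply: measurable_funM; first exact: mbump_arg2 continuous_bump.
by apply: measurable_funB; exact: mbump_arg continuous_step.
Qed.

Lemma measurable_dtheta :
  measurable_fun setT (fun pq : Q * Q => dtheta e t0 t1 pq.1.2 pq.2.2).
Proof.
apply: measurable_funM => //; apply: measurable_funD; apply: measurable_funM.
- exact: mbump_arg2 continuous_dbump.
- by apply: measurable_funB; exact: mbump_arg continuous_step.
- exact: mbump_arg2 continuous_bump.
- by apply: measurable_funB; exact: mbump_arg continuous_bump.
Qed.

Lemma measurable_moll_xy :
  measurable_fun setT (fun pq : Q * Q => moll e (pq.1.1 - pq.2.1)).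
Proof. exact: (measurableT_comp (measurable_moll e) measurable_xy). Qed.

Lemma measurable_ker : measurable_fun setT ker.
Proof.
by apply: measurable_funM; [exact: measurable_moll_xy|exact: measurable_theta].
Qed.

Lemma measurable_dker : measurable_fun setT dker.
Proof.
by apply: measurable_funM; [exact: measurable_moll_xy|exact: measurable_dtheta].
Qed.

Lemma measurable_gker : measurable_fun setT gker.
Proof.
apply: measurable_fun_rVP => i.
rewrite (_ : (fun _ => _) = fun pq : Q * Q => theta e t0 t1 pq.1.2 pq.2.2 *
    rV_coord i (grad (moll e) (pq.1.1 - pq.2.1))).
  apply: measurable_funM; first exact: measurable_theta.
  apply: (measurableT_comp (measurable_coord i)).
  exact: (measurableT_comp (measurable_grad_moll e) measurable_xy).
by apply/funext => pq; rewrite mxE.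
Qed.

End kernels.

(** * The five doubled terms *)

Section doubling_terms.
Context {R : realType} {d : nat}.
Local Notation V := 'rV[R]_d.
Local Notation Q := (V * measurableTypeR R)%type.
Variables (f : R -> V) (A : R -> R).
Hypotheses (lf : lipschitz f) (lA : lipschitz A) (A0 : A 0 = 0).
Variable nu : {sigma_finite_measure set V -> \bar R}.
Variables (e t0 t1 : R).
Hypotheses (e0 : 0 < e) (t01 : t0 <= t1).
Local Notation ker := (@ker R d e t0 t1).
Local Notation dker := (@dker R d e t0 t1).
Local Notation gker := (@gker R d e t0 t1).
Local Notation kbox := (@kbox R d e t0 t1).

Definition shiftQ (p : Q) (z : V) : Q := (p.1 + z, p.2).

Section terms.
Variables U W : Q -> R.
Hypotheses (mU : measurable_fun setT U) (mW : measurable_fun setT W).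
Hypotheses (iU : lebQ.-integrable setT (EFin \o U)).
Hypotheses (iW : lebQ.-integrable setT (EFin \o W)).

(** [dbl1] to [dbl5] follow the five terms of [entropy_integrand] at the first point, with k equal
    to W at the second point and [ker] as test function. *)
Definition dbl1 (pq : Q * Q) : R := Defs.eta (W pq.2) (U pq.1) * dker pq.
Definition dbl2 (pq : Q * Q) : R := dotv (entropy_flux f (W pq.2) (U pq.1)) (gker pq).
(* A majorant, up to a constant that is small with r, of the levy_near term. *)
Definition dbl3 (pq : Q * Q) : R := Defs.eta (A (W pq.2)) (A (U pq.1)) * \1_kbox pq.
Definition dbl4 (r : R) (pq : Q * Q) : R := eta' (W pq.2) (U pq.1) *
  far nu [set z | r < enorm z] shiftQ (A \o U) pq.1 * ker pq.
Definition dbl5 (r : R) (pq : Q * Q) : R := Defs.eta (A (W pq.2)) (A (U pq.1)) *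
  dotv (levy_drift nu r) (gker pq).

Let mU1 : measurable_fun setT (fun pq : Q * Q => U pq.1).
Proof. exact: (measurableT_comp mU measurable_fst). Qed.

Let mW2 : measurable_fun setT (fun pq : Q * Q => W pq.2).
Proof. exact: (measurableT_comp mW measurable_snd). Qed.

Let mA : measurable_fun setT A.
Proof. exact: continuous_measurable_fun (lipschitz_continuous lA). Qed.

Lemma measurable_eta_UW : measurable_fun setT (fun pq => Defs.eta (W pq.2) (U pq.1)).
Proof.
have mn : measurable_fun setT (fun w : R => `|w|).
  by apply: continuous_measurable_fun; exact: norm_continuous.
exact: (measurableT_comp mn (measurable_funB mU1 mW2)).
Qed.

Lemma measurable_etaA_UW : measurable_fun setT (fun pq => Defs.eta (A (W pq.2)) (A (U pq.1))).
Proof.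
have mn : measurable_fun setT (fun w : R => `|w|).
  by apply: continuous_measurable_fun; exact: norm_continuous.
apply: (measurableT_comp mn); apply: measurable_funB.
  exact: (measurableT_comp mA mU1).
exact: (measurableT_comp mA mW2).
Qed.

Lemma measurable_eta'_UW : measurable_fun setT (fun pq => eta' (W pq.2) (U pq.1)).
Proof.
exact: (measurableT_comp measurable_sgr (measurable_funB mU1 mW2)).
Qed.

Let eta_ge0 (k w : R) : 0 <= Defs.eta k w. Proof. exact: normr_ge0. Qed.

Let eta_le pq : Defs.eta (W pq.2) (U pq.1) <= `|U pq.1| + `|W pq.2|.
Proof. exact: ler_normB. Qed.

Let etaA_le : exists2 L : R, 0 <= L & forall pq,
  Defs.eta (A (W pq.2)) (A (U pq.1)) <= L * (`|U pq.1| + `|W pq.2|).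
Proof.
have [L L0 hL] := lipschitz_bound lA; exists L => // pq.
by rewrite (le_trans (hL _ _))// ler_wpM2l// eta_le.
Qed.

Let b0 : 0 <= e + 1. Proof. by rewrite addr_ge0// ltW. Qed.
Let a01 : t0 - e <= t1 + e. Proof. by move: e0 t01 => ? ?; lra. Qed.
Let I0 pq : 0 <= \1_kbox pq :> R. Proof. by []. Qed.

Lemma integrable_dbl1 : lebQQ.-integrable setT (EFin \o dbl1).
Proof.
have [C C0 hC] := @kernel_bounds R d e t0 t1 e0 t01.
apply: (integrable_box_dominated b0 a01 C0 iU iW).
  by apply: measurable_funM; [exact: measurable_eta_UW|exact: measurable_dker].
move=> pq; have [_ _ h _] := hC pq.
rewrite normrM (ger0_norm (eta_ge0 _ _)).
apply: (@le_trans _ _ ((`|U pq.1| + `|W pq.2|) * (C * \1_kbox pq))).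
  by apply: ler_pM.
by rewrite mulrCA mulrA.
Qed.

Lemma integrable_dbl2 : lebQQ.-integrable setT (EFin \o dbl2).
Proof.
have [C C0 hC] := @kernel_bounds R d e t0 t1 e0 t01.
have [L L0 hL] := lipschitz_bound lf.
have mfl : measurable_fun setT (fun pq => entropy_flux f (W pq.2) (U pq.1)).
  apply: measurable_fun_rVP => i.
  have mfi : measurable_fun setT (fun s => f s 0 i).
    apply: continuous_measurable_fun => s.
    apply: (@continuous_comp _ _ _ f (fun v : V => v 0 i)).
      exact: lipschitz_continuous.
    exact: coord_continuous.
  rewrite (_ : (fun _ => _) = fun pq : Q * Q => eta' (W pq.2) (U pq.1) *
    (f (U pq.1) 0 i - f (W pq.2) 0 i)).
    apply: measurable_funM; first exact: measurable_eta'_UW.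
    apply: measurable_funB; first exact: (measurableT_comp mfi mU1).
    exact: (measurableT_comp mfi mW2).
  by apply/funext => pq; rewrite !mxE.
(* L controls each coordinate of the flux and C each coordinate of [gker]; d products are summed. *)
apply: (integrable_box_dominated b0 a01 _ iU iW (C := d%:R * (L * C))).
- by rewrite !mulr_ge0.
- by apply: measurable_dotv => //; exact: measurable_gker.
move=> pq; have [_ _ _ h] := hC pq.
rewrite (le_trans (ler_norm_sum _ _ _))//.
have -> : d%:R * (L * C) * (`|U pq.1| + `|W pq.2|) * \1_kbox pq =
    \sum_(i < d) (L * (`|U pq.1| + `|W pq.2|) * (C * \1_kbox pq)).
  by rewrite sumr_const card_ord -mulr_natl; ring.
apply: ler_sum => i _; rewrite normrM ler_pM//.
rewrite !mxE normrM (@le_trans _ _ (1 * `|f (U pq.1) 0 i - f (W pq.2) 0 i|))//.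
  by rewrite ler_wpM2r// /eta' normr_sg; case: (_ != _).
rewrite mul1r (@le_trans _ _ (L * `|U pq.1 - W pq.2|))//.
  apply: le_trans (hL _ _).
  by have := coord_le_norm (f (U pq.1) - f (W pq.2)) i; rewrite !mxE.
by rewrite ler_wpM2l// eta_le.
Qed.

Lemma integrable_dbl3 : lebQQ.-integrable setT (EFin \o dbl3).
Proof.
have [L L0 hL] := etaA_le.
apply: (integrable_box_dominated b0 a01 L0 iU iW).
  apply: measurable_funM; first exact: measurable_etaA_UW.
  by apply: measurable_indic; exact: measurable_box.
by move=> pq; rewrite normrM (ger0_norm (eta_ge0 _ _)) (ger0_norm (I0 _)) ler_wpM2r.
Qed.

Lemma integrable_dbl5 r : lebQQ.-integrable setT (EFin \o dbl5 r).
Proof.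
have [C C0 hC] := @kernel_bounds R d e t0 t1 e0 t01.
have [L L0 hL] := etaA_le.
pose K := \sum_i `|levy_drift nu r 0 i|.
have K0 : 0 <= K by exact: sumr_ge0.
apply: (integrable_box_dominated b0 a01 _ iU iW (C := L * (K * C))).
- by rewrite !mulr_ge0.
- apply: measurable_funM; first exact: measurable_etaA_UW.
  by apply: measurable_dotv => //; exact: measurable_gker.
move=> pq; have [_ _ _ h] := hC pq.
rewrite normrM (ger0_norm (eta_ge0 _ _)).
apply: (@le_trans _ _ (L * (`|U pq.1| + `|W pq.2|) * (K * (C * \1_kbox pq)))).
  apply: ler_pM => //.
  apply: (le_trans (ler_norm_sum _ _ _)).
  rewrite /K mulr_suml ler_sum// => i _.
  by rewrite normrM ler_wpM2l.
by rewrite le_eqVlt; apply/orP; left; apply/eqP; ring.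
Qed.

End terms.

End doubling_terms.

Section shiftQ_theory.
Context {R : realType} {d : nat}.
Local Notation V := 'rV[R]_d.
Local Notation Q := (V * measurableTypeR R)%type.

Lemma mpres_shiftQ (z : V) : mpres lebQ lebQ (fun p : Q => shiftQ p z).
Proof.
have idp : mpres (@lebesgue_measure R) lebesgue_measure id by split.
exact: (mpres_prod (mpres_shift_rV z) idp).
Qed.

Lemma measurable_shiftQ : measurable_fun setT (fun pz : Q * V => shiftQ pz.1 pz.2).
Proof.
apply/measurable_fun_pairP; split.
  apply: measurable_addv; last exact: measurable_snd.
  exact: (measurableT_comp measurable_fst measurable_fst).
exact: (measurableT_comp measurable_snd measurable_fst).
Qed.

Lemma integrable_lipschitz (A : R -> R) (U : Q -> R) : lipschitz A -> A 0 = 0 ->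
  lebQ.-integrable setT (EFin \o U) -> lebQ.-integrable setT (EFin \o (A \o U)).
Proof.
move=> lA A0 iU; have [L L0 hL] := lipschitz_bound lA.
have mU : measurable_fun setT U by case/integrableP : iU => /measurable_EFinP.
apply: le_integrable (integrableZl measurableT L iU) => //.
  apply/measurable_EFinP; apply: measurableT_comp => //.
  exact: continuous_measurable_fun (lipschitz_continuous lA).
move=> p _; rewrite /= lee_fin normrM (ger0_norm L0).
by have := hL (U p) 0; rewrite A0 !subr0.
Qed.

End shiftQ_theory.

(** * The entropy inequality with the second point frozen *)

Section entropy_doubling.
Context {R : realType} {d : nat}.
Local Notation V := 'rV[R]_d.
Local Notation Q := (V * measurableTypeR R)%type.
Variables (f : R -> V) (A : R -> R).
Hypotheses (lf : lipschitz f) (lA : lipschitz A) (A0 : A 0 = 0).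
Variable nu : {sigma_finite_measure set V -> \bar R}.
Hypothesis inu : levy_integrable nu.
Variables (T e t0 t1 : R).
Hypotheses (e0 : 0 < e) (t01 : t0 <= t1) (te0 : 0 < t0 - e) (te1 : t1 + e < T).
Local Notation ker := (@ker R d e t0 t1).
Local Notation kbox := (@kbox R d e t0 t1).

Lemma integrable_dbl4 (U W : Q -> R) r : 0 < r ->
  measurable_fun setT U -> measurable_fun setT W ->
  lebQ.-integrable setT (EFin \o U) ->
  lebQQ.-integrable setT (EFin \o dbl4 A nu e t0 t1 U W r).
Proof.
move=> r0 mU mW iU.
have mD := @measurable_enorm_gt R d r.
have Dlty := levy_far_lty r0 inu.
have iAU := integrable_lipschitz lA A0 iU.
have ifar := integrable_far mD Dlty measurable_shiftQ mpres_shiftQ iAU.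
have mfar := measurable_far mD Dlty measurable_shiftQ mpres_shiftQ iAU.
have [C C0 hC] := @kernel_bounds R d e t0 t1 e0 t01.
have b0 : 0 <= e + 1 by rewrite addr_ge0// ltW.
have a01 : t0 - e <= t1 + e by move: e0 t01 => ? ?; lra.
have i0 : lebQ.-integrable setT (EFin \o (fun _ : Q => 0)) by exact: integrable0.
apply: (integrable_box_dominated b0 a01 C0 ifar i0).
  apply: measurable_funM; last exact: measurable_ker.
  apply: measurable_funM; first exact: measurable_eta'_UW.
  exact: (measurableT_comp mfar measurable_fst).
move=> pq; have [k0 k1 _ _] := hC pq.
rewrite normr0 addr0 normrM (ger0_norm k0) normrM.
apply: (@le_trans _ _ (1 * `|far nu [set z | r < enorm z] shiftQ (A \o U) pq.1| *
    (C * \1_kbox pq))).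
  rewrite ler_pM// ?mulr_ge0// ler_wpM2r//.
  by rewrite /eta' normr_sg; case: (_ != _).
by rewrite mul1r mulrCA mulrA.
Qed.

(** C belongs to the mollifier at scale e and eps to the radius r: with e fixed, the bound is made
    small through r alone. *)
Lemma levy_near_testf_le (C eps r : R) (q : Q) x t : 0 <= C ->
  (forall x z : V,
     `|moll e (x + z) - moll e x - dotv z (grad (moll e) x)| <= C * enorm z ^+ 2) ->
  0 < r < 1 ->
  (\int[nu]_(z in punct_ball r) (enorm z ^+ 2)%:E <= eps%:E)%E ->
  levy_near nu r (fun y => testf e t0 t1 q (y, t)) x <=
  @thetaC0 R * C * eps * \1_kbox ((x, t), q).
Proof.
move=> C0 hC r01 ie; have /andP[r0 r1] := r01.
have th0 : 0 <= theta e t0 t1 t q.2 by exact: theta_ge0.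
have [xB|xB] := pselect (kbox ((x, t), q)); last first.
  rewrite indicE memNset// mulr0 levy_near_eq0 ?(ltW r0)//.
    move=> z zr; case: (out_kbox e0 t01 xB) => [[i hi]|[h1 h2]]; last first.
      by rewrite /testf /= h1 mulr0.
    rewrite /testf /= (@moll_eq0 _ _ _ _ i)// ?mul0r//.
    rewrite (_ : x - z - q.1 = (x - q.1) - z); last by rewrite addrAC.
    rewrite mxE; have := lerB_dist ((x - q.1) 0 i) (z 0 i).
    rewrite !mxE in hi *; have := coord_le_enorm z i; move: hi => /=; lra.
  rewrite grad_testf; case: (out_kbox e0 t01 xB) => [[i hi]|[h1 h2]]; last first.
    by rewrite h1 scale0r.
  rewrite grad_moll_eq0 ?scaler0// (@moll_eq0 _ _ _ _ i)//.
  by apply: le_trans hi; rewrite lerDl.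
rewrite indicE mem_set// mulr1.
have mt : measurable_fun setT (fun y => testf e t0 t1 q (y, t)).
  apply: measurable_funM; last by move=> /=; apply: measurable_cst.
  have mx : measurable_fun setT (fun y : V => y - q.1).
    by apply: measurable_subv => //; exact: measurable_id.
  exact: (measurableT_comp (measurable_moll e) mx).
have tC z : `|testf e t0 t1 q (x + z, t) - testf e t0 t1 q (x, t) -
    dotv z (grad (fun y => testf e t0 t1 q (y, t)) x)| <=
    theta e t0 t1 t q.2 * C * enorm z ^+ 2.
  rewrite grad_testf dotvZr /testf /=.
  rewrite (_ : x + z - q.1 = x - q.1 + z); last by rewrite addrAC.
  rewrite (_ : _ - _ = theta e t0 t1 t q.2 * (moll e (x - q.1 + z) -
    moll e (x - q.1) - dotv z (grad (moll e) (x - q.1)))); last by ring.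
  by rewrite normrM ger0_norm// -mulrA ler_wpM2l.
have tC0 : 0 <= theta e t0 t1 t q.2 * C by rewrite mulr_ge0.
have eps0 : 0 <= eps.
  by rewrite -lee_fin; apply: le_trans ie; apply: integral_ge0 => z _;
    rewrite lee_fin sqr_ge0.
apply: (le_trans (ler_norm _)).
apply: (le_trans (levy_near_le tC0 r01 mt ie tC)).
by rewrite ler_wpM2r// ler_wpM2r// theta_le.
Qed.

(** W q serves as k and [testf] at q as test function. The conclusion involves only terms measurable
    in the pair (p, q) and integrates over all of space-time, so it can be integrated in q. *)
Lemma entropy_dbl u0 (u : V * R -> R) (W : Q -> R) (C eps r : R) (q : Q) :
  entropy_solution f A nu T u0 u -> 0 <= C ->
  (forall x z : V,
     `|moll e (x + z) - moll e x - dotv z (grad (moll e) x)| <= C * enorm z ^+ 2) ->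
  0 < r < 1 ->
  (\int[nu]_(z in punct_ball r) (enorm z ^+ 2)%:E <= eps%:E)%E ->
  (0 <= \int[lebQ]_p (dbl1 e t0 t1 (extU T u) W (p, q) +
    dbl2 f e t0 t1 (extU T u) W (p, q) +
    @thetaC0 R * C * eps * dbl3 A e t0 t1 (extU T u) W (p, q) +
    dbl4 A nu e t0 t1 (extU T u) W r (p, q) +
    dbl5 A nu e t0 t1 (extU T u) W r (p, q))%:E)%E.
Proof.
move=> es C0 hC r01 ie; have /andP[r0 r1] := r01.
have tf := test_function_testf q e0 t01 te0 te1.
have := entropy_ineq es (W q) r0 tf (fun p => testf_ge0 q p e0 t01).
move=> /le_trans; apply.
pose G (p : Q) : \bar R := (dbl1 e t0 t1 (extU T u) W (p, q) +
    dbl2 f e t0 t1 (extU T u) W (p, q) +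
    @thetaC0 R * C * eps * dbl3 A e t0 t1 (extU T u) W (p, q) +
    dbl4 A nu e t0 t1 (extU T u) W r (p, q) +
    dbl5 A nu e t0 t1 (extU T u) W r (p, q))%:E.
apply: (@le_trans _ _ (\int[lebQ]_(p in QT T) G p)%E).
  (* On Q_T only the near term is estimated; the other four coincide, the far one because the
     extension agrees with u on the whole time slice t. *)
  apply: le_integral_any => -[x t] [_ /=]; rewrite in_itv/= => tT.
  rewrite /G lee_fin /entropy_integrand -(extUE u x tT).
  rewrite derive1_testf grad_testf.
  rewrite lerD2r lerD// -?lerD//.
    rewrite lerD// mulrCA ler_wpM2l ?normr_ge0//.
    exact: levy_near_testf_le.
  rewrite le_eqVlt; apply/orP; left; apply/eqP; rewrite /dbl4 /ker /testf /=.
  congr (_ * _ * _); rewrite /levy_far /far; apply: eq_Rintegral => z _.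
  by rewrite /shiftQ /= !extUE.
(* Outside Q_T all terms vanish, the kernel living at times in [t0 - e, t1 + e], inside (0, T). *)
rewrite integral_mkcond le_eqVlt; apply/orP; left; apply/eqP.
apply: eq_integral => -[x t] _; rewrite patchE; case: ifPn => // xT.
have tT : ~~ ((t0 - e < t < t1 + e) && (t0 - e < q.2 < t1 + e)).
  apply/negP => /andP[/andP[h1 h2] _]; move/negP : xT; apply; rewrite inE.
  by split => //=; rewrite in_itv/=; move: te0 te1 => ? ?; apply/andP; split; lra.
have [th dth] := theta_support e0 t01 tT.
have nB : ~ kbox ((x, t), q).
  move=> [_ [/= /andP[h1 h2] _]]; move/negP : xT; apply; rewrite inE.
  by split => //=; rewrite in_itv/=; move: te0 te1 => ? ?; apply/andP; split; lra.
rewrite /G /dbl1 /dbl2 /dbl3 /dbl4 /dbl5 indicE memNset// /dker /ker /gker /= th dth.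
by rewrite scale0r !dotv0r !mulr0 !addr0.
Qed.

End entropy_doubling.

(* An infinite or undefined integral is sent to 0 by fine on both sides. *)
Lemma Rintegral_ge0Zr (R : realType) d (T : measurableType d)
    (m : {measure set T -> \bar R}) (D : set T) (g : T -> R) (k : R) :
  measurable D -> measurable_fun D g -> 0 <= k ->
  \int[m]_(z in D) (g z * k) = (\int[m]_(z in D) g z) * k.
Proof.
move=> mD mg; rewrite le_eqVlt => /orP[/eqP <-|k0].
  rewrite mulr0 /Rintegral integral0_eq// => z _; by rewrite mulr0.
rewrite /Rintegral.
have -> : (\int[m]_(z in D) (g z * k)%:E =
    k%:E * \int[m]_(z in D) (EFin \o g)^\+ z - k%:E * \int[m]_(z in D) (EFin \o g)^\- z)%E.
  rewrite (_ : (fun z => (g z * k)%:E) = fun z => (k%:E * (EFin \o g) z)%E); last first.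
    by apply/funext => z; rewrite mulrC EFinM.
  rewrite integralE ge0_funeposM ?ge0_funenegM ?(ltW k0)//.
  have mEg : measurable_fun D (EFin \o g) by exact/measurable_EFinP.
  rewrite !ge0_integralZl_EFin ?(ltW k0)//.
  - exact: measurable_funeneg.
  - exact: measurable_funepos.
rewrite [in RHS]integralE.
have : (0 <= \int[m]_(z in D) (EFin \o g)^\+ z)%E by exact: integral_ge0.
have : (0 <= \int[m]_(z in D) (EFin \o g)^\- z)%E by exact: integral_ge0.
case: (\int[m]_(z in D) _)%E => [b||]; case: (\int[m]_(z in D) _)%E => [a||] //= _ _.
- by ring.
- by rewrite gt0_muley ?lte_fin//= mul0r.
- by rewrite gt0_muley ?lte_fin//= mul0r.
- by rewrite gt0_muley ?lte_fin//= mul0r.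
Qed.

(** * The doubling inequality *)

Section doubling_inequality.
Context {R : realType} {d : nat}.
Local Notation V := 'rV[R]_d.
Local Notation Q := (V * measurableTypeR R)%type.
Variables (f : R -> V) (A : R -> R).
Hypotheses (lf : lipschitz f) (lA : lipschitz A) (A0 : A 0 = 0).
Hypothesis ndA : {homo A : x y / x <= y}.
Variable nu : {sigma_finite_measure set V -> \bar R}.
Hypothesis inu : levy_integrable nu.
Variables (T e t0 t1 : R).
Hypotheses (e0 : 0 < e) (t01 : t0 <= t1) (te0 : 0 < t0 - e) (te1 : t1 + e < T).
Local Notation ker := (@ker R d e t0 t1).
Local Notation dker := (@dker R d e t0 t1).
Local Notation kbox := (@kbox R d e t0 t1).

Let b0 : 0 <= e + 1. Proof. by rewrite addr_ge0// ltW. Qed.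
Let a01 : t0 - e <= t1 + e. Proof. by move: e0 t01 => ? ?; lra. Qed.
Let i0 : lebQ.-integrable setT (EFin \o (fun _ : Q => 0)).
Proof. exact: integrable0. Qed.

(** Since A is non-decreasing, A a - A b never has the sign opposite to that of a - b; where A a = A
    b both sides vanish. *)
Let sgA (a b : R) : Num.sg (a - b) * (A a - A b) = `|A a - A b|.
Proof.
have [ab|ab|->] := ltgtP a b.
- rewrite ltr0_sg ?subr_lt0// mulN1r ler0_norm ?subr_le0//.
  by apply: ndA; exact: ltW.
- rewrite gtr0_sg ?subr_gt0// mul1r ger0_norm ?subr_ge0//.
  by apply: ndA; exact: ltW.
- by rewrite !subrr normr0 mulr0.
Qed.

Definition shiftQQ (pq : Q * Q) (z : V) : Q * Q := (shiftQ pq.1 z, shiftQ pq.2 z).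

Lemma mpres_shiftQQ z : mpres lebQQ lebQQ (fun pq => shiftQQ pq z).
Proof. exact: (mpres_prod (mpres_shiftQ z) (mpres_shiftQ z)). Qed.

Lemma measurable_shiftQQ :
  measurable_fun setT (fun pqz : (Q * Q) * V => shiftQQ pqz.1 pqz.2).
Proof.
have h (pr : Q * Q -> Q) : measurable_fun setT pr ->
    measurable_fun setT (fun pqz : (Q * Q) * V => shiftQ (pr pqz.1) pqz.2).
  move=> mpr.
  have m1 : measurable_fun setT (fun pqz : (Q * Q) * V => (pr pqz.1, pqz.2)).
    apply/measurable_fun_pairP; split; last exact: measurable_snd.
    exact: (measurableT_comp mpr measurable_fst).
  exact: (measurableT_comp measurable_shiftQ m1).
apply/measurable_fun_pairP; split.
  by apply: h; exact: measurable_fst.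
by apply: h; exact: measurable_snd.
Qed.

Lemma integrable_ker (g : Q -> R) : lebQ.-integrable setT (EFin \o g) ->
  lebQQ.-integrable setT (EFin \o (fun pq => g pq.1 * ker pq)) /\
  lebQQ.-integrable setT (EFin \o (fun pq => g pq.2 * ker pq)).
Proof.
move=> ig.
have mg : measurable_fun setT g by case/integrableP : ig => /measurable_EFinP.
have [C C0 hC] := @kernel_bounds R d e t0 t1 e0 t01.
split.
  apply: (integrable_box_dominated b0 a01 C0 ig i0).
    apply: measurable_funM; last exact: measurable_ker.
    exact: (measurableT_comp mg measurable_fst).
  move=> pq; have [k0 k1 _ _] := hC pq.
  rewrite normr0 addr0 normrM (ger0_norm k0).
  apply: (@le_trans _ _ (`|g pq.1| * (C * \1_kbox pq))); first by rewrite ler_wpM2l.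
  by rewrite mulrCA mulrA.
apply: (integrable_box_dominated b0 a01 C0 i0 ig).
  apply: measurable_funM; last exact: measurable_ker.
  exact: (measurableT_comp mg measurable_snd).
move=> pq; have [k0 k1 _ _] := hC pq.
rewrite normr0 add0r normrM (ger0_norm k0).
apply: (@le_trans _ _ (`|g pq.2| * (C * \1_kbox pq))); first by rewrite ler_wpM2l.
by rewrite mulrCA mulrA.
Qed.

Section far_term.
Variables U W : Q -> R.
Hypotheses (iU : lebQ.-integrable setT (EFin \o U)).
Hypotheses (iW : lebQ.-integrable setT (EFin \o W)).

Let mU : measurable_fun setT U.
Proof. by case/integrableP : iU => /measurable_EFinP. Qed.

Let mW : measurable_fun setT W.
Proof. by case/integrableP : iW => /measurable_EFinP. Qed.

Let mA : measurable_fun setT A.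
Proof. exact: continuous_measurable_fun (lipschitz_continuous lA). Qed.

(** [ker] is unchanged by the simultaneous shift, so it can be moved inside the far operator of
    [shiftQQ]. The two far terms become sgn(U - W) times a difference of far operators on pairs of
    points, which is the setting of [far_pair_le0]. *)
Lemma integral_dbl4_le0 r : 0 < r ->
  lebQQ.-integrable setT (fun pq =>
    (dbl4 A nu e t0 t1 U W r pq + dbl4 A nu e t0 t1 W U r (pq.2, pq.1))%:E) /\
  (\int[lebQQ]_pq
    (dbl4 A nu e t0 t1 U W r pq + dbl4 A nu e t0 t1 W U r (pq.2, pq.1))%:E <= 0)%E.
Proof.
move=> r0; pose D := [set z : V | r < enorm z].
have mD : measurable D by exact: measurable_enorm_gt.
have Dlty : (nu D < +oo)%E by exact: levy_far_lty.
pose a (pq : Q * Q) := (A \o U) pq.1 * ker pq.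
pose b (pq : Q * Q) := (A \o W) pq.2 * ker pq.
have ia := (integrable_ker (integrable_lipschitz lA A0 iU)).1.
have ib := (integrable_ker (integrable_lipschitz lA A0 iW)).2.
have k0 pq : 0 <= ker pq by exact: ker_ge0.
have farE (g : Q -> R) (p : Q) (k : R) : measurable_fun setT g -> 0 <= k ->
    \int[nu]_(z in D) (g (shiftQ p z) * k - g p * k) = far nu D shiftQ g p * k.
  move=> mg kk; rewrite /far -Rintegral_ge0Zr//.
    by apply: eq_Rintegral => z _; rewrite mulrBl.
  apply: measurable_funTS; apply: measurable_funB => //.
  exact: (measurableT_comp mg (measurableT_comp measurable_shiftQ (measurable_pair1 p))).
have fara pq : far nu D shiftQQ a pq = far nu D shiftQ (A \o U) pq.1 * ker pq.
  rewrite -(farE (A \o U) pq.1 (ker pq) (measurableT_comp mA mU) (k0 pq)).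
  rewrite /far; apply: eq_Rintegral => z _.
  by rewrite /a; congr (_ * _ - _); case: pq => p q; exact: ker_shift.
have farb pq : far nu D shiftQQ b pq = far nu D shiftQ (A \o W) pq.2 * ker pq.
  rewrite -(farE (A \o W) pq.2 (ker pq) (measurableT_comp mA mW) (k0 pq)).
  rewrite /far; apply: eq_Rintegral => z _.
  by rewrite /b; congr (_ * _ - _); case: pq => p q; exact: ker_shift.
have E pq : dbl4 A nu e t0 t1 U W r pq + dbl4 A nu e t0 t1 W U r (pq.2, pq.1) =
    eta' (W pq.2) (U pq.1) * (far nu D shiftQQ a pq - far nu D shiftQQ b pq).
  rewrite fara farb /dbl4 -/D /=; case: pq => p q /=.
  rewrite (ker_sym _ _ _ q p) (_ : eta' (U p) (W q) = - eta' (W q) (U p)); last first.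
    by rewrite /eta' -opprB sgrN.
  ring.
have -> : (fun pq => (dbl4 A nu e t0 t1 U W r pq +
    dbl4 A nu e t0 t1 W U r (pq.2, pq.1))%:E) = (fun pq =>
    (eta' (W pq.2) (U pq.1) * (far nu D shiftQQ a pq - far nu D shiftQQ b pq))%:E).
  by apply/funext => pq; rewrite E.
apply: (far_pair_le0 mD Dlty measurable_shiftQQ mpres_shiftQQ ia ib).
- exact: measurable_eta'_UW.
- by move=> pq; rewrite /eta' normr_sg; case: (_ != _).
- move=> pq; rewrite -mulrBl mulrA sgA normrM (ger0_norm (k0 _)).
  by [].
Qed.

End far_term.

Variables (u0 v0 : V -> R) (u v : V * R -> R).
Hypothesis (esu : entropy_solution f A nu T u0 u).
Hypothesis (esv : entropy_solution f A nu T v0 v).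
Hypothesis T0 : 0 < T.

Let U := extU T u : Q -> R.
Let W := extU T v : Q -> R.

Let dblsum (k r : R) (U1 U2 : Q -> R) (pq : Q * Q) : R :=
  dbl1 e t0 t1 U1 U2 pq + dbl2 f e t0 t1 U1 U2 pq + k * dbl3 A e t0 t1 U1 U2 pq +
  dbl4 A nu e t0 t1 U1 U2 r pq + dbl5 A nu e t0 t1 U1 U2 r pq.

Let integrable_dblsum k r U1 U2 : 0 < r ->
  lebQ.-integrable setT (EFin \o U1) -> lebQ.-integrable setT (EFin \o U2) ->
  lebQQ.-integrable setT (EFin \o dblsum k r U1 U2).
Proof.
move=> r0 i1 i2.
have m1 : measurable_fun setT U1 by case/integrableP : i1 => /measurable_EFinP.
have m2 : measurable_fun setT U2 by case/integrableP : i2 => /measurable_EFinP.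
have j1 := integrable_dbl1 e0 t01 m1 m2 i1 i2.
have j2 := integrable_dbl2 lf e0 t01 m1 m2 i1 i2.
have j3 := integrableZl measurableT k (integrable_dbl3 lA e0 t01 m1 m2 i1 i2).
have j4 := integrable_dbl4 lA A0 inu e0 t01 r0 m1 m2 i1.
have j5 := integrable_dbl5 lA nu e0 t01 m1 m2 i1 i2 r.
exact: (integrableD measurableT (integrableD measurableT (integrableD measurableT
  (integrableD measurableT j1 j2) j3) j4) j5).
Qed.

Let integral_dblsum_ge0 (w0 : V -> R) (w : V * R -> R) (U2 : Q -> R) (C eps r : R) :
  entropy_solution f A nu T w0 w -> lebQ.-integrable setT (EFin \o U2) -> 0 <= C ->
  (forall x z : V,
     `|moll e (x + z) - moll e x - dotv z (grad (moll e) x)| <= C * enorm z ^+ 2) ->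
  0 < r < 1 ->
  (\int[nu]_(z in punct_ball r) (enorm z ^+ 2)%:E <= eps%:E)%E ->
  (0 <= \int[lebQQ]_pq (dblsum (@thetaC0 R * C * eps) r (extU T w) U2 pq)%:E)%E.
Proof.
move=> esw i2 C0 hC r01 ie; have /andP[r0 _] := r01.
have iw : lebQ.-integrable setT (EFin \o extU T w) := integrable_extU T0 esw.
have iS := integrable_dblsum (@thetaC0 R * C * eps) r0 iw i2.
rewrite -(integral21_prod_meas1 iS); apply: integral_ge0 => q _.
exact: (entropy_dbl e0 t01 te0 te1 U2 q esw C0 hC r01 ie).
Qed.

Lemma doubling_ge0 : (0 <= \int[lebQQ]_pq
  (Defs.eta (W pq.2) (U pq.1) * (dker pq + dker (pq.2, pq.1)))%:E)%E /\
  lebQQ.-integrable setT (fun pq =>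
  (Defs.eta (W pq.2) (U pq.1) * (dker pq + dker (pq.2, pq.1)))%:E).
Proof.
have iU : lebQ.-integrable setT (EFin \o U) := integrable_extU T0 esu.
have iW : lebQ.-integrable setT (EFin \o W) := integrable_extU T0 esv.
have mU : measurable_fun setT U by case/integrableP : iU => /measurable_EFinP.
have mW : measurable_fun setT W by case/integrableP : iW => /measurable_EFinP.
have [C C0 hC] := @moll_taylor_bound R d e.
have hC2 (x z : V) := (hC x z).2.
have i1 := integrable_dbl1 e0 t01 mU mW iU iW.
have i1' := mpres_integrable mpres_lebQQ_swap (integrable_dbl1 e0 t01 mW mU iW iU).
have iJ : lebQQ.-integrable setT (fun pq =>
  (Defs.eta (W pq.2) (U pq.1) * (dker pq + dker (pq.2, pq.1)))%:E).
  apply: eq_integrable (integrableD measurableT i1 i1') => // -[p q] _.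
  rewrite /= /dbl1 /= -EFinD; congr EFin.
  by rewrite mulrDr (_ : Defs.eta (U p) (W q) = Defs.eta (W q) (U p))// /Defs.eta distrC.
split=> //.
have i3 := integrable_dbl3 lA e0 t01 mU mW iU iW.
pose M := fine (\int[lebQQ]_pq (dbl3 A e t0 t1 U W pq)%:E)%E.
have ME : (\int[lebQQ]_pq (dbl3 A e t0 t1 U W pq)%:E = M%:E)%E.
  by rewrite /M fineK//; exact: integrable_fin_num i3.
pose j := fine (\int[lebQQ]_pq
  (Defs.eta (W pq.2) (U pq.1) * (dker pq + dker (pq.2, pq.1)))%:E)%E.
have jE : (\int[lebQQ]_pq
  (Defs.eta (W pq.2) (U pq.1) * (dker pq + dker (pq.2, pq.1)))%:E = j%:E)%E.
  by rewrite /j fineK//; exact: integrable_fin_num iJ.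
have M0 : 0 <= M.
  apply: fine_ge0; apply: integral_ge0 => pq _; rewrite lee_fin.
  by rewrite /dbl3 mulr_ge0// /Defs.eta.
have K0 : 0 <= @thetaC0 R by apply: le_trans (theta_le e0 t01 0 0); exact: theta_ge0.
(* The near contribution carries the factor eps, while M depends neither on eps nor on r. *)
suff key eps : 0 < eps -> 0 <= j + 2 * (@thetaC0 R * C * M) * eps.
  rewrite jE lee_fin leNgt; apply/negP => j0.
  (* With eps = - j / c the bound would be j + (c - 1) eps = - eps < 0; the added 1 also keeps c
     positive. *)
  pose c := 2 * (@thetaC0 R * C * M) + 1.
  have cM0 : 0 <= 2 * (@thetaC0 R * C * M) by rewrite !mulr_ge0.
  have c0 : 0 < c by rewrite ltr_wpDl.
  have h1 : 0 < - j / c by rewrite divr_gt0// oppr_gt0.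
  have := key _ h1; apply/negP; rewrite -ltNge.
  have : c * (- j / c) = - j by rewrite mulrC divfK// gt_eqF.
  rewrite /c mulrDl mul1r; lra.
move=> eps0; have [r r01 ie] := near_sqr_small inu eps0.
have /andP[r0 r1] := r01.
pose K := @thetaC0 R * C * eps.
have g1 := integral_dblsum_ge0 esu iW C0 hC2 r01 ie.
have g2 := integral_dblsum_ge0 esv iU C0 hC2 r01 ie.
have iS1 := integrable_dblsum K r0 iU iW.
have iS2 := integrable_dblsum K r0 iW iU.
have mS2 : measurable_fun setT (EFin \o dblsum K r W U) by case/integrableP : iS2.
have iS2' := mpres_integrable mpres_lebQQ_swap iS2.
rewrite -(mpres_integral mpres_lebQQ_swap mS2) in g2.
have [i4 le4] := integral_dbl4_le0 iU iW r0.
have := adde_ge0 g1 g2.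
have <- := integralD measurableT iS1 iS2'.
(* Under exchange of p and q the entropy flux and [eta] are symmetric in the two states while [gker]
   changes sign, so flux and drift cancel; the near majorant is symmetric and doubles. *)
have -> : (\int[lebQQ]_pq ((dblsum K r U W pq)%:E +
    (EFin \o dblsum K r W U) (pq.2, pq.1)) =
  \int[lebQQ]_pq (((Defs.eta (W pq.2) (U pq.1) * (dker pq + dker (pq.2, pq.1)))%:E +
    (2 * K)%:E * (dbl3 A e t0 t1 U W pq)%:E) +
    (dbl4 A nu e t0 t1 U W r pq + dbl4 A nu e t0 t1 W U r (pq.2, pq.1))%:E))%E.
  apply: eq_integral => -[p q] _; rewrite /= -!EFinD; congr EFin.
  have etaC (a b : R) : Defs.eta a b = Defs.eta b a by rewrite /Defs.eta distrC.
  have e1 : dbl1 e t0 t1 W U (q, p) = Defs.eta (W q) (U p) * dker (q, p).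
    by rewrite /dbl1 /= etaC.
  have e2 : dbl2 f e t0 t1 W U (q, p) = - dbl2 f e t0 t1 U W (p, q).
    rewrite /dbl2 /= (gker_antisym _ _ _ p q) dotvNr /entropy_flux.
    rewrite (_ : eta' (U p) (W q) = - eta' (W q) (U p)); last first.
      by rewrite /eta' -opprB sgrN.
    by rewrite -(opprB (f (U p))) scalerN scaleNr opprK.
  have e3 : dbl3 A e t0 t1 W U (q, p) = dbl3 A e t0 t1 U W (p, q).
    by rewrite /dbl3 /= etaC /kbox box_sym.
  have e5 : dbl5 A nu e t0 t1 W U r (q, p) = - dbl5 A nu e t0 t1 U W r (p, q).
    by rewrite /dbl5 /= (gker_antisym _ _ _ p q) dotvNr mulrN etaC.
  rewrite /dblsum e1 e2 e3 e5 /dbl1 /=; ring.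
have i3' := integrableZl measurableT (2 * K) i3.
have i13 := integrableD measurableT iJ i3'.
rewrite integralD// integralD// integralZl// jE ME -EFinM -EFinD => h.
rewrite -lee_fin.
have -> : j + 2 * (@thetaC0 R * C * M) * eps = j + 2 * K * M by rewrite /K; ring.
by apply: le_trans h _; rewrite -[leRHS]adde0 leeD2l.
Qed.

End doubling_inequality.

Local Open Scope ereal_scope.

Lemma measurable_mkpair (a b c : measure_display) (A : measurableType a)
    (B : measurableType b) (C : measurableType c) (f : A -> B) (g : A -> C) :
  measurable_fun setT f -> measurable_fun setT g ->
  measurable_fun setT (fun x => (f x, g x)).
Proof. by move=> mf mg; apply/measurable_fun_pairP; split. Qed.

(** * Separating space from time in doubled integrals *)

Section shuffle.
Context {R : realType} d1 d2 (T1 : measurableType d1) (T2 : measurableType d2).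
Variables (m1 : {sigma_finite_measure set T1 -> \bar R}).
Variables (m2 : {sigma_finite_measure set T2 -> \bar R}).

(** Lets a doubled integral be read as a time average of spatial integrals. Of the four iterated
    integrals only those in y and t have to be exchanged. *)
Lemma mpres_shuffle : mpres (prod_sf (prod_sf m1 m1) (prod_sf m2 m2))
  (prod_sf (prod_sf m1 m2) (prod_sf m1 m2))
  (fun xyts => ((xyts.1.1, xyts.2.1), (xyts.1.2, xyts.2.2))).
Proof.
have msh : measurable_fun setT (fun xyts : (T1 * T1) * (T2 * T2) =>
    ((xyts.1.1, xyts.2.1), (xyts.1.2, xyts.2.2))).
  apply/measurable_fun_pairP; split; apply/measurable_fun_pairP; split.
  - exact: (measurableT_comp measurable_fst measurable_fst).
  - exact: (measurableT_comp measurable_fst measurable_snd).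
  - exact: (measurableT_comp measurable_snd measurable_fst).
  - exact: (measurableT_comp measurable_snd measurable_snd).
split=> // F mF F0.
have mG : measurable_fun setT (fun xyts : (T1 * T1) * (T2 * T2) =>
    F ((xyts.1.1, xyts.2.1), (xyts.1.2, xyts.2.2))) by exact: measurableT_comp.
rewrite [LHS](fubini_tonelli1 (m1 := prod_sf m1 m1) (m2 := prod_sf m2 m2) _ mG)//.
rewrite [LHS](fubini_tonelli1 (m1 := m1) (m2 := m1)); last 2 first.
- exact: (measurable_fun_fubini_tonelli_F (m2 := prod_sf m2 m2) _ mG).
- by move=> xy; exact: integral_ge0.
rewrite [RHS](fubini_tonelli1 (m1 := prod_sf m1 m2) (m2 := prod_sf m1 m2) _ mF)//.
rewrite [RHS](fubini_tonelli1 (m1 := m1) (m2 := m2)); last 2 first.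
- exact: (measurable_fun_fubini_tonelli_F (m2 := prod_sf m1 m2) _ mF).
- by move=> xy; exact: integral_ge0.
apply: eq_integral => x _; rewrite /fubini_F.
pose H (y : T1) (t : T2) := \int[m2]_s F ((x, t), (y, s)).
transitivity (\int[m1]_y \int[m2]_t H y t).
  apply: eq_integral => y _; rewrite (fubini_tonelli1 (m1 := m2) (m2 := m2))//.
  exact: (measurableT_comp mG (measurable_pair1 (x, y))).
rewrite (fubini_tonelli (m1 := m1) (m2 := m2) (fun yt => H yt.1 yt.2)); last 2 first.
- have mK : measurable_fun setT (fun yts : (T1 * T2) * T2 =>
      F ((x, yts.1.2), (yts.1.1, yts.2))).
    apply: measurableT_comp => //; apply: measurable_mkpair; apply: measurable_mkpair.
    + exact: measurable_cst.
    + exact: (measurableT_comp measurable_snd measurable_fst).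
    + exact: (measurableT_comp measurable_fst measurable_fst).
    + exact: measurable_snd.
  exact: (measurable_fun_fubini_tonelli_F (m2 := m2) _ mK).
- by move=> yt; exact: integral_ge0.
apply: eq_integral => t _; rewrite /fubini_G.
rewrite [RHS](fubini_tonelli1 (m1 := m1) (m2 := m2) (fun ys => F ((x, t), ys)))//.
exact: (measurableT_comp mF (measurable_pair1 (x, t))).
Qed.

End shuffle.

(** * Masses of the mollifiers *)

Section mollifier_constants.
Context {R : realType}.

Lemma integral_gt0_of_box (d : measure_display) (T : measurableType d)
    (m : {measure set T -> \bar R}) (g : T -> R) (B : set T) :
  measurable B -> 0 < m B -> measurable_fun setT g -> (forall x, 0 <= g x)%R ->
  (forall x, B x -> 0 < g x)%R -> 0 < \int[m]_x (g x)%:E.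
Proof.
move=> mB B0 mg g0 gB; rewrite lt0e integral_ge0 ?andbT//; last first.
  by move=> x _; rewrite lee_fin.
apply/eqP => I0.
have mEg : measurable_fun setT (EFin \o g) by exact/measurable_EFinP.
have : \int[m]_x `|(EFin \o g) x| = 0.
  by rewrite -I0; apply: eq_integral => x _; rewrite gee0_abs// lee_fin.
move=> /(ae_eq_integral_abs m measurableT mEg)[N [mN N0 sN]].
have BN : B `<=` N.
  move=> x Bx; apply: sN => /= /(_ Logic.I) [] gx0.
  by have := gB x Bx; rewrite gx0 ltxx.
have : m B <= m N by apply: le_measure => //; rewrite inE.
by rewrite N0 leNgt B0.
Qed.

Let lam2 : {sigma_finite_measure set _ -> \bar R} :=
  prod_sf (@lebesgue_measure R) (@lebesgue_measure R).

Let lam2X (A B : set (measurableTypeR R)) : measurable A -> measurable B ->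
  lam2 (A `*` B) = lebesgue_measure A * lebesgue_measure B.
Proof. exact: product_measure1E. Qed.

(** The mass of [tker] is the same at every time ([tmassE]), so it cancels between t0 and t1; only 0
    < [tmass e] < +oo matters. *)
Definition tmass (e : R) : \bar R := \int[lam2]_ts (tker e 0 ts.1 ts.2)%:E.

Let mtk e tau : measurable_fun setT
  (fun ts : measurableTypeR R * measurableTypeR R => tker e tau ts.1 ts.2).
Proof.
have mf : measurable_fun setT
  (fun ts : measurableTypeR R * measurableTypeR R => ts.1 : R) by exact: measurable_fst.
have ms : measurable_fun setT
  (fun ts : measurableTypeR R * measurableTypeR R => ts.2 : R) by exact: measurable_snd.
have mb := continuous_measurable_fun (@continuous_bump R).
apply: measurable_funM.
  apply: (measurableT_comp mb); apply: measurable_funM => //.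
  exact: measurable_funB.
apply: (measurableT_comp mb); apply: measurable_funM => //.
by apply: measurable_funB => //; exact: measurable_funD.
Qed.

Lemma tmassE e tau : \int[lam2]_ts (tker e tau ts.1 ts.2)%:E = tmass e.
Proof.
have mF : measurable_fun setT (fun ts : measurableTypeR R * measurableTypeR R =>
    (tker e tau ts.1 ts.2)%:E) by apply/measurable_EFinP; exact: mtk.
have F0 (ts : measurableTypeR R * measurableTypeR R) : 0 <= (tker e tau ts.1 ts.2)%:E.
  by rewrite lee_fin tker_ge0.
apply: (etrans (esym ((mpres_prod (mpres_shift tau) (mpres_shift tau)).2 _ mF F0))).
apply: eq_integral => -[t s] _ /=; congr EFin; rewrite /tker.
by congr (bump (_ / _) * bump (_ / _))%R; ring.
Qed.

Let itv_lty (b : R) : (0 < b)%R ->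
  0 < @lebesgue_measure R `[(- b)%R, b]%classic /\
  @lebesgue_measure R `[(- b)%R, b]%classic < +oo.
Proof.
move=> b0; have lE := lebesgue_measure_itv `[(- b)%R, b].
have bb : (- b < b)%R by rewrite gtrN.
rewrite /= lte_fin bb in lE.
split.
  by apply: (eq_ind_r (fun z => 0 < z) _ lE); rewrite -EFinB lte_fin subr_gt0.
by apply: (eq_ind_r (fun z => z < +oo) _ lE); rewrite -EFinB ltry.
Qed.

Lemma tmass_gt0 e : (0 < e)%R -> 0 < tmass e.
Proof.
(* For |t|, |s| <= e/4 both |t - s| and |t + s| are at most e/2 < e. *)
move=> e0; have e4 : (0 < e / 4)%R by rewrite divr_gt0.
have [h1 h2] := itv_lty e4.
have mI : measurable (`[(- (e / 4))%R, (e / 4)%R]%classic : set (measurableTypeR R)).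
  exact: measurable_itv.
apply: (@integral_gt0_of_box _ _ lam2 (fun ts => tker e 0 ts.1 ts.2)
  (`[(- (e / 4))%R, (e / 4)%R]%classic `*` `[(- (e / 4))%R, (e / 4)%R]%classic)).
- exact: measurableX.
- by apply: (eq_ind_r (fun z => 0 < z) _ (lam2X mI mI)); exact: mule_gt0.
- exact: mtk.
- by move=> ts; exact: tker_ge0.
- move=> [t s] [/=]; rewrite !in_itv/= -!ler_norml => ht hs.
  have ht1 := ler_normB t s; have ht2 := ler_normD t s.
  by rewrite mulr_gt0// bump_gt0// normrM normfV (gtr0_norm e0) ltr_pdivrMr// mul1r
    ?mulr0 ?subr0; lra.
Qed.

(** |t - s| < e and |t + s| < e force |t|, |s| < e, so the kernel lies below the indicator of a
    square. *)
Lemma tmass_lty e : (0 < e)%R -> tmass e < +oo.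
Proof.
move=> e0; have [h1 h2] := itv_lty e0.
have mI : measurable (`[(- e)%R, e]%classic : set (measurableTypeR R)).
  exact: measurable_itv.
pose B : set (measurableTypeR R * measurableTypeR R) :=
  (`[(- e)%R, e]%classic `*` `[(- e)%R, e]%classic).
have mB : measurable B by exact: measurableX.
apply: (@le_lt_trans _ _ (\int[lam2]_ts (\1_B ts)%:E)).
  apply: ge0_le_integral => //.
  - by move=> ts _; rewrite lee_fin tker_ge0.
  - by apply/measurable_EFinP; exact: mtk.
  - by apply/measurable_EFinP; exact: measurable_indic.
  move=> [t s] _; rewrite lee_fin indicE.
  have [_|nB] := boolP ((t, s) \in B).
    by rewrite /tker -[leRHS]mulr1 ler_pM// ?bump_ge0 ?bump_le1.
  rewrite /tker /=; have [h|h] := leP e `|t - s|%R.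
    by rewrite bump_eq0 ?mul0r// normrM normfV (gtr0_norm e0) ler_pdivlMr// mul1r.
  rewrite [X in (_ * X)%R]bump_eq0 ?mulr0//.
  rewrite normrM normfV (gtr0_norm e0) ler_pdivlMr// mul1r ?mulr0 ?subr0 leNgt.
  apply/negP => h'; move/negP : nB; apply; rewrite inE; split; rewrite /= in_itv/=;
    move: h h'; rewrite !ltr_norml => /andP[? ?] /andP[? ?]; apply/andP; split; lra.
rewrite integral_indic// setIT.
apply: (eq_ind_r (fun z => z < +oo) _ (lam2X mI mI)).
by rewrite lte_mul_pinfty// ge0_fin_numE.
Qed.

Definition xmass d (e : R) : \bar R := \int[lebesgue_rV R d]_x (moll e x)%:E.

Let rV_box_lty d (b : R) : (0 < b)%R ->
  measurable [set v : 'rV[R]_d | forall i, `[(- b)%R, b]%classic (v 0%R i)] /\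
  0 < lebesgue_rV R d [set v | forall i, `[(- b)%R, b]%classic (v 0%R i)] < +oo.
Proof.
move=> b0; have [h1 h2] := itv_lty b0; split.
  by apply: (@measurable_rV_box R d (fun=> `[(- b)%R, b]%classic)) => i;
    exact: measurable_itv.
have -> : lebesgue_rV R d [set v | forall i, `[(- b)%R, b]%classic (v 0%R i)] =
    ((2 * b) ^+ d)%:E.
  apply: (etrans (@lebesgue_rV_box R d (fun=> `[(- b)%R, b]%classic)
    (fun i => measurable_itv _))).
  rewrite -[in RHS](card_ord d) -prodr_const -prodEFin; apply: eq_bigr => i _.
  apply: (etrans (lebesgue_measure_itv _)); rewrite /= lte_fin gtrN//.
  by rewrite -EFinB; congr EFin; ring.
by rewrite lte_fin exprn_gt0 ?mulr_gt0// ltry.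
Qed.

Lemma xmass_gt0 d e : (0 < e)%R -> 0 < xmass d e.
Proof.
move=> e0; have e2 : (0 < e / 2)%R by rewrite divr_gt0.
have [mB /andP[B0 _]] := rV_box_lty d e2.
apply: (integral_gt0_of_box mB B0).
- exact: measurable_moll.
- by move=> x; exact: moll_ge0.
- move=> x xB; apply: moll_gt0 => // i.
  have := xB i; rewrite /= in_itv/= -ler_norml => /le_lt_trans; apply; lra.
Qed.

Lemma xmass_lty d e : (0 < e)%R -> xmass d e < +oo.
Proof.
move=> e0; have [mB /andP[_ Boo]] := rV_box_lty d e0.
pose B := [set v : 'rV[R]_d | forall i, `[(- e)%R, e]%classic (v 0%R i)].
apply: (@le_lt_trans _ _ (\int[lebesgue_rV R d]_x (\1_B x)%:E)).
  apply: ge0_le_integral => //.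
  - by move=> x _; rewrite lee_fin moll_ge0.
  - by apply/measurable_EFinP; exact: measurable_moll.
  - by apply/measurable_EFinP; exact: measurable_indic.
  move=> x _; rewrite lee_fin indicE; have [_|nB] := boolP (x \in B).
    exact: moll_le1.
  have /existsNP[i hi] : ~ forall i, `[(- e)%R, e]%classic (x 0%R i).
    by move=> h; move/negP : nB; apply; rewrite inE.
  rewrite (@moll_eq0 _ _ _ _ i)//; move: hi; rewrite /= in_itv/= => /negP.
  by rewrite -ler_norml -ltNge => /ltW.
by rewrite integral_indic// setIT.
Qed.

End mollifier_constants.

(** * Comparison of regularised and exact L^1 distances *)

Section space_average.
Context {R : realType} {d : nat}.
Local Notation V := 'rV[R]_d.
Local Notation lam := (lebesgue_rV R d).
Variable e : R.
Hypothesis e0 : (0 < e)%R.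

Definition lamxy := prod_sf (lebesgue_rV R d) (lebesgue_rV R d).

Lemma measurable_mollxy :
  measurable_fun setT (fun xy : V * V => moll e (xy.1 - xy.2)).
Proof.
have mxy : measurable_fun setT (fun xy : V * V => (xy.1 - xy.2)%R).
  by apply: measurable_subv; [exact: measurable_fst|exact: measurable_snd].
exact: (measurableT_comp (measurable_moll e) mxy).
Qed.

Lemma integral_moll_sub (x : V) : \int[lam]_y (moll e (x - y))%:E = xmass d e.
Proof.
have mm : measurable_fun setT (fun y : V => (moll e y)%:E).
  by apply/measurable_EFinP; exact: measurable_moll.
have m0 (y : V) : 0 <= (moll e y)%:E by rewrite lee_fin moll_ge0.
rewrite /xmass -((mpres_shift_rV (- x)).2 _ mm m0).
by apply: eq_integral => y _; rewrite -mollN opprB.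
Qed.

Lemma integral_xmoll (g : V -> R) : measurable_fun setT g -> (forall x, 0 <= g x)%R ->
  \int[lamxy]_xy (g xy.1 * moll e (xy.1 - xy.2))%:E =
  (\int[lam]_x (g x)%:E) * xmass d e.
Proof.
move=> mg g0.
have mF : measurable_fun setT (fun xy : V * V => (g xy.1 * moll e (xy.1 - xy.2))%:E).
  apply/measurable_EFinP; apply: measurable_funM; last exact: measurable_mollxy.
  exact: (measurableT_comp mg measurable_fst).
rewrite [LHS](fubini_tonelli1 (m1 := lam) (m2 := lam) _ mF); last first.
  by move=> xy; rewrite lee_fin mulr_ge0// moll_ge0.
have x0 : 0 <= xmass d e by apply: integral_ge0 => x _; rewrite lee_fin moll_ge0.
rewrite [RHS]muleC -ge0_integralZl//; [|exact/measurable_EFinP|by move=> x _; rewrite lee_fin].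
apply: eq_integral => x _; rewrite /fubini_F /= muleC -(integral_moll_sub x).
rewrite -ge0_integralZl//.
- by apply/measurable_EFinP; exact: (measurableT_comp measurable_mollxy (measurable_pair1 x)).
- by move=> y _; rewrite lee_fin moll_ge0.
- by rewrite lee_fin.
Qed.

Lemma integral_ymoll (g : V -> R) : measurable_fun setT g -> (forall x, 0 <= g x)%R ->
  \int[lamxy]_xy (g xy.2 * moll e (xy.1 - xy.2))%:E =
  (\int[lam]_x (g x)%:E) * xmass d e.
Proof.
move=> mg g0; rewrite -integral_xmoll//.
have mF : measurable_fun setT (fun xy : V * V => (g xy.1 * moll e (xy.1 - xy.2))%:E).
  apply/measurable_EFinP; apply: measurable_funM; last exact: measurable_mollxy.
  exact: (measurableT_comp mg measurable_fst).
rewrite -(mpres_integral (mpres_swap lam lam) mF).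
by apply: eq_integral => -[x y] _ /=; rewrite -mollN opprB.
Qed.

(** With z = x - y the left side averages over z the L^1 distances between w and its translates, and
    [moll] charges only those z with all coordinates below e. *)
Lemma integral_shift_moll_le (w : V -> R) (s : R) : measurable_fun setT w ->
  (forall a : V, (forall i, `|a 0 i| < e)%R ->
    \int[lam]_x `|(w (x + a) - w x)%:E| <= s%:E) -> (0 <= s)%R ->
  \int[lamxy]_xy (`|w xy.1 - w xy.2| * moll e (xy.1 - xy.2))%:E <=
  s%:E * xmass d e.
Proof.
move=> mw hw s0.
have mD : measurable_fun setT (fun xy : V * V => `|w xy.1 - w xy.2|%R).
  have mn : measurable_fun setT (fun w : R => `|w|%R).
    by apply: continuous_measurable_fun; exact: norm_continuous.
  apply: (measurableT_comp mn); apply: measurable_funB.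
    exact: (measurableT_comp mw measurable_fst).
  exact: (measurableT_comp mw measurable_snd).
have mF : measurable_fun setT (fun xy : V * V =>
    (`|w xy.1 - w xy.2| * moll e (xy.1 - xy.2))%:E).
  apply/measurable_EFinP; apply: measurable_funM => //; exact: measurable_mollxy.
have mG : measurable_fun setT (fun zy : V * V =>
    (`|w (zy.1 + zy.2) - w zy.2| * moll e zy.1)%:E).
  have ms : measurable_fun setT (fun zy : V * V => ((zy.1 + zy.2)%R, zy.2)).
    apply: measurable_mkpair; last exact: measurable_snd.
    by apply: measurable_addv; [exact: measurable_fst|exact: measurable_snd].
  apply/measurable_EFinP; apply: measurable_funM.
    exact: (measurableT_comp mD ms).
  exact: (measurableT_comp (measurable_moll e) measurable_fst).
have F0 (xy : V * V) : 0 <= (`|w xy.1 - w xy.2| * moll e (xy.1 - xy.2))%:E.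
  by rewrite lee_fin mulr_ge0// moll_ge0.
have G0 (zy : V * V) : 0 <= (`|w (zy.1 + zy.2) - w zy.2| * moll e zy.1)%:E.
  by rewrite lee_fin mulr_ge0// moll_ge0.
rewrite [leLHS](fubini_tonelli2 (m1 := lam) (m2 := lam) _ mF F0).
have -> : \int[lam]_y fubini_G lam (fun xy => (`|w xy.1 - w xy.2| * moll e (xy.1 - xy.2))%:E) y =
    \int[lam]_y \int[lam]_z (fun zy : V * V =>
      (`|w (zy.1 + zy.2) - w zy.2| * moll e zy.1)%:E) (z, y).
  apply: eq_integral => y _; rewrite /fubini_G.
  have mFy : measurable_fun setT (fun x : V => (`|w x - w y| * moll e (x - y))%:E).
    exact: (measurableT_comp mF (measurable_pair2 y)).
  have Fy0 (x : V) : 0 <= (`|w x - w y| * moll e (x - y))%:E.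
    by rewrite lee_fin mulr_ge0// moll_ge0.
  apply: (etrans (esym ((mpres_shift_rV y).2 _ mFy Fy0))).
  by apply: eq_integral => z _; rewrite /= addrK.
have TE := fubini_tonelli (m1 := lam) (m2 := lam) _ mG G0.
rewrite [leLHS](_ : _ = \int[lam]_z fubini_F lam (fun zy : V * V =>
    (`|w (zy.1 + zy.2) - w zy.2| * moll e zy.1)%:E) z); last exact: esym TE.
have x0 : 0 <= xmass d e by apply: integral_ge0 => x _; rewrite lee_fin moll_ge0.
have mm : measurable_fun setT (fun y : V => (moll e y)%:E).
  by apply/measurable_EFinP; exact: measurable_moll.
have moll0 (x : V) : setT x -> 0 <= (moll e x)%:E by rewrite lee_fin moll_ge0.
have s0' : 0 <= s%:E by rewrite lee_fin.
rewrite /xmass -(ge0_integralZl lam measurableT mm moll0 s0').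
apply: le_integral_any => z _; rewrite /fubini_F /=.
have mz : measurable_fun setT (fun y : V => `|(w (y + z) - w y)%:E|).
  have mwz : measurable_fun setT (fun y : V => w (y + z)%R).
    exact: (measurableT_comp mw (measurable_shift_rV z)).
  have mE := (measurable_EFinP setT _).2 (measurable_funB mwz mw).
  exact: (measurableT_comp (@abse_measurable R setT) mE).
have -> : \int[lam]_y (`|w (z + y) - w y| * moll e z)%:E =
    (moll e z)%:E * \int[lam]_y `|(w (y + z) - w y)%:E|.
  have mz0 : 0 <= (moll e z)%:E by rewrite lee_fin moll_ge0.
  have nz0 (y : V) : setT y -> 0 <= `|(w (y + z) - w y)%:E| by [].
  rewrite -(ge0_integralZl lam measurableT mz nz0 mz0).
  by apply: eq_integral => y _; rewrite (addrC z y) EFinM [LHS]muleC.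
rewrite muleC; have [zi|/existsNP[i zi]] := pselect (forall i, `|z 0 i| < e)%R.
  by apply: lee_wpmul2r; [rewrite lee_fin moll_ge0|exact: hw].
have -> : moll e z = 0%R by apply: (moll_eq0 (i := i) e0); rewrite leNgt; exact/negP.
by rewrite !mule0.
Qed.

Lemma le_integral_sum4 (F0 F1 F2 F3 F4 : V * V -> R) :
  measurable_fun setT F1 -> measurable_fun setT F2 ->
  measurable_fun setT F3 -> measurable_fun setT F4 ->
  (forall xy, 0 <= F1 xy)%R -> (forall xy, 0 <= F2 xy)%R ->
  (forall xy, 0 <= F3 xy)%R -> (forall xy, 0 <= F4 xy)%R ->
  (forall xy, F0 xy <= F1 xy + F2 xy + F3 xy + F4 xy)%R ->
  \int[lamxy]_xy (F0 xy)%:E <= \int[lamxy]_xy (F1 xy)%:E + \int[lamxy]_xy (F2 xy)%:E +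
    \int[lamxy]_xy (F3 xy)%:E + \int[lamxy]_xy (F4 xy)%:E.
Proof.
move=> /measurable_EFinP m1 /measurable_EFinP m2 /measurable_EFinP m3 /measurable_EFinP m4.
move=> p1 p2 p3 p4 h.
rewrite -ge0_integralD//; [|by move=> *; rewrite lee_fin|by move=> *; rewrite lee_fin].
rewrite -ge0_integralD//; [|by move=> *; rewrite -EFinD lee_fin addr_ge0|
  exact: emeasurable_funD|by move=> *; rewrite lee_fin].
rewrite -ge0_integralD//; [|by move=> *; rewrite -!EFinD lee_fin !addr_ge0|
  by apply: emeasurable_funD => //; exact: emeasurable_funD|by move=> *; rewrite lee_fin].
by apply: le_integral_any => xy _; rewrite -!EFinD lee_fin.
Qed.

(** Exchanging |u1(x) - v1(y)| and |u2(x) - v2(x)| costs |u1 - u2|(x), |v2(x) - v2(y)| and |v1 -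
    v2|(y). Against the mollifier each contributes at most s times its mass, whence 3 s. *)
Lemma space_average_compare (u1 u2 v1 v2 : V -> R) (s : R) :
  measurable_fun setT u1 -> measurable_fun setT u2 ->
  measurable_fun setT v1 -> measurable_fun setT v2 ->
  \int[lam]_x `|(u1 x - u2 x)%:E| <= s%:E ->
  \int[lam]_x `|(v1 x - v2 x)%:E| <= s%:E ->
  (forall a : V, (forall i, `|a 0 i| < e)%R ->
    \int[lam]_x `|(v2 (x + a) - v2 x)%:E| <= s%:E) -> (0 <= s)%R ->
  \int[lamxy]_xy (`|u1 xy.1 - v1 xy.2| * moll e (xy.1 - xy.2))%:E <=
    (\int[lam]_x `|(u2 x - v2 x)%:E|) * xmass d e + (3 * s)%:E * xmass d e /\
  (\int[lam]_x `|(u2 x - v2 x)%:E|) * xmass d e <=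
    \int[lamxy]_xy (`|u1 xy.1 - v1 xy.2| * moll e (xy.1 - xy.2))%:E +
    (3 * s)%:E * xmass d e.
Proof.
move=> mu1 mu2 mv1 mv2 hu hv hw s0.
have mn : measurable_fun setT (fun w : R => `|w|%R).
  by apply: continuous_measurable_fun; exact: norm_continuous.
have mfst (h : V -> R) : measurable_fun setT h -> measurable_fun setT (fun xy : V * V => h xy.1).
  by move=> mh; exact: (measurableT_comp mh measurable_fst).
have msnd (h : V -> R) : measurable_fun setT h -> measurable_fun setT (fun xy : V * V => h xy.2).
  by move=> mh; exact: (measurableT_comp mh measurable_snd).
have mm (h k : V * V -> R) : measurable_fun setT h -> measurable_fun setT k ->
    measurable_fun setT (fun xy => `|h xy - k xy| * moll e (xy.1 - xy.2))%R.
  move=> mh mk; apply: measurable_funM; last exact: measurable_mollxy.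
  by apply: (measurableT_comp mn); exact: measurable_funB.
have md (h k : V -> R) : measurable_fun setT h -> measurable_fun setT k ->
    measurable_fun setT (fun x => `|h x - k x|%R).
  by move=> mh mk; apply: (measurableT_comp mn); exact: measurable_funB.
have ge0 (h k : V * V -> R) xy : (0 <= `|h xy - k xy| * moll e (xy.1 - xy.2))%R.
  by rewrite mulr_ge0// moll_ge0.
pose F0 (xy : V * V) : R := (`|u1 xy.1 - v1 xy.2| * moll e (xy.1 - xy.2))%R.
pose F1 (xy : V * V) : R := (`|u2 xy.1 - v2 xy.1| * moll e (xy.1 - xy.2))%R.
pose F2 (xy : V * V) : R := (`|u1 xy.1 - u2 xy.1| * moll e (xy.1 - xy.2))%R.
pose F3 (xy : V * V) : R := (`|v2 xy.1 - v2 xy.2| * moll e (xy.1 - xy.2))%R.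
pose F4 (xy : V * V) : R := (`|v1 xy.2 - v2 xy.2| * moll e (xy.1 - xy.2))%R.
have x0 : 0 <= xmass d e by apply: integral_ge0 => x _; rewrite lee_fin moll_ge0.
have h1 : \int[lamxy]_xy (F1 xy)%:E = (\int[lam]_x `|(u2 x - v2 x)%:E|) * xmass d e.
  exact: (integral_xmoll (md _ _ mu2 mv2)).
have h2 : \int[lamxy]_xy (F2 xy)%:E <= s%:E * xmass d e.
  by rewrite (integral_xmoll (md _ _ mu1 mu2))// lee_wpmul2r.
have h3 : \int[lamxy]_xy (F3 xy)%:E <= s%:E * xmass d e.
  exact: integral_shift_moll_le.
have h4 : \int[lamxy]_xy (F4 xy)%:E <= s%:E * xmass d e.
  by rewrite (integral_ymoll (md _ _ mv1 mv2))// lee_wpmul2r.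
have E3 : (3 * s)%:E * xmass d e = s%:E * xmass d e + s%:E * xmass d e + s%:E * xmass d e.
  rewrite -!ge0_muleDl ?lee_fin ?addr_ge0// -!EFinD.
  by congr (_%:E * _); ring.
have m0 := mm _ _ (mfst _ mu1) (msnd _ mv1).
have m1 := mm _ _ (mfst _ mu2) (mfst _ mv2).
have m2 := mm _ _ (mfst _ mu1) (mfst _ mu2).
have m3 := mm _ _ (mfst _ mv2) (msnd _ mv2).
have m4 := mm _ _ (msnd _ mv1) (msnd _ mv2).
have moll0 (xy : V * V) : (0 <= moll e (xy.1 - xy.2))%R by exact: moll_ge0.
split.
  have := @le_integral_sum4 F0 F1 F2 F3 F4 m1 m2 m3 m4 (ge0 _ _) (ge0 _ _) (ge0 _ _) (ge0 _ _).
  rewrite h1 => h; rewrite E3 !addeA; apply: (le_trans (h _)).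
    move=> xy; rewrite /F0 /F1 /F2 /F3 /F4 -!mulrDl ler_wpM2r//.
    rewrite (_ : u1 xy.1 - v1 xy.2 = (u2 xy.1 - v2 xy.1) + (u1 xy.1 - u2 xy.1) +
      (v2 xy.1 - v2 xy.2) - (v1 xy.2 - v2 xy.2))%R; last by ring.
    apply: (le_trans (ler_normB _ _)); rewrite lerD2r.
    apply: (le_trans (ler_normD _ _)); rewrite lerD2r.
    exact: ler_normD.
  by apply: leeD h4; apply: leeD h3; apply: leeD h2.
have := @le_integral_sum4 F1 F0 F2 F3 F4 m0 m2 m3 m4 (ge0 _ _) (ge0 _ _) (ge0 _ _) (ge0 _ _).
rewrite h1 => h; rewrite E3 !addeA; apply: (le_trans (h _)).
  move=> xy; rewrite /F0 /F1 /F2 /F3 /F4 -!mulrDl ler_wpM2r//.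
  rewrite (_ : u2 xy.1 - v2 xy.1 = (u1 xy.1 - v1 xy.2) - (u1 xy.1 - u2 xy.1) -
    (v2 xy.1 - v2 xy.2) + (v1 xy.2 - v2 xy.2))%R; last by ring.
  apply: (le_trans (ler_normD _ _)); rewrite lerD2r.
  apply: (le_trans (ler_normB _ _)); rewrite lerD2r.
  exact: ler_normB.
by apply: leeD h4; apply: leeD h3; apply: leeD h2.
Qed.

End space_average.

Section doubled_average.
Context {R : realType} {d : nat}.
Local Notation V := 'rV[R]_d.
Local Notation Q := (V * measurableTypeR R)%type.
Local Notation lam := (lebesgue_rV R d).
Local Notation lebTT := (prod_sf (@lebesgue_measure R) (@lebesgue_measure R)).
Variables (U W : Q -> R) (e : R).
Hypothesis iU : lebQ.-integrable setT (EFin \o U).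
Hypothesis iW : lebQ.-integrable setT (EFin \o W).
Hypothesis e0 : (0 < e)%R.

(** 2 (t - tau) is the sum of t + s - 2 tau and t - s, and 2 (s - tau) is their difference, so both
    are below 2 e where the two bumps are nonzero. *)
Lemma tker_eq0 tau t s : ~~ ((`|t - tau| < e) && (`|s - tau| < e))%R ->
  tker e tau t s = 0%R.
Proof.
move: e0 => e0'.
have [h|h] := leP e `|t - s|%R.
  by rewrite /tker bump_eq0 ?mul0r// normrM normfV (gtr0_norm e0) ler_pdivlMr// mul1r.
have [h'|h'] := leP e `|t + s - 2 * tau|%R.
  by rewrite /tker [X in (_ * X)%R]bump_eq0 ?mulr0// normrM normfV (gtr0_norm e0)
    ler_pdivlMr// mul1r.
case/negP; move: h h'; rewrite !ltr_norml => /andP[? ?] /andP[? ?].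
by apply/andP; split; apply/andP; split; lra.
Qed.

Definition dblavg_fun (tau : R) (pq : Q * Q) : R :=
  (`|U pq.1 - W pq.2| * (moll e (pq.1.1 - pq.2.1) * tker e tau pq.1.2 pq.2.2))%R.

(* Up to a normalisation, a regularisation of the L^1 distance of U and W at
   time tau. *)
Definition dblavg (tau : R) : \bar R := \int[lebQQ]_pq (dblavg_fun tau pq)%:E.

Definition slice_avg (ts : R * R) : \bar R :=
  \int[lamxy]_xy (`|U (xy.1, ts.1) - W (xy.2, ts.2)| * moll e (xy.1 - xy.2))%:E.

Let mU : measurable_fun setT U.
Proof. by case/integrableP : iU => /measurable_EFinP. Qed.

Let mW : measurable_fun setT W.
Proof. by case/integrableP : iW => /measurable_EFinP. Qed.

Let mn : measurable_fun setT (fun w : R => `|w|%R).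
Proof. by apply: continuous_measurable_fun; exact: norm_continuous. Qed.

Lemma measurable_dblavg_fun tau : measurable_fun setT (dblavg_fun tau).
Proof.
apply: measurable_funM.
  have mU1 : measurable_fun setT (fun pq : Q * Q => U pq.1).
    exact: (measurableT_comp mU measurable_fst).
  have mW2 : measurable_fun setT (fun pq : Q * Q => W pq.2).
    exact: (measurableT_comp mW measurable_snd).
  exact: (measurableT_comp mn (measurable_funB mU1 mW2)).
apply: measurable_funM; first exact: measurable_moll_xy.
exact: measurable_tker.
Qed.

Lemma dblavg_fun_ge0 tau pq : (0 <= dblavg_fun tau pq)%R.
Proof. by rewrite mulr_ge0// mulr_ge0 ?moll_ge0// tker_ge0. Qed.

Lemma integrable_dblavg tau : lebQQ.-integrable setT (EFin \o dblavg_fun tau).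
Proof.
have a01 : (tau - e <= tau + e)%R by move: e0 => ?; lra.
apply: (integrable_box_dominated (ltW e0) a01 ler01 iU iW).
  exact: measurable_dblavg_fun.
move=> pq; rewrite ger0_norm ?dblavg_fun_ge0// mul1r /dblavg_fun.
apply: ler_pM => //; [by rewrite mulr_ge0 ?moll_ge0 ?tker_ge0|exact: ler_normB|].
rewrite indicE; have [_|npq] := boolP (pq \in _).
  rewrite -[leRHS]mulr1 ler_pM ?moll_ge0 ?tker_ge0 ?moll_le1//.
  by rewrite /tker -[leRHS]mulr1 ler_pM ?bump_ge0 ?bump_le1.
have [/andP[h1 h2]|h] := boolP ((`|pq.1.2 - tau| < e) && (`|pq.2.2 - tau| < e))%R;
  last by rewrite tker_eq0// mulr0.
have /existsNP[i /negP hi] : ~ forall i, (`|(pq.1.1 - pq.2.1) 0%R i| <= e)%R.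
  move=> h; move/negP : npq; apply; rewrite inE; split=> //.
  move: h1 h2; rewrite !ltr_norml => /andP[? ?] /andP[? ?].
  by split; apply/andP; split; lra.
by rewrite (moll_eq0 (i := i) e0) ?mul0r// ltW// ltNge.
Qed.

Let mF tau : measurable_fun setT (fun xyts : (V * V) * (measurableTypeR R * measurableTypeR R) =>
  (dblavg_fun tau ((xyts.1.1, xyts.2.1), (xyts.1.2, xyts.2.2)))%:E).
Proof.
have mD : measurable_fun setT (EFin \o dblavg_fun tau).
  by apply/measurable_EFinP; exact: measurable_dblavg_fun.
have [ms _] := mpres_shuffle (lebesgue_rV R d) (@lebesgue_measure R).
exact: (measurableT_comp mD ms).
Qed.

Let sliceE tau t s :
  \int[lamxy]_xy (dblavg_fun tau ((xy.1, t), (xy.2, s)))%:E =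
  (tker e tau t s)%:E * slice_avg (t, s).
Proof.
rewrite /slice_avg -ge0_integralZl//.
- by apply: eq_integral => xy _; rewrite /dblavg_fun/= -EFinM; congr EFin; ring.
- apply/measurable_EFinP; apply: measurable_funM; last exact: measurable_mollxy.
  apply: (measurableT_comp mn); apply: measurable_funB.
    exact: (measurableT_comp (measurableT_comp mU (measurable_pair2 t)) measurable_fst).
  exact: (measurableT_comp (measurableT_comp mW (measurable_pair2 s)) measurable_snd).
- by move=> xy _; rewrite lee_fin mulr_ge0// moll_ge0.
- by rewrite lee_fin tker_ge0.
Qed.

Lemma dblavgE tau :
  dblavg tau = \int[lebTT]_ts ((tker e tau ts.1 ts.2)%:E * slice_avg ts).
Proof.
have mD : measurable_fun setT (EFin \o dblavg_fun tau).
  by apply/measurable_EFinP; exact: measurable_dblavg_fun.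
have D0 pq : 0 <= (EFin \o dblavg_fun tau) pq by rewrite lee_fin dblavg_fun_ge0.
apply: (etrans (esym ((mpres_shuffle (lebesgue_rV R d) (@lebesgue_measure R)).2 _ mD D0))).
have F0 (xyts : (V * V) * (measurableTypeR R * measurableTypeR R)) : 0 <=
  (dblavg_fun tau ((xyts.1.1, xyts.2.1), (xyts.1.2, xyts.2.2)))%:E.
  by rewrite lee_fin dblavg_fun_ge0.
apply: (etrans (fubini_tonelli2 (m1 := lamxy) (m2 := lebTT) _ (mF tau) F0)).
by apply: eq_integral => -[t s] _; exact: sliceE.
Qed.

Lemma measurable_slice_avg tau : measurable_fun setT
  (fun ts : measurableTypeR R * measurableTypeR R =>
    (tker e tau ts.1 ts.2)%:E * slice_avg ts).
Proof.
have F0 (xyts : (V * V) * (measurableTypeR R * measurableTypeR R)) : 0 <=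
  (dblavg_fun tau ((xyts.1.1, xyts.2.1), (xyts.1.2, xyts.2.2)))%:E.
  by rewrite lee_fin dblavg_fun_ge0.
have := measurable_fun_fubini_tonelli_G (m1 := lamxy) _ (mF tau) F0.
rewrite (_ : (fun ts : measurableTypeR R * measurableTypeR R =>
  (tker e tau ts.1 ts.2)%:E * slice_avg ts) = fubini_G lamxy (fun xyts =>
  (dblavg_fun tau ((xyts.1.1, xyts.2.1), (xyts.1.2, xyts.2.2)))%:E))//.
by apply/funext => -[t s]; rewrite -sliceE.
Qed.

End doubled_average.

Section compare.
Context {R : realType} {d : nat}.
Local Notation V := 'rV[R]_d.
Local Notation Q := (V * measurableTypeR R)%type.
Local Notation lam := (lebesgue_rV R d).
Local Notation lebTT := (prod_sf (@lebesgue_measure R) (@lebesgue_measure R)).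
Variables (U W : Q -> R) (e : R).
Hypothesis iU : lebQ.-integrable setT (EFin \o U).
Hypothesis iW : lebQ.-integrable setT (EFin \o W).
Hypothesis e0 : (0 < e)%R.

Let mU : measurable_fun setT U.
Proof. by case/integrableP : iU => /measurable_EFinP. Qed.

Let mW : measurable_fun setT W.
Proof. by case/integrableP : iW => /measurable_EFinP. Qed.

Let mUt t : measurable_fun setT (fun x : V => U (x, t)).
Proof. exact: (measurableT_comp mU (measurable_pair2 t)). Qed.

Let mWt t : measurable_fun setT (fun x : V => W (x, t)).
Proof. exact: (measurableT_comp mW (measurable_pair2 t)). Qed.

Let mtk tau : measurable_fun setT
  (fun ts : measurableTypeR R * measurableTypeR R => (tker e tau ts.1 ts.2)%:E).
Proof.
have h := measurable_tker (R := R) (d := d) e tau.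
have k : measurable_fun setT (fun ts : measurableTypeR R * measurableTypeR R =>
    (((0%R : V), ts.1) : Q, ((0%R : V), ts.2) : Q)).
  apply: measurable_mkpair; apply: measurable_mkpair; try exact: measurable_cst.
    exact: measurable_fst.
  exact: measurable_snd.
by apply/measurable_EFinP; exact: (measurableT_comp h k).
Qed.

(** Wherever [tker] is nonzero both times are within e of tau and the comparison of spatial averages
    applies; averaging it over t and s brings in [tmass]. *)
Lemma dblavg_compare (tau s : R) :
  (forall t, (`|t - tau| < e)%R -> \int[lam]_x `|(U (x, t) - U (x, tau))%:E| <= s%:E) ->
  (forall t, (`|t - tau| < e)%R -> \int[lam]_x `|(W (x, t) - W (x, tau))%:E| <= s%:E) ->
  (forall a : V, (forall i, `|a 0%R i| < e)%R ->
    \int[lam]_x `|(W ((x + a)%R, tau) - W (x, tau))%:E| <= s%:E) -> (0 <= s)%R ->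
  dblavg U W e tau <= ((\int[lam]_x `|(U (x, tau) - W (x, tau))%:E|) * xmass d e +
    (3 * s)%:E * xmass d e) * tmass e /\
  (\int[lam]_x `|(U (x, tau) - W (x, tau))%:E|) * xmass d e * tmass e <=
    dblavg U W e tau + (3 * s)%:E * xmass d e * tmass e.
Proof.
move=> hU hW hsh s0.
set N := \int[lam]_x _.
have N0 : 0 <= N by exact: integral_ge0.
have x0 : 0 <= xmass d e by apply: ltW; exact: xmass_gt0.
have tk0 (ts : measurableTypeR R * measurableTypeR R) : 0 <= (tker e tau ts.1 ts.2)%:E.
  by rewrite lee_fin tker_ge0.
have tkZ k : 0 <= k -> \int[lebTT]_ts ((tker e tau ts.1 ts.2)%:E * k) = k * tmass e.
  move=> k0; rewrite -(tmassE e tau) -(ge0_integralZl lebTT measurableT (mtk tau) (fun ts _ => tk0 ts) k0).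
  by apply: eq_integral => ts _; rewrite muleC.
have Y0 ts : 0 <= slice_avg U W e ts.
  by apply: integral_ge0 => xy _; rewrite lee_fin mulr_ge0// moll_ge0.
have s30 : 0 <= (3 * s)%:E * xmass d e by rewrite mule_ge0// lee_fin mulr_ge0.
have cmp (ts : R * R) : (`|ts.1 - tau| < e)%R -> (`|ts.2 - tau| < e)%R ->
    slice_avg U W e ts <= N * xmass d e + (3 * s)%:E * xmass d e /\
    N * xmass d e <= slice_avg U W e ts + (3 * s)%:E * xmass d e.
  move=> h1 h2; exact: (space_average_compare e0 (mUt ts.1) (mUt tau) (mWt ts.2)
    (mWt tau) (hU _ h1) (hW _ h2) hsh s0).
rewrite (dblavgE e iU iW); split.
  have K0 : 0 <= N * xmass d e + (3 * s)%:E * xmass d e by rewrite adde_ge0// mule_ge0.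
  rewrite -(tkZ _ K0); apply: le_integral_any => ts _.
  have [/andP[h1 h2]|h] := boolP ((`|ts.1 - tau| < e) && (`|ts.2 - tau| < e))%R.
    by apply: lee_wpmul2l; [exact: tk0|exact: (cmp ts h1 h2).1].
  by rewrite tker_eq0// !mul0e.
have mY := measurable_slice_avg e iU iW tau.
have Nx0 : 0 <= N * xmass d e by exact: mule_ge0.
rewrite -(tkZ _ Nx0) -(tkZ _ s30) -ge0_integralD//; first last.
- by apply: emeasurable_funM => //; exact: mtk.
- by move=> ts _; rewrite mule_ge0// tk0.
- by move=> ts _; rewrite mule_ge0// tk0.
apply: le_integral_any => ts _.
have [/andP[h1 h2]|h] := boolP ((`|ts.1 - tau| < e) && (`|ts.2 - tau| < e))%R.
  rewrite -ge0_muleDr//; apply: lee_wpmul2l; [exact: tk0|exact: (cmp ts h1 h2).2].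
by rewrite tker_eq0// !mul0e adde0.
Qed.

End compare.

Lemma entropy_slice_near (R : realType) (d : nat) (f : R -> 'rV[R]_d) (A : R -> R)
    (mu : {measure set 'rV[R]_d -> \bar R}) (T : R) (u0 : 'rV[R]_d -> R)
    (u : 'rV[R]_d * R -> R) (tau s : R) :
  entropy_solution f A mu T u0 u -> (0 <= tau <= T)%R -> (0 < s)%R ->
  exists2 del : R, (0 < del)%R & forall t, (0 <= t <= T)%R -> (`|t - tau| < del)%R ->
    \int[lebesgue_rV R d]_x `|(u (x, t) - u (x, tau))%:E| <= s%:E.
Proof.
move=> es tauT s0.
have /fine_cvgP[ff /cvgrPdist_le /(_ s s0) h] := slice_cvg es tauT.
move: ff => /(filterI h)[/= del del0 hdel]; exists del => // t tT ttau.
have [] := hdel t; first by rewrite /= distrC.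
  by rewrite in_itv.
rewrite sub0r normrN ger0_norm ?fine_ge0 ?integral_ge0// => h1 h2.
by rewrite -[leLHS]fineK.
Qed.

(** The mollifier masses x and m, positive and finite, are divided out; the errors at the two times
    add up. *)
Lemma le_of_weighted_averages (R : realType) (N0 N1 X0 X1 x m : \bar R) (s : R) :
  0 <= N0 -> 0 < x -> x < +oo -> 0 < m -> m < +oo -> (0 <= s)%R ->
  X0 <= (N0 * x + s%:E * x) * m -> N1 * x * m <= X1 + s%:E * x * m -> X1 <= X0 ->
  N1 <= N0 + (2 * s)%:E.
Proof.
move=> N00 x0 xoo m0 moo s0 h0 h1 h10.
have K0 : 0 < x * m by exact: mule_gt0.
have Kf : x * m \is a fin_num by rewrite fin_numM// gt0_fin_numE.
have s0' : 0 <= s%:E by rewrite lee_fin.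
rewrite -(lee_pmul2r Kf K0) !muleA; apply: (le_trans h1).
apply: (le_trans (leeD2r _ (le_trans h10 h0))).
have x0' := ltW x0; have m0' := ltW m0.
have -> : (2 * s)%:E = s%:E + s%:E :> \bar R by rewrite -EFinD; congr EFin; ring.
have sx0 : 0 <= s%:E * x by exact: mule_ge0.
have Nx0 : 0 <= N0 * x by exact: mule_ge0.
rewrite addeA (ge0_muleDl _ (adde_ge0 N00 s0') s0') (ge0_muleDl _ N00 s0').
by rewrite (ge0_muleDl _ (adde_ge0 Nx0 sx0) sx0).
Qed.

(** * From the doubling inequality to the contraction *)

Section contraction.
Context {R : realType} {d : nat}.
Local Notation V := 'rV[R]_d.
Local Notation Q := (V * measurableTypeR R)%type.
Local Notation lam := (lebesgue_rV R d).
Variables (f : R -> V) (A : R -> R).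
Hypotheses (lf : lipschitz f) (lA : lipschitz A) (A0 : A 0 = 0%R).
Hypothesis ndA : {homo A : x y / (x <= y)%R}.
Variable nu : {sigma_finite_measure set V -> \bar R}.
Hypothesis inu : levy_integrable nu.
Variables (T : R) (u0 v0 : V -> R) (u v : V * R -> R).
Hypothesis T0 : (0 < T)%R.
Hypothesis esu : entropy_solution f A nu T u0 u.
Hypothesis esv : entropy_solution f A nu T v0 v.

Let U := extU T u : Q -> R.
Let W := extU T v : Q -> R.
Let iU : lebQ.-integrable setT (EFin \o U) := integrable_extU T0 esu.
Let iW : lebQ.-integrable setT (EFin \o W) := integrable_extU T0 esv.

Lemma dblavg_nonincreasing e t0 t1 :
  (0 < e)%R -> (t0 <= t1)%R -> (0 < t0 - e)%R -> (t1 + e < T)%R ->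
  dblavg U W e t1 <= dblavg U W e t0.
Proof.
move=> e0 t01 te0 te1.
have [h _] := doubling_ge0 lf lA A0 ndA inu e0 t01 te0 te1 esu esv T0.
have i0 := integrable_dblavg iU iW e0 t0.
have i1 := integrable_dblavg iU iW e0 t1.
have i01 := integrableB measurableT i0 i1.
have e2 : (0 < 2 / e)%R by rewrite divr_gt0.
(* By [dthetaD] the symmetrised time derivative is 2/e times the difference of the kernels at t0 and
   t1. *)
have E : \int[lebQQ]_pq (Defs.eta (extU T v pq.2) (extU T u pq.1) *
      (dker e t0 t1 pq + dker e t0 t1 (pq.2, pq.1)))%:E =
    (2 / e)%:E * (dblavg U W e t0 - dblavg U W e t1).
  apply: (etrans _ (etrans (integralZl measurableT i01 (2 / e))
    (congr1 _ (integralB measurableT i0 i1)))).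
  apply: eq_integral => -[p q] _; rewrite /= -EFinB -EFinM; congr EFin.
  rewrite /dker /dblavg_fun /Defs.eta /= -[(q.1 - p.1)%R]opprB mollN -mulrDr dthetaD.
  by rewrite -[U p]/(extU T u p) -[W q]/(extU T v q); ring.
have f1 : dblavg U W e t1 \is a fin_num by exact: integrable_fin_num i1.
move: h; rewrite E; move: (dblavg U W e t0) (dblavg U W e t1) f1 => X Y fY.
by rewrite pmule_rge0 ?lte_fin// leeBrDr// add0e.
Qed.

Let slice (t : R) : \bar R := \int[lam]_x `|(u (x, t) - v (x, t))%:E|.

Let measurable_slice w0 w t : entropy_solution f A nu T w0 w -> (0 <= t <= T)%R ->
  measurable_fun setT (fun x : V => w (x, t)).
Proof. by move=> es tT; have /integrableP[/measurable_EFinP] := integrable_slice es tT. Qed.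

Lemma slice_nonincreasing_interior t0 t1 : (0 < t0)%R -> (t0 <= t1)%R -> (t1 < T)%R ->
  slice t1 <= slice t0.
Proof.
move=> t00 t01 t1T.
have t0T : (0 <= t0 <= T)%R by apply/andP; split; lra.
have t1T' : (0 <= t1 <= T)%R by apply/andP; split; lra.
(* Below del the regularised distance gives the true one up to 3 s on either side; tau and T - tau
   enter del so that the time window stays where U and W coincide with u and v. *)
have steady tau s : (0 < tau < T)%R -> (0 < s)%R -> exists2 del : R, (0 < del)%R &
    forall e, (0 < e <= del)%R ->
  [/\ dblavg U W e tau <= (slice tau * xmass d e + (3 * s)%:E * xmass d e) * tmass e &
    slice tau * xmass d e * tmass e <= dblavg U W e tau + (3 * s)%:E * xmass d e * tmass e].
  move=> tauT s0; have /andP[tau0 tauT1] := tauT.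
  have tauT' : (0 <= tau <= T)%R by apply/andP; split; lra.
  have [d1 d10 h1] := entropy_slice_near esu tauT' s0.
  have [d2 d20 h2] := entropy_slice_near esv tauT' s0.
  have [d3 d30 h3] := L1_shift_modulus (integrable_slice esv tauT') s0.
  pose del := Num.min (Num.min d1 (Num.min d2 d3)) (Num.min tau (T - tau)%R).
  exists del; first by rewrite !lt_min d10 d20 d30 tau0 subr_gt0.
  move=> e /andP[e0]; rewrite !le_min => /andP[/and3P[e1 e2 e3] /andP[et eT]].
  have E (w : V * R -> R) t x : (`|t - tau| < e)%R -> extU T w (x, t) = w (x, t).
    rewrite ltr_norml => /andP[? ?]; rewrite extUE//; apply/andP; split; lra.
  have tE : (`|tau - tau| < e)%R by rewrite subrr normr0.
  have sE : slice tau = \int[lam]_x `|(U (x, tau) - W (x, tau))%:E|.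
    by apply: eq_integral => x _; rewrite /U /W !E.
  have tI t : (`|t - tau| < e)%R -> (0 <= t <= T)%R.
    by rewrite ltr_norml => /andP[? ?]; apply/andP; split; lra.
  rewrite sE.
  have hU t : (`|t - tau| < e)%R -> \int[lam]_x `|(U (x, t) - U (x, tau))%:E| <= s%:E.
    move=> te; apply: (le_trans _ (h1 t (tI t te) (lt_le_trans te e1))).
    by apply: le_integral_any => x _; rewrite /U !E.
  have hW t : (`|t - tau| < e)%R -> \int[lam]_x `|(W (x, t) - W (x, tau))%:E| <= s%:E.
    move=> te; apply: (le_trans _ (h2 t (tI t te) (lt_le_trans te e2))).
    by apply: le_integral_any => x _; rewrite /W !E.
  have hS (a : V) : (forall i, `|a 0%R i| < e)%R ->
      \int[lam]_x `|(W ((x + a)%R, tau) - W (x, tau))%:E| <= s%:E.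
    move=> ae; apply: (le_trans _ (h3 a (fun i => lt_le_trans (ae i) e3))).
    by apply: le_integral_any => x _; rewrite /W !E.
  by have [] := dblavg_compare iU iW e0 hU hW hS (ltW s0).
apply/lee_addgt0Pr => s s0.
(* Each of the two times costs 3 * (s / 6), so the total error is s. *)
have s6 : (0 < s / 6)%R by rewrite divr_gt0.
have [|d0 d00 h0] := steady t0 (s / 6)%R _ s6; first by apply/andP; split; lra.
have [|d1 d10 h1] := steady t1 (s / 6)%R _ s6; first by apply/andP; split; lra.
pose e := Num.min (Num.min d0 d1) (Num.min (t0 / 2) ((T - t1) / 2))%R.
have e0 : (0 < e)%R by rewrite !lt_min d00 d10 !divr_gt0// subr_gt0.
have : (e <= e)%R by []; rewrite {2}/e !le_min => /andP[/andP[ed0 ed1] /andP[et0 et1]].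
have [hu _] : _ /\ _ := h0 e ltac:(by rewrite e0).
have [_ hl] := h1 e ltac:(by rewrite e0).
have X10 : dblavg U W e t1 <= dblavg U W e t0.
  by apply: dblavg_nonincreasing => //; move: e0 et0 et1; lra.
have s3 : (0 <= 3 * (s / 6))%R by rewrite mulr_ge0// ltW.
have := le_of_weighted_averages (integral_ge0 _ _) (xmass_gt0 d e0) (xmass_lty d e0)
  (tmass_gt0 e0) (tmass_lty e0) s3 hu hl X10.
by rewrite (_ : (2 * (3 * (s / 6)) = s)%R); [apply|lra].
Qed.

(** Test functions are supported in the open Q_T, so time 0 is reached only by continuity in L^1: at
    a small time the distance exceeds that at 0 by at most s / 2 for each solution. *)
Lemma slice_le_init t : (0 < t < T)%R -> slice t <= slice 0%R.
Proof.
move=> /andP[t0 tT]; apply/lee_addgt0Pr => s s0.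
have s2 : (0 < s / 2)%R by rewrite divr_gt0.
have T00 : ((0 : R) <= 0 <= T)%R by apply/andP; split; [exact: lexx|exact: ltW].
have [d1 d10 h1] := entropy_slice_near esu T00 s2.
have [d2 d20 h2] := entropy_slice_near esv T00 s2.
pose r := Num.min (t / 2)%R (Num.min (d1 / 2) (d2 / 2))%R.
have r0 : (0 < r)%R by rewrite !lt_min !divr_gt0.
have : (r <= r)%R by []; rewrite {2}/r !le_min => /andP[rt /andP[rd1 rd2]].
have rE : (`|r - 0| = r)%R by rewrite subr0 gtr0_norm.
have rT : (0 <= r <= T)%R by apply/andP; split; move: r0 t0 tT rt; lra.
have rt' : (r <= t)%R by move: r0 t0 rt; lra.
apply: (le_trans (slice_nonincreasing_interior r0 rt' tT)).
have {}h1 := h1 r rT ltac:(rewrite rE; move: d10 rd1; lra).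
have {}h2 := h2 r rT ltac:(rewrite rE; move: d20 rd2; lra).
have mu0 := measurable_slice esu T00; have mv0 := measurable_slice esv T00.
have mur := measurable_slice esu rT; have mvr := measurable_slice esv rT.
have mabs (h k : V -> R) : measurable_fun setT h -> measurable_fun setT k ->
    measurable_fun setT (fun x => `|(h x - k x)%:E|).
  move=> mh mk; have mE := (measurable_EFinP setT _).2 (measurable_funB mh mk).
  exact: (measurableT_comp (@abse_measurable R setT) mE).
have m1 := mabs _ _ mu0 mv0; have m2 := mabs _ _ mur mu0; have m3 := mabs _ _ mvr mv0.
have ge0 (h : V -> R) x : setT x -> 0 <= `|(h x)%:E| by [].
have E1 := ge0_integralD lam measurableT (ge0 (fun x => u (x, 0%R) - v (x, 0%R))%R) m1
  (ge0 (fun x => u (x, r) - u (x, 0%R))%R) m2.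
have m12 := emeasurable_funD m1 m2.
have E2 := ge0_integralD lam measurableT (fun x Dx => adde_ge0
  (ge0 (fun x => u (x, 0%R) - v (x, 0%R))%R x Dx)
  (ge0 (fun x => u (x, r) - u (x, 0%R))%R x Dx)) m12
  (ge0 (fun x => v (x, r) - v (x, 0%R))%R) m3.
apply: (@le_trans _ _ (slice 0%R + (s / 2)%:E + (s / 2)%:E)); last first.
  by rewrite -addeA leeD2l// -EFinD lee_fin; move: s0; lra.
apply: (le_trans _ (leeD (leeD (lexx _) h1) h2)).
rewrite -E1 -E2; apply: le_integral_any => x _.
rewrite !abse_EFin -!EFinD lee_fin.
rewrite (_ : u (x, r) - v (x, r) = (u (x, 0) - v (x, 0)) + (u (x, r) - u (x, 0)) -
  (v (x, r) - v (x, 0)))%R; last by ring.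
apply: (le_trans (ler_normB _ _)); rewrite lerD2r.
exact: ler_normD.
Qed.

(** [u0] and [v0] carry no measurability, so almost-everywhere equality of the integrands is not
    enough. The null set is removed from the left integral, whose integrand is measurable, and the
    rest is a pointwise comparison by [le_integral_any]. *)
Lemma slice_init_le : slice 0%R <= \int[lam]_x `|(u0 x - v0 x)%:E|.
Proof.
have T00 : ((0 : R) <= 0 <= T)%R by apply/andP; split; [exact: lexx|exact: ltW].
have mu0 := measurable_slice esu T00; have mv0 := measurable_slice esv T00.
have [N [mN N0 sN]] : {ae lam, forall x, u (x, 0%R) = u0 x /\ v (x, 0%R) = v0 x}.
  exact: filterS2 (entropy_init esu) (entropy_init esv).
have mE := (measurable_EFinP setT _).2 (measurable_funB mu0 mv0).
have m1 := measurableT_comp (@abse_measurable R setT) mE.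
have g0 (x : V) : setT x -> 0 <= `|(u (x, 0%R) - v (x, 0%R))%:E| by move=> _; exact: abse_ge0.
apply: (eq_ind_r (fun z => z <= _) _ (ge0_negligible_integral mN measurableT m1 g0 N0)).
rewrite integral_mkcond; apply: le_integral_any => x _; rewrite patchE.
case: ifPn => [|_]; last exact: abse_ge0.
rewrite inE => -[_ nNx].
have [hu hv] : u (x, 0%R) = u0 x /\ v (x, 0%R) = v0 x.
  by apply: contrapT => h; apply: nNx; exact: sN.
by rewrite /= hu hv.
Qed.

End contraction.

Local Close Scope ereal_scope.

Theorem theorem5p2 (R : realType) (d : nat) (T : R)
    (f : R -> 'rV[R]_d) (A : R -> R)
    (mu : {measure set 'rV[R]_d -> \bar R})
    (u0 v0 : 'rV[R]_d -> R) (u v : 'rV[R]_d * R -> R) :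
  (1 <= d)%N -> 0 < T ->
  lipschitz f -> lipschitz A -> {homo A : x y / x <= y} -> A 0 = 0 ->
  levy_measure mu ->
  entropy_solution f A mu T u0 u ->
  entropy_solution f A mu T v0 v ->
  forall t, 0 < t < T ->
    ('N[lebesgue_rV R d]_1[(fun x => (u (x, t) - v (x, t))%:E)]
       <= 'N[lebesgue_rV R d]_1[(fun x => (u0 x - v0 x)%:E)])%E.
Proof.
move=> _ T0 lf lA ndA A0 [_ imu] esu esv t tT.
have [nu munu] := levy_sigma_finite imu.
have inu := eq_levy_integrable munu imu.
have esu' := entropy_solution_eq_levy munu esu.
have esv' := entropy_solution_eq_levy munu esv.
rewrite !Lnorm1.
apply: le_trans (slice_init_le T0 esu' esv').
exact: (slice_le_init lf lA A0 ndA inu T0 esu' esv' tT).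
Qed.
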